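(* Let $N \ge 2$, let $g_1,\ldots,g_N \in \mathbb{R}$ and $\sigma_1,\ldots,\sigma_N > 0$, and let $X$ be a classical system of $N$ competing Brownian particles with drift coefficients $g_1,\ldots,g_N$ and diffusion coefficients $\sigma_1^2,\ldots,\sigma_N^2$. Suppose that a.s. there are no triple collisions at any moment $t > 0$. Then a.s. there are no simultaneous collisions at any moment $t > 0$.
   Context: Work on a filtered probability space $(\Omega,\mathcal F,(\mathcal F_t)_{t\ge 0},\mathbf P)$ whose filtration satisfies the usual conditions. A standard Brownian motion is a one-dimensional Brownian motion with zero drift and unit diffusion coefficient starting from the origin. For $x = (x_1,\ldots,x_N)' \in \mathbb{R}^N$, the ranking permutation $\mathbf p_x$ is the unique permutation of $\{1,\ldots,N\}$ such that $x_{\mathbf p_x(i)} \le x_{\mathbf p_x(j)}$ for $1 \le i \le j \le N$, and such that if $i<j$ and $x_{\mathbf p_x(i)} = x_{\mathbf p_x(j)}$, then $\mathbf p_x(i) < \mathbf p_x(j)$. Classical system of competing Brownian particles: let $W_1,\ldots,W_N$ be i.i.d. standard $(\mathcal F_t)_{t\ge0}$-Brownian motions. A continuous adapted $\mathbb{R}^N$-valued process $X = (X(t), t \ge 0)$, $X(t) = (X_1(t),\ldots,X_N(t))'$, is called a classical system of $N$ competing Brownian particles with drift coefficients $g_1,\ldots,g_N$ and diffusion coefficients $\sigma_1^2,\ldots,\sigma_N^2$ if, with $\mathbf p_t := \mathbf p_{X(t)}$, $$dX_i(t) = \sum_{k=1}^N 1(\mathbf p_t(k) = i)\left[g_k\,dt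 + \sigma_k\,dW_i(t)\right],\quad i = 1,\ldots,N.$$ The $k$th ranked particle is the process $Y_k(t) := X_{\mathbf p_t(k)}(t)$, so that $Y_1(t) \le \ldots \le Y_N(t)$. A triple collision at time $t$ occurs if there is $k \in \{2,\ldots,N-1\}$ with $Y_{k-1}(t) = Y_k(t) = Y_{k+1}(t)$. A simultaneous collision at time $t$ occurs if there are $k \ne l$ in $\{1,\ldots,N-1\}$ with $Y_k(t) = Y_{k+1}(t)$ and $Y_l(t) = Y_{l+1}(t)$. *)

(* Defs.v *)
From HB Require Import structures.
From mathcomp Require Import all_boot all_order all_algebra all_fingroup.
From mathcomp Require Import all_classical all_reals all_analysis.

Set Implicit Arguments.
Unset Strict Implicit.
Unset Printing Implicit Defensive.

Import Order.TTheory GRing.Theory Num.Theory.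
Import numFieldNormedType.Exports.

Local Open Scope classical_set_scope.
Local Open Scope ring_scope.

(* Ranks and names of particles are both elements of 'I_N, counted from 0.  *)

Section ranking.
Context {R : realType} {N : nat}.
Implicit Types (x : 'cV[R]_N) (p : 'S_N).

Definition is_ranking_perm x p : Prop :=
  (forall i j : 'I_N, (i <= j)%N -> x (p i) ord0 <= x (p j) ord0) /\
  (forall i j : 'I_N, (i < j)%N -> x (p i) ord0 = x (p j) ord0 ->
     (p i < p j)%N).

(* The default value is never used: see rank_permP and rank_perm_unique. *)
Definition rank_perm x : 'S_N := xget 1%g [set p | is_ranking_perm x p].

Definition ranked x (k : 'I_N) : R := x (rank_perm x k) ord0.

Let lexle x (i j : 'I_N) : bool :=
  (x i ord0 < x j ord0) || ((x i ord0 == x j ord0) && (i <= j)%N).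

Let lexle_total x : total (lexle x).
Proof.
by move=> i j; rewrite /lexle; case: ltgtP => //= _; exact: leq_total.
Qed.

Let lexle_trans x : transitive (lexle x).
Proof.
move=> j i k /orP[ij|/andP[/eqP ij lij]] /orP[jk|/andP[/eqP jk ljk]].
- by rewrite /lexle (lt_trans ij jk).
- by rewrite /lexle -jk ij.
- by rewrite /lexle ij jk.
- by rewrite /lexle ij jk eqxx (leq_trans lij ljk) orbT.
Qed.

Let lexle_anti x : antisymmetric (lexle x).
Proof.
move=> i j; rewrite /lexle; case: ltgtP => //= _ ij.
by apply/val_inj/eqP; rewrite eqn_leq.
Qed.

Lemma rank_permP x : is_ranking_perm x (rank_perm x).
Proof.
rewrite /rank_perm; case: xgetP => [p _ //|noP]; exfalso.
pose s := sort (lexle x) (enum 'I_N).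
have ss : size s = N by rewrite size_sort size_enum_ord.
have us : uniq s by rewrite sort_uniq enum_uniq.
have finj : injective (fun k : 'I_N => nth k s k).
  move=> i j; rewrite (set_nth_default i j) ?ss// => /eqP.
  by rewrite nth_uniq ?ss// => /eqP/val_inj.
pose p : 'S_N := perm finj.
have pE (i j : 'I_N) : (i < j)%N -> lexle x (p i) (p j).
  move=> ij; rewrite !permE (set_nth_default i j) ?ss//.
  have /(sorted_ltn_nth (@lexle_trans x)) : sorted (lexle x) s.
    exact: sort_sorted (@lexle_total x) _.
  by apply=> //; rewrite inE ss.
apply: (noP p); split => i j.
- rewrite leq_eqVlt => /orP[/eqP/val_inj ->//|/pE].
  by rewrite /lexle => /orP[/ltW//|/andP[/eqP-> _]].
- move=> ij xij; have := pE _ _ ij.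
  rewrite /lexle xij ltxx eqxx /= leq_eqVlt => /orP[/eqP/val_inj/perm_inj e|//].
  by rewrite e ltnn in ij.
Qed.

Lemma rank_perm_unique x p : is_ranking_perm x p -> p = rank_perm x.
Proof.
move=> hp.
have srt (q : 'S_N) : is_ranking_perm x q ->
    sorted (lexle x) [seq q i | i <- enum 'I_N].
  move=> [q1 q2]; rewrite sorted_map.
  apply: (@sub_sorted _ (fun i j : 'I_N => (i < j)%N)).
    move=> i j /= ij; rewrite /lexle; have := q1 _ _ (ltnW ij).
    rewrite le_eqVlt => /orP[/eqP e|->//].
    by rewrite e eqxx (ltnW (q2 _ _ ij e)) orbT.
  have := iota_ltn_sorted 0 N; rewrite -val_enum_ord sorted_map.
  exact: sub_sorted.
have enumP (q : 'S_N) : perm_eq [seq q i | i <- enum 'I_N] (enum 'I_N).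
  apply: uniq_perm; [|exact: enum_uniq|].
    by rewrite (map_inj_uniq (@perm_inj _ q)) enum_uniq.
  move=> i; rewrite mem_enum; apply/mapP; exists ((q^-1)%g i).
    by rewrite mem_enum.
  by rewrite permKV.
have E : [seq p i | i <- enum 'I_N] = [seq rank_perm x i | i <- enum 'I_N].
  apply: (sorted_eq (@lexle_trans x) (@lexle_anti x)).
  - exact: srt.
  - exact: srt (rank_permP x).
  - by rewrite (perm_trans (enumP p))// perm_sym.
by apply/permP => i; move/eq_in_map : E; apply; rewrite mem_enum.
Qed.

Definition triple_collision x : Prop :=
  exists i j k : 'I_N, [/\ j = i.+1 :> nat, k = j.+1 :> nat,
    ranked x i = ranked x j & ranked x j = ranked x k].

Definition simultaneous_collision x : Prop :=
  exists k k' l l' : 'I_N, [/\ k' = k.+1 :> nat, l' = l.+1 :> nat, k <> l,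
    ranked x k = ranked x k' & ranked x l = ranked x l'].

End ranking.

(* Time is the half-line [0, +oo[ of R; the values of filtrations and        *)
(* processes at negative times are never constrained.                        *)

Section stochastic_basis.
Context {R : realType} {d : measure_display} {T : measurableType d}.
Variables (P : probability T R) (F : R -> set_system T).

Record usual_conditions : Prop := {
  filtration_sigma_algebra : forall t, 0 <= t -> sigma_algebra setT (F t) ;
  filtration_measurable : forall t, 0 <= t -> F t `<=` measurable ;
  filtration_nondecreasing : forall s t : R, 0 <= s -> s <= t -> F s `<=` F t ;
  filtration_right_continuous : forall t, 0 <= t ->
    F t = \bigcap_(s in [set s | t < s]) F s ;
  filtration_complete : P.-negligible `<=` F 0 }.

Definition measurable_wrt (G : set_system T) (f : T -> R) : Prop :=
  forall B : set R, measurable B -> G (f @^-1` B).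

Definition adapted (H : R -> T -> R) : Prop :=
  forall t, 0 <= t -> measurable_wrt (F t) (H t).

Definition jointly_measurable (H : R -> T -> R) : Prop :=
  measurable_fun [set z : R * T | 0 <= z.1] (fun z => H z.1 z.2).

Definition continuous_paths (H : R -> T -> R) : Prop :=
  forall w, {within `[0, +oo[, continuous (fun t => H t w)}.

Definition increment (W : R -> T -> R) (s t : R) (w : T) : R := W t w - W s w.

Definition is_standard_brownian (W : R -> T -> R) : Prop :=
  [/\ adapted W, continuous_paths W, {ae P, forall w, W 0 w = 0},
    (forall s t : R, 0 <= s -> s < t -> forall B : set R, measurable B ->
       P (increment W s t @^-1` B) =
       normal_prob 0 (Num.sqrt (t - s)) B) &
    (forall s t : R, 0 <= s -> s < t ->
       forall (A : set T) (B : set R), F s A -> measurable B ->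
       P (A `&` increment W s t @^-1` B) =
       (P A * P (increment W s t @^-1` B))%E)].

Definition sigma_process (W : R -> T -> R) : set_system T :=
  <<s [set A | exists t (B : set R),
         [/\ 0 <= t, measurable B & A = W t @^-1` B]] >>.

(* As each sigma-algebra contains the whole space, the product rule for the  *)
(* full family includes the one for every subfamily.                         *)
Definition independent_processes (n : nat) (W : 'I_n -> R -> T -> R) : Prop :=
  forall A : 'I_n -> set T, (forall i, sigma_process (W i) (A i)) ->
    P (\bigcap_i A i) = (\prod_(i < n) P (A i))%E.

Record simple_process := {
  sp_size : nat ;
  sp_time : nat -> R ;
  sp_coef : nat -> T -> R ;
  sp_time_ge0 : 0 <= sp_time 0%N ;
  sp_time_nondecreasing : forall j, sp_time j <= sp_time j.+1 ;
  sp_coef_measurable : forall j, measurable_wrt (F (sp_time j)) (sp_coef j) ;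
  sp_coef_bounded : exists C, forall j w, `|sp_coef j w| <= C }.

Definition simple_eval (S : simple_process) (t : R) (w : T) : R :=
  \sum_(j < sp_size S)
    sp_coef S j w * (sp_time S j < t <= sp_time S j.+1)%R%:R.

Definition simple_integral (W : R -> T -> R) (S : simple_process)
    (t : R) (w : T) : R :=
  \sum_(j < sp_size S) sp_coef S j w *
    (W (Num.min (sp_time S j.+1) t) w - W (Num.min (sp_time S j) t) w).

(* M is (a continuous version of) the Ito integral of H with respect to W,   *)
(* from time 0: the L^2 limit of the integrals of simple processes that      *)
(* converge to H in L^2([0, t] x T) for all t. This covers the               *)
(* integrands with E \int_0^t H^2 ds < +oo for all t, in particular the      *)
(* bounded ones, and determines M up to indistinguishability.                *)
Definition is_ito_integral (W H M : R -> T -> R) : Prop :=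
  [/\ adapted H,
      jointly_measurable H,
      adapted M, continuous_paths M &
      exists S : nat -> simple_process, forall t, 0 <= t ->
        ((\int[P]_w \int[lebesgue_measure]_(s in `[0%R, t])
             ((simple_eval (S n) s w - H s w) ^+ 2)%:E)%E
           @[n --> \oo] --> 0%E) /\
        ((\int[P]_w ((simple_integral W (S n) t w - M t w) ^+ 2)%:E)%E
           @[n --> \oo] --> 0%E)].

(* X(t) = X(0) + \int_0^t b(s) ds + \int_0^t a(s) dW(s) for all t >= 0, a.s. *)
Definition has_ito_differential (X b a W : R -> T -> R) : Prop :=
  exists2 M, is_ito_integral W a M &
    {ae P, forall w, forall t, 0 <= t ->
      X t w = X 0 w + \int[lebesgue_measure]_(s in `[0, t]) b s w + M t w}.

Record classical_competing_brownian_particles (N : nat)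
    (g sigma : 'I_N -> R) (W : 'I_N -> R -> T -> R)
    (X : R -> T -> 'cV[R]_N) : Prop := {
  cbp_brownian : forall i, is_standard_brownian (W i) ;
  cbp_independent : independent_processes W ;
  cbp_adapted : forall i, adapted (fun t w => X t w i ord0) ;
  cbp_continuous : forall i, continuous_paths (fun t w => X t w i ord0) ;
  cbp_sde : forall i, has_ito_differential
    (fun t w => X t w i ord0)
    (fun t w => \sum_(k < N) (rank_perm (X t w) k == i)%:R * g k)
    (fun t w => \sum_(k < N) (rank_perm (X t w) k == i)%:R * sigma k)
    (W i) }.

End stochastic_basis.

(* Main.v *)
(** Without triple collisions, a simultaneous collision at time t0 involves two
disjoint pairs (a, b) and (c, c') of particles, of adjacent ranks k, k+1 and
l, l+1. As long as the strict inequalities between coordinates that hold at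
time t0 persist, which is an open condition, a and b share the ranks k, k+1 and
c and c' the ranks l, l+1. So in a neighbourhood of t0, and whatever the order
inside the pairs, D1 = (X_a - X_b) / sqrt (sigma_k^2 + sigma_(k+1)^2) and its
analogue D2 form a planar semimartingale with bounded drift and bracket t Id,
and it suffices that such a process does not hit the origin.

Put w = D1^2 + D2^2 + e. As ln is harmonic in the plane and the drift is
bounded, the drift of ln w + K sqrt w is at least 1 / sqrt w for K large. Since
the potential is of order ln e near the origin, letting e tend to 0 shows that
the origin is not hit from a positive distance; since the integral of
1 / sqrt w would be of order e^(-1/2), D1 and D2 do not vanish together on an
interval either. There are countably many choices of the pairs, the order
relation, rational time intervals and rational distances.

In place of an Ito formula, the potential is expanded on a regular grid; the
third-order remainder is controlled by psi x = x^2 min (1, |x|), whose sum over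
the increments tends to 0 in mean. *)

Require Import Defs.
From HB Require Import structures.
From mathcomp Require Import all_boot all_order all_algebra all_fingroup.
From mathcomp Require Import all_classical all_reals all_analysis.
From mathcomp Require Import measurable_realfun ring lra zify.

Set Implicit Arguments.
Unset Strict Implicit.
Unset Printing Implicit Defensive.

Import Order.TTheory GRing.Theory Num.Theory.
Import numFieldNormedType.Exports.

Local Open Scope classical_set_scope.
Local Open Scope ring_scope.

(** * Real-valued integrals *)

(** The filtration may be larger than the one generated by the [W i]. Each [W i] has increments
    independent of the past, and the [W i] are mutually independent as processes, but nothing says
    that the increments of two of them are jointly independent of the past. The orthogonality of the
    martingale parts must therefore be proved; it comes from products of increments over ever finer
    subdivisions ([cross_increment]). Stopping is done on the grid. D1 and D2 are defined for all
    times, and their brackets differ from the planar one by defects that vanish while the particles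
    remain separated. A path is dropped at the first grid point where it is outside the region. How
    long the defects vanish after a good grid point depends on the path, so their total is removed
    by dominated convergence as the mesh tends to 0. Conditional expectations are replaced by
    expectations against bounded variables of the past. The constants of the expansion blow up as e
    tends to 0, but they only multiply quantities that vanish with the mesh: the final bound is
    uniform in e. *)

Section real_valued_integrals.
Context d (T : measurableType d) (R : realType).
Variable mu : {measure set T -> \bar R}.

(** [Rintegral] is the [fine] of an extended integral, hence 0 when that integral is infinite;
    integrability is therefore carried along explicitly. *)
Definition itg (D : set T) (f : T -> R) := mu.-integrable D (EFin \o f).

Variable D : set T.
Hypothesis mD : measurable D.
Implicit Types (f g h : T -> R).

Lemma itg_measurable f : itg D f -> measurable_fun D f.
Proof. by move=> /integrableP[/measurable_EFinP]. Qed.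

Lemma eq_itg f g : (forall x, D x -> f x = g x) -> itg D f -> itg D g.
Proof.
by move=> fg; apply: eq_integrable => // x; rewrite inE /= => /fg ->.
Qed.

Lemma eq_rint f g : (forall x, D x -> f x = g x) ->
  \int[mu]_(x in D) f x = \int[mu]_(x in D) g x.
Proof. by move=> fg; apply: eq_Rintegral => x; rewrite inE => /fg. Qed.

Lemma itg_le g f : measurable_fun D f -> itg D g ->
  (forall x, D x -> `|f x| <= g x) -> itg D f.
Proof.
move=> mf ig fg; apply: le_integrable ig => //.
  exact/measurable_EFinP.
move=> x Dx; rewrite /= lee_fin; apply: le_trans (fg x Dx) _.
exact: ler_norm.
Qed.

Lemma itg0 : itg D (fun=> 0).
Proof. exact: integrable0. Qed.

Lemma itgD f g : itg D f -> itg D g -> itg D (fun x => f x + g x).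
Proof. by move=> hf hg; apply: (integrableD mD hf hg). Qed.

Lemma itgB f g : itg D f -> itg D g -> itg D (fun x => f x - g x).
Proof. by move=> hf hg; apply: (integrableB mD hf hg). Qed.

Lemma itgZ c f : itg D f -> itg D (fun x => c * f x).
Proof. by move=> hf; apply: (integrableZl mD c hf). Qed.

Lemma itg_norm f : itg D f -> itg D (fun x => `|f x|).
Proof. exact: integrable_norm. Qed.

Lemma itg_sum (I : Type) (s : seq I) (p : pred I) (F : I -> T -> R) :
  (forall i, p i -> itg D (F i)) -> itg D (fun x => \sum_(i <- s | p i) F i x).
Proof.
move=> hF; elim: s => [|i s IH].
  by apply: eq_itg itg0 => x _; rewrite big_nil.
case: (boolP (p i)) => pi; last first.
  by apply: eq_itg IH => x _; rewrite big_cons (negbTE pi).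
by apply: eq_itg (itgD (hF i pi) IH) => x _; rewrite big_cons pi.
Qed.

Lemma itg_mulb f h C : itg D f -> measurable_fun D h ->
  (forall x, D x -> `|h x| <= C) -> itg D (fun x => h x * f x).
Proof.
move=> hf mh hC; apply: (@itg_le (fun x => C * `|f x|)).
- by apply: measurable_funM => //; exact: itg_measurable.
- exact/itgZ/itg_norm.
- by move=> x Dx; rewrite normrM ler_wpM2r// hC.
Qed.

Lemma itg_mul_sq f g : measurable_fun D f -> measurable_fun D g ->
  itg D (fun x => f x ^+ 2) -> itg D (fun x => g x ^+ 2) ->
  itg D (fun x => f x * g x).
Proof.
move=> mf mg hf hg; apply: (itg_le _ (itgD hf hg)).
  exact: measurable_funM.
move=> x _; rewrite ler_norml; apply/andP; split.
- have := sqr_ge0 (f x + g x); have := sqr_ge0 (f x); have := sqr_ge0 (g x); nra.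
- have := sqr_ge0 (f x - g x); have := sqr_ge0 (f x); have := sqr_ge0 (g x); nra.
Qed.

Lemma itg_sqrD f g : measurable_fun D f -> measurable_fun D g ->
  itg D (fun x => f x ^+ 2) -> itg D (fun x => g x ^+ 2) ->
  itg D (fun x => (f x + g x) ^+ 2).
Proof.
move=> mf mg hf hg; have hh := itgD (itgZ 2 hf) (itgZ 2 hg).
apply: (itg_le _ hh); first by apply: measurable_funX; exact: measurable_funD.
move=> x _; rewrite ger0_norm ?sqr_ge0//.
by have := sqr_ge0 (f x - g x); nra.
Qed.

Lemma rintD f g : itg D f -> itg D g -> \int[mu]_(x in D) (f x + g x) =
  \int[mu]_(x in D) f x + \int[mu]_(x in D) g x.
Proof. exact: RintegralD. Qed.

Lemma rintB f g : itg D f -> itg D g -> \int[mu]_(x in D) (f x - g x) =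
  \int[mu]_(x in D) f x - \int[mu]_(x in D) g x.
Proof. exact: RintegralB. Qed.

Lemma rintZ c f : itg D f -> \int[mu]_(x in D) (c * f x) =
  c * \int[mu]_(x in D) f x.
Proof. exact: RintegralZl. Qed.

Lemma rint0 : \int[mu]_(x in D) (0 : R) = 0.
Proof. by rewrite Rintegral_cst// mul0r. Qed.

Lemma rint_sum (I : Type) (s : seq I) (p : pred I) (F : I -> T -> R) :
  (forall i, p i -> itg D (F i)) ->
  \int[mu]_(x in D) (\sum_(i <- s | p i) F i x) =
  \sum_(i <- s | p i) \int[mu]_(x in D) F i x.
Proof.
move=> hF; elim: s => [|i s IH].
  by under eq_rint do rewrite big_nil; rewrite big_nil rint0.
case: (boolP (p i)) => pi; rewrite big_cons ?pi ?(negbTE pi).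
  under eq_rint do rewrite big_cons pi.
  by rewrite rintD ?IH//; [exact: hF|exact: itg_sum].
by under eq_rint do rewrite big_cons (negbTE pi).
Qed.

Lemma ler_rint f g : itg D f -> itg D g -> (forall x, D x -> f x <= g x) ->
  \int[mu]_(x in D) f x <= \int[mu]_(x in D) g x.
Proof. exact: le_Rintegral. Qed.

Lemma rint_ge0 f : (forall x, D x -> 0 <= f x) -> 0 <= \int[mu]_(x in D) f x.
Proof. exact: Rintegral_ge0. Qed.

Lemma ler_rint_norm f g : itg D f -> itg D g -> (forall x, D x -> `|f x| <= g x) ->
  `|\int[mu]_(x in D) f x| <= \int[mu]_(x in D) g x.
Proof.
move=> hf hg fg; apply: le_trans (le_normr_Rintegral mD hf) _.
by apply: ler_rint => //; exact: itg_norm.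
Qed.

Lemma EFin_rint f : itg D f ->
  (\int[mu]_(x in D) f x)%:E = (\int[mu]_(x in D) (f x)%:E)%E.
Proof. by move=> hf; rewrite /Rintegral fineK//; exact: integrable_fin_num. Qed.

Lemma itg_ge0P f : measurable_fun D f -> (forall x, D x -> 0 <= f x) ->
  (\int[mu]_(x in D) (f x)%:E < +oo)%E -> itg D f.
Proof.
move=> mf f0 foo; apply/integrableP; split; first exact/measurable_EFinP.
rewrite (eq_integral (fun x => (f x)%:E))// => x; rewrite inE => Dx /=.
by rewrite ger0_norm// f0.
Qed.

End real_valued_integrals.

Section finite_measure_integrals.
Context d (T : measurableType d) (R : realType).
Variable mu : {measure set T -> \bar R}.
Variable D : set T.
Hypotheses (mD : measurable D) (muD : (mu D < +oo)%E).

Lemma itg_cst (c : R) : itg mu D (fun=> c).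
Proof.
apply/integrableP; split; first exact: measurable_cst.
by rewrite integral_cst// lte_mul_pinfty.
Qed.

Lemma itg_bounded (f : T -> R) C : measurable_fun D f ->
  (forall x, D x -> `|f x| <= C) -> itg mu D f.
Proof. by move=> mf fC; exact: itg_le (itg_cst C) fC. Qed.

End finite_measure_integrals.

(** * Independence and Gaussian moments *)

Section independence.
Context d (T : measurableType d) (R : realType) (P : probability T R).

Lemma integrable_distribution d' (T' : measurableType d') (X : {RV P >-> T'})
    (f : T' -> \bar R) : measurable_fun setT f ->
  P.-integrable setT (f \o X) -> (distribution P X).-integrable setT f.
Proof.
move=> mf /integrableP[_ foo]; apply/integrableP; split => //.
by rewrite ge0_integral_distribution//; exact: measurableT_comp.
Qed.

(** By hypothesis the law of the pair (f, g) agrees with the product of the two laws on rectangles,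
    hence everywhere; Fubini applied to x y factors the expectation. *)
Lemma indep_expectation (f g : T -> R) :
  itg P setT f -> itg P setT g ->
  (forall A B : set R, measurable A -> measurable B ->
    P (f @^-1` A `&` g @^-1` B) = (P (f @^-1` A) * P (g @^-1` B))%E) ->
  itg P setT (fun w => f w * g w) /\
  \int[P]_w (f w * g w) = (\int[P]_w f w) * \int[P]_w g w.
Proof.
move=> hf hg fg.
have mf := itg_measurable hf; have mg := itg_measurable hg.
pose X : {mfun T >-> R} := HB.pack f (isMeasurableFun.Build _ _ _ _ _ mf).
pose Y : {mfun T >-> R} := HB.pack g (isMeasurableFun.Build _ _ _ _ _ mg).
pose fg0 (w : T) := (f w, g w).
have mZ : measurable_fun setT fg0 by exact/measurable_fun_pair.
pose Z : {mfun T >-> (R * R)%type} := HB.pack fg0 (isMeasurableFun.Build _ _ _ _ _ mZ).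
pose F (z : R * R) := (z.1 * z.2)%:E.
have mF : measurable_fun setT F.
  by apply/measurable_EFinP; apply: measurable_funM.
have lawE A : measurable A ->
    ((distribution P X \x distribution P Y) A = distribution P Z A)%E.
  move=> mA; by apply: (@product_measure_unique _ _ _ _ _ (distribution P X)
    (distribution P Y) (distribution P Z)).
have mEid : measurable_fun [set: R] (EFin \o (@idfun R)).
  by apply/measurable_EFinP; exact: measurable_id.
have iX : (distribution P X).-integrable setT (EFin \o (@idfun R)).
  exact: (@integrable_distribution _ _ X _ mEid hf).
have iY : (distribution P Y).-integrable setT (EFin \o (@idfun R)).
  exact: (@integrable_distribution _ _ Y _ mEid hg).
have iF : ((distribution P X \x distribution P Y)%E).-integrable setT F.
  apply/integrable12ltyP => //.
  rewrite (eq_integral (fun x : R => (`|x|%:E * \int[distribution P Y]_y `|y|%:E)%E)); last first.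
    move=> x _; rewrite -ge0_integralZl//=.
      by apply: eq_integral => y _; rewrite normrM EFinM.
    by apply/measurable_EFinP; exact: normr_measurable.
  have /integrableP[_ iY'] := iY; have /integrableP[_ iX'] := iX.
  rewrite ge0_integralZr//=.
  - by rewrite lte_mul_pinfty// ?integral_ge0// ge0_fin_numE// integral_ge0.
  - by apply/measurable_EFinP; exact: normr_measurable.
  - exact: integral_ge0.
have iFZ : (distribution P Z).-integrable setT F.
  have /integrableP[_ iF'] := iF; apply/integrableP; split => //.
  suff -> : (\int[distribution P Z]_z `|F z| =
      \int[(distribution P X \x distribution P Y)%E]_z `|F z|)%E by [].
  by apply: eq_measure_integral => A mA _; exact/esym/lawE.
have iFZ' : P.-integrable setT (F \o Z).
  have /integrableP[_ iF'] := iFZ; apply/integrableP; split.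
    exact: measurableT_comp.
  rewrite ge0_integral_distribution// in iF'.
  by apply: measurableT_comp.
split; first exact: iFZ'.
apply: EFin_inj; rewrite EFinM !EFin_rint//.
transitivity (\int[distribution P Z]_z F z)%E.
  by rewrite integral_distribution.
transitivity (\int[(distribution P X \x distribution P Y)%E]_z F z)%E.
  by apply: eq_measure_integral => A mA _; exact/esym/lawE.
rewrite -integral12_prod_meas1// /fubini_F /F /=.
have fY : (\int[distribution P Y]_y y%:E \is a fin_num)%E.
  exact: integrable_fin_num.
have -> : (\int[P]_w (f w)%:E = \int[distribution P X]_x x%:E)%E.
  by rewrite integral_distribution.
have -> : (\int[P]_w (g w)%:E = \int[distribution P Y]_x x%:E)%E.
  by rewrite integral_distribution.
rewrite -(fineK fY) -integralZr//.
apply: eq_integral => x _; rewrite fineK//.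
by rewrite -integralZl//; apply: eq_integral => y _; rewrite EFinM.
Qed.

End independence.

Section density.
Context d (T : measurableType d) (R : realType).
Variables (mu nu : {measure set T -> \bar R}) (p : T -> R).
Hypotheses (mp : measurable_fun setT p) (p0 : forall x, 0 <= p x).
Hypothesis nuE : forall A, measurable A -> nu A = (\int[mu]_(x in A) (p x)%:E)%E.
Local Open Scope ereal_scope.

Import HBNNSimple.

Let density_nnsfun (f : {nnsfun T >-> R}) :
  \int[nu]_x (f x)%:E = \int[mu]_x ((f x)%:E * (p x)%:E).
Proof.
under [LHS]eq_integral do rewrite fimfunE -fsumEFin//.
rewrite [LHS]ge0_integral_fsum//; last 2 first.
  - by move=> r; exact/measurable_EFinP/measurableT_comp.
  - by move=> n x _; rewrite EFinM nnfun_muleindic_ge0.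
under [RHS]eq_integral.
  move=> x xD; rewrite fimfunE -fsumEFin// muleC ge0_mule_fsumr; last first.
    by move=> r; rewrite EFinM nnfun_muleindic_ge0.
  over.
rewrite [RHS]ge0_integral_fsum//; last 2 first.
  - move=> r; apply: emeasurable_funM; first exact/measurable_EFinP.
    exact/measurable_EFinP/measurableT_comp.
  - move=> n x _; rewrite EFinM mule_ge0//; first by rewrite lee_fin.
    by rewrite nnfun_muleindic_ge0.
apply: eq_fsbigr => r _.
rewrite integralZl_indic_nnsfun//= integral_indic// setIT nuE//.
have mA : measurable (f @^-1` [set r]) by exact: measurable_funPTI.
have [r0|r0] := ltP r 0%R.
  have E : f @^-1` [set r] = set0 by rewrite preimage_nnfun0.
  rewrite E integral_set0 mule0 integral0_eq// => x _.
  by rewrite indicE in_set0 mulr0 mule0.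
rewrite integral_mkcond -ge0_integralZl//=.
- apply: eq_integral => x _; rewrite patchE indicE.
  by case: ifPn => // _; rewrite ?mulr1 ?mulr0 ?mule0// muleC.
- by apply/(measurable_restrictT _ mA)/measurable_funTS/measurable_EFinP.
- by move=> x _; rewrite patchE; case: ifPn => //; rewrite lee_fin.
Qed.

(** True for simple functions by the definition of the density, then for f by monotone convergence
    on both sides along [nnsfun_approx]. *)
Lemma ge0_integral_density (f : T -> \bar R) : measurable_fun setT f ->
  (forall x, 0 <= f x) -> \int[nu]_x f x = \int[mu]_x (f x * (p x)%:E).
Proof.
move=> mf f0; pose f_ := nnsfun_approx measurableT mf.
transitivity (limn (fun n => \int[nu]_x (f_ n x)%:E)).
  rewrite -monotone_convergence//=.
  - apply: eq_integral => ? /[!inE] xD; apply/esym/cvg_lim => //=.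
    exact: cvg_nnsfun_approx.
  - by move=> n; exact/measurable_EFinP/measurable_funTS.
  - by move=> n ? _; rewrite lee_fin.
  - by move=> ? _ ? ? mn; rewrite lee_fin; exact/lefP/nd_nnsfun_approx.
transitivity (limn (fun n => \int[mu]_x ((f_ n x)%:E * (p x)%:E))).
  by apply: congr_lim; apply/funext => n /=; exact: density_nnsfun.
rewrite -monotone_convergence//=.
- apply: eq_integral => x _; apply/cvg_lim => //=.
  apply: cvgeZr => //; exact: cvg_nnsfun_approx.
- by move=> n; apply: emeasurable_funM; apply/measurable_EFinP.
- by move=> n x _; rewrite mule_ge0// lee_fin.
- move=> x _ m n mn; rewrite lee_wpmul2r// ?lee_fin//.
  exact/lefP/nd_nnsfun_approx.
Qed.

End density.

(** * Moments of centred Gaussian variables *)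

Section gaussian_moments.
Context {R : realType}.
Local Notation mu := (@lebesgue_measure R).
Implicit Types (s : R) (G : R -> R).

(** The substitution y = s x turns the density of variance s^2 into the standard one, so that the
    moments of all Brownian increments reduce to those of one law. *)
Lemma normal_prob_scale s G : 0 < s -> continuous G -> (forall x, 0 <= G x) ->
  (\int[normal_prob 0 s]_x (G x)%:E = \int[mu]_x (G (s * x) * normal_pdf 0 1 x)%:E)%E.
Proof.
move=> s0 cG G0; have sn0 : s != 0 by rewrite gt_eqF.
have mG : measurable_fun setT G by exact: continuous_measurable_fun.
have mG' : measurable_fun setT (EFin \o G) by exact/measurable_EFinP.
have G0' x : (0 <= (EFin \o G) x)%E by rewrite lee_fin.
rewrite (ge0_integral_density (mu := mu) (nu := normal_prob 0 s) (measurable_normal_pdf 0 s)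
  (normal_pdf_ge0 0 s) (fun=> fun=> erefl) mG' G0').
have pdfs x : normal_pdf 0 s (x * s) * s = normal_pdf 0 1 x.
  rewrite /normal_pdf (negbTE sn0) oner_eq0 /normal_fun /normal_peak.
  have -> : - (x * s - 0) ^+ 2 / (s ^+ 2 *+ 2) = - (x - 0) ^+ 2 / (1 ^+ 2 *+ 2).
    by field.
  have -> : Num.sqrt (s ^+ 2 * pi *+ 2) = s * Num.sqrt (1 ^+ 2 * pi *+ 2).
    by rewrite expr1n mul1r -mulrnAr sqrtrM ?sqr_ge0// sqrtr_sqr gtr0_norm.
  by rewrite invfM; set q := (Num.sqrt _)^-1; set e := expR _; field.
pose F (x : R^o) : R := x * s.
have F'E : F^`()%classic = cst s.
  apply/funext => x; rewrite /F derive1E deriveM// derive_cst derive_id.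
  by rewrite scaler0 add0r /GRing.scale/= mulr1.
under eq_integral do rewrite -EFinM.
rewrite (@increasing_ge0_integration_by_substitutionT _ F
   (fun x => G x * normal_pdf 0 s x)).
- by apply: eq_integral => x _; rewrite F'E/= fctE/= /F -mulrA pdfs [x * s]mulrC.
- by move=> x y xy; rewrite /F ltr_pM2r.
- by rewrite F'E => x; exact: cst_continuous.
- by rewrite F'E; exact: is_cvg_cst.
- by rewrite F'E; exact: is_cvg_cst.
- by [].
- by apply: gt0_cvgMlNy => //; exact: cvg_id.
- by apply: gt0_cvgMly => //; exact: cvg_id.
- move=> x; apply: cvgM; first exact: cG.
  exact: continuous_normal_pdf.
- by move=> x; rewrite mulr_ge0// normal_pdf_ge0.
Qed.

End gaussian_moments.

Section gaussian_variables.
Context {R : realType}.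
Local Notation mu := (@lebesgue_measure R).

(* The second moment is 1, but only its positivity is needed. *)
Definition gauss_moment (k : nat) : R :=
  \int[mu]_y (y ^+ k * normal_pdf 0 1 y).

(** With u = y^2 / 8 one has y^4 = 64 u^2 <= 64 exp (2 u), that is y^4 exp (- y^2 / 2) <= 64 exp (-
    y^2 / 4). The right-hand side is a multiple of the Gaussian density of variance 2. *)
Lemma itg_gauss_moment4 : itg mu setT (fun y : R => y ^+ 4 * normal_pdf 0 1 y).
Proof.
pose C : R := 64 * normal_peak 1 * (normal_peak (Num.sqrt 2))^-1.
have s20 : Num.sqrt 2 != 0 :> R by rewrite gt_eqF// sqrtr_gt0.
have i2 : itg mu setT (fun y => C * normal_pdf 0 (Num.sqrt 2) y).
  by apply: itgZ => //; exact: integrable_normal_pdf.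
apply: (itg_le measurableT _ i2).
  apply: measurable_funM; first exact: measurable_funX.
  exact: measurable_normal_pdf.
move=> y _; rewrite ger0_norm; last by rewrite mulr_ge0 ?exprn_even_ge0 ?normal_pdf_ge0.
have -> : C * normal_pdf 0 (Num.sqrt 2) y = 64 * normal_peak 1 * normal_fun 0 (Num.sqrt 2) y.
  rewrite /C /normal_pdf (negbTE s20) -!mulrA; congr (_ * (_ * _)).
  by rewrite mulrA mulVf ?mul1r// gt_eqF// normal_peak_gt0.
rewrite /normal_pdf oner_eq0 /normal_fun !subr0 expr1n sqr_sqrtr//.
have -> : - y ^+ 2 / (1 *+ 2) = - y ^+ 2 / (2 *+ 2) + - y ^+ 2 / (2 *+ 2) by field.
rewrite expRD; set E := expR (- y ^+ 2 / (2 *+ 2)).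
have -> : y ^+ 4 * (normal_peak 1 * (E * E)) = normal_peak 1 * E * (y ^+ 4 * E) by ring.
have -> : 64 * normal_peak 1 * E = normal_peak 1 * E * 64 by ring.
rewrite ler_wpM2l ?mulr_ge0 ?normal_peak_ge0 ?expR_ge0//.
rewrite /E mulNr expRN ler_pdivrMr ?expR_gt0//.
have -> : y ^+ 2 / (2 *+ 2) = y ^+ 2 / 8 + y ^+ 2 / 8 by field.
rewrite expRD.
have h : y ^+ 2 / 8 <= expR (y ^+ 2 / 8).
  by apply: le_trans (expR_ge1Dx _); rewrite lerDr.
have h0 : 0 <= y ^+ 2 / 8 by rewrite divr_ge0 ?sqr_ge0.
have -> : y ^+ 4 = 64 * ((y ^+ 2 / 8) * (y ^+ 2 / 8)) by field.
by rewrite ler_wpM2l// ler_pM.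
Qed.

Lemma itg_gauss_moment2 : itg mu setT (fun y : R => y ^+ 2 * normal_pdf 0 1 y).
Proof.
apply: (itg_le measurableT _ (itgD measurableT (integrable_normal_pdf 0 1) itg_gauss_moment4)).
  apply: measurable_funM; first exact: measurable_funX.
  exact: measurable_normal_pdf.
move=> y _; rewrite ger0_norm; last by rewrite mulr_ge0 ?sqr_ge0 ?normal_pdf_ge0.
rewrite -[X in _ <= X + _]mul1r -mulrDl ler_wpM2r ?normal_pdf_ge0//.
by have := sqr_ge0 (y ^+ 2 - 1); have := sqr_ge0 (y ^+ 2); nra.
Qed.

Lemma gauss_moment4_ge0 : 0 <= gauss_moment 4.
Proof.
by apply: rint_ge0 => y _; rewrite mulr_ge0 ?exprn_even_ge0 ?normal_pdf_ge0.
Qed.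

Lemma gauss_moment2_gt0 : 0 < gauss_moment 2.
Proof.
rewrite lt0r rint_ge0 ?andbT; last first.
  by move=> y _; rewrite mulr_ge0 ?exprn_even_ge0 ?normal_pdf_ge0.
(* The integrand is at least [c] on [1, 2], where y^2 lies between 1 and 4. *)
pose c : R := normal_peak 1 * expR (- 2).
have c0 : 0 < c by rewrite mulr_gt0 ?expR_gt0// normal_peak_gt0// oner_eq0.
suff : c <= gauss_moment 2 by move=> h; rewrite gt_eqF// (lt_le_trans c0).
rewrite -lee_fin (EFin_rint measurableT itg_gauss_moment2).
have mf : measurable_fun [set: R] (fun y : R => y ^+ 2 * normal_pdf 0 1 y).
  exact: itg_measurable itg_gauss_moment2.
apply: (@le_trans _ _ (\int[mu]_(y in `[1%R, 2%R]%classic) (y ^+ 2 * normal_pdf 0 1 y)%:E)%E); last first.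
  apply: ge0_subset_integral => //; first exact/measurable_EFinP.
  by move=> y _; rewrite lee_fin mulr_ge0 ?sqr_ge0 ?normal_pdf_ge0.
have mu12 : mu `[1%R, 2%R]%classic = 1%:E.
  by rewrite lebesgue_measure_itv/= lte_fin ltr1n -EFinD; congr EFin; lra.
have -> : c%:E = (\int[mu]_(y in `[1%R, 2%R]) c%:E)%E.
  by rewrite integral_cst// [X in (_ * X)%E](_ : _ = 1%:E) ?mule1.
apply: ge0_le_integral => //=.
- by move=> y _; rewrite lee_fin ltW.
- by apply/measurable_EFinP; exact: measurable_funTS.
move=> y; rewrite in_itv/= => /andP[y1 y2]; rewrite lee_fin.
have y2' : 1 <= y ^+ 2 <= 4.
  have := sqr_ge0 (y - 1); have : 0 <= (y - 1) * (2 - y) by apply: mulr_ge0; lra.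
  move=> ? ?; apply/andP; split; nra.
rewrite /normal_pdf oner_eq0 /normal_fun subr0 expr1n -[c]mul1r.
case/andP: y2' => y2' y4; apply: ler_pM => //; first exact: ltW.
rewrite ler_wpM2l ?normal_peak_ge0// ler_expR.
by rewrite -[1 *+ 2]/(2 : R) mulNr lerN2 ler_pdivrMr//; lra.
Qed.

Context d (T : measurableType d) (P : probability T R).
Variables (Y : T -> R) (s : R).
Hypotheses (s0 : 0 < s) (mY : measurable_fun setT Y).
Hypothesis lawY : forall B : set R, measurable B -> P (Y @^-1` B) = normal_prob 0 s B.

Lemma ge0_expectation_normal (G : R -> R) : continuous G -> (forall x, 0 <= G x) ->
  (\int[P]_w (G (Y w))%:E = \int[mu]_x (G (s * x) * normal_pdf 0 1 x)%:E)%E.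
Proof.
move=> cG G0; pose Y' : T -> measurableTypeR R := Y.
pose X : {mfun T >-> measurableTypeR R} := HB.pack Y' (isMeasurableFun.Build _ _ _ _ Y' mY).
have mG : measurable_fun setT (EFin \o G).
  by apply/measurable_EFinP; exact: continuous_measurable_fun.
rewrite -normal_prob_scale//.
transitivity (\int[distribution P X]_x (G x)%:E)%E.
  by rewrite (@ge0_integral_distribution _ _ _ _ _ P X (EFin \o G))// => y; rewrite lee_fin.
apply: (eq_measure_integral (m1 := distribution P X) (normal_prob 0 s)).
by move=> A mA _; exact: (lawY mA).
Qed.

Let even_moment k : ~~ odd k -> itg mu setT (fun y : R => y ^+ k * normal_pdf 0 1 y) ->
  itg P setT (fun w => Y w ^+ k) /\ \int[P]_w (Y w ^+ k) = gauss_moment k * s ^+ k.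
Proof.
move=> ok ik.
have E : (\int[P]_w (Y w ^+ k)%:E = (gauss_moment k * s ^+ k)%:E)%E.
  rewrite (@ge0_expectation_normal (fun x => x ^+ k)).
  - rewrite mulrC /gauss_moment -rintZ// EFin_rint//; last exact: itgZ.
    by apply: eq_integral => x _; rewrite exprMn mulrA.
  - exact: exprn_continuous.
  - by move=> x; exact: exprn_even_ge0.
split; last by apply: EFin_inj; rewrite -E /Rintegral E.
apply: itg_ge0P => //.
- exact: measurable_funX.
- by move=> w _; exact: exprn_even_ge0.
- by rewrite E ltry.
Qed.

Lemma normal_moment2 : itg P setT (fun w => Y w ^+ 2) /\
  \int[P]_w (Y w ^+ 2) = gauss_moment 2 * s ^+ 2.
Proof. by apply: even_moment => //; exact: itg_gauss_moment2. Qed.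

Lemma normal_moment4 : itg P setT (fun w => Y w ^+ 4) /\
  \int[P]_w (Y w ^+ 4) = gauss_moment 4 * s ^+ 4.
Proof. by apply: even_moment => //; exact: itg_gauss_moment4. Qed.

(** [ge0_expectation_normal] speaks of nonnegative functions, so Y is split into max (Y, 0) and max
    (-Y, 0); the substitution x -> -x exchanges their expectations. *)
Lemma normal_mean : itg P setT Y /\ \int[P]_w Y w = 0.
Proof.
have Poo : (P setT < +oo)%E by rewrite probability_setT ltry.
have iY : itg P setT Y.
  apply: (itg_le measurableT mY (itgD measurableT (itg_cst measurableT Poo 1) normal_moment2.1)).
  move=> w _; rewrite -[Y w ^+ 2]real_normK ?num_real//.
  by have := sqr_ge0 (`|Y w| - 1); nra.
split => //.
have ip (c : R) : itg P setT (fun w => Num.max (c * Y w) 0).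
  apply: (itg_le measurableT _ (itgZ measurableT `|c| (itg_norm iY))).
    by apply: measurable_maxr => //; exact: measurable_funM.
  by move=> w _; rewrite -normrM maxEle; case: ifPn => _; rewrite ?normr0.
have cm (c : R) : continuous (fun x : R => Num.max (c * x) 0).
  move=> x; apply: continuous_max; last exact: cst_continuous.
  by apply: continuousM; [exact: cst_continuous|exact: cvg_id].
have m0 (c x : R) : 0 <= Num.max (c * x) 0 by rewrite le_max lexx orbT.
have -> : \int[P]_w Y w = \int[P]_w (Num.max (1 * Y w) 0) - \int[P]_w (Num.max ((-1) * Y w) 0).
  rewrite -rintB//; apply: eq_rint => w _.
  by rewrite mul1r mulN1r !maxEle oppr_le0; case: (leP (Y w) 0) => h1; case: (leP 0 (Y w)) => h2; lra.
apply/eqP; rewrite subr_eq0; apply/eqP; apply: EFin_inj; rewrite !EFin_rint//.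
rewrite (@ge0_expectation_normal (fun x => Num.max (1 * x) 0))//.
rewrite (@ge0_expectation_normal (fun x => Num.max ((-1) * x) 0))//.
transitivity (\int[mu]_(x in `[0%R, +oo[) (Num.max (1 * (s * x)) 0 * normal_pdf 0 1 x)%:E)%E.
  rewrite [RHS]integral_mkcond; apply: eq_integral => x _; rewrite patchE.
  case: ifPn => //; rewrite notin_setE/= in_itv/= andbT => /negP; rewrite -ltNge => x0.
  by rewrite mul1r max_r ?mul0r// pmulr_rle0// ltW.
transitivity (\int[mu]_(x in `]-oo, (-0)%R]) (Num.max ((-1) * (s * x)) 0 * normal_pdf 0 1 x)%:E)%E; last first.
  rewrite [LHS]integral_mkcond; apply: eq_integral => x _; rewrite patchE.
  case: ifPn => //; rewrite notin_setE/= in_itv/= oppr0 => /negP; rewrite -ltNge => x0.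
  by rewrite max_r ?mul0r// mulN1r oppr_le0 mulr_ge0// ltW.
rewrite (@ge0_integration_by_substitutionNy _ (fun x => Num.max ((-1) * (s * x)) 0 * normal_pdf 0 1 x)).
- apply: eq_integral => x _; congr EFin; rewrite /= mul1r mulN1r mulrN opprK.
  by rewrite /normal_pdf oner_eq0 /normal_fun !subr0 sqrrN.
- apply: continuous_subspaceT => x.
  apply: (@continuousM _ _ (fun x => Num.max ((-1) * (s * x)) 0) (normal_pdf 0 1)).
    apply: (@continuous_comp _ _ _ (fun x => s * x) (fun x => Num.max ((-1) * x) 0)) => //.
      by apply: continuousM; [exact: cst_continuous|exact: cvg_id].
    exact: cm.
  exact: (@continuous_normal_pdf R 0 1 (oner_neq0 R) x).
- by move=> x _; rewrite mulr_ge0 ?normal_pdf_ge0.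
Qed.

End gaussian_variables.

(** * Increments of Brownian motions *)

Section adapted_processes.
Context {R : realType} {d : measure_display} {T : measurableType d}.
Variables (P : probability T R) (F : R -> set_system T).
Hypothesis hF : usual_conditions P F.

(** Equivalent to [measurable_wrt (F t)] for t >= 0 ([fmeasP]). As a [measurable_fun] on a generated
    sigma-algebra it inherits the closure of measurable functions under sums, products and
    compositions. *)
Definition fmeas (t : R) (f : T -> R) : Prop :=
  measurable_fun setT (f : g_sigma_algebraType (F t) -> R).

Lemma prob_fin : (P setT < +oo)%E. Proof. by rewrite probability_setT ltry. Qed.

Lemma rint_cst (c : R) : \int[P]_w c = c.
Proof. by rewrite /Rintegral integral_cst//= probability_setT mule1. Qed.

Lemma fmeasP t f : 0 <= t -> fmeas t f <-> measurable_wrt (F t) f.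
Proof.
move=> t0; have sF := sigma_algebra_id (filtration_sigma_algebra hF t0).
split => [h B mB|h _ B mB].
  have := h measurableT B mB; rewrite setTI.
  by rewrite -[X in X _ -> _]/(<<s F t>>) sF.
by rewrite setTI -[X in X _]/(<<s F t>>) sF; exact: h.
Qed.

Lemma fmeas_measurable t f : 0 <= t -> fmeas t f -> measurable_fun setT f.
Proof.
move=> t0 /(fmeasP _ t0) h _ B mB; rewrite setTI.
by apply: (filtration_measurable hF t0); exact: h.
Qed.

Lemma fmeas_le s t f : 0 <= s -> s <= t -> fmeas s f -> fmeas t f.
Proof.
move=> s0 st /(fmeasP _ s0) h; apply/fmeasP; first exact: le_trans st.
by move=> B mB; apply: (filtration_nondecreasing hF s0 st); exact: h.
Qed.

Lemma fmeas_indic t (A : set T) : 0 <= t -> F t A -> fmeas t (\1_A).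
Proof.
move=> t0 FA; have sF := sigma_algebra_id (filtration_sigma_algebra hF t0).
apply: (@measurable_indic _ (g_sigma_algebraType (F t))).
by rewrite -[X in X _]/(<<s F t>>) sF.
Qed.

Lemma fmeas_adapted (H : R -> T -> R) t : adapted F H -> 0 <= t -> fmeas t (H t).
Proof. by move=> aH t0; apply/fmeasP => //; exact: aH. Qed.

Lemma itg_fmeas_bounded t f (C : R) : 0 <= t -> fmeas t f ->
  (forall w, `|f w| <= C) -> itg P setT f.
Proof.
move=> t0 mf fC; apply: (itg_bounded measurableT prob_fin (C := C)) => //.
exact: fmeas_measurable mf.
Qed.

End adapted_processes.

Section brownian_increments.
Context {R : realType} {d : measure_display} {T : measurableType d}.
Variables (P : probability T R) (F : R -> set_system T).
Hypothesis hF : usual_conditions P F.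
Local Notation kappa := (gauss_moment (R := R) 2).
Local Notation fmeas := (fmeas F).

Section one.
Variable W : R -> T -> R.
Hypothesis hW : is_standard_brownian P F W.
Variables s t : R.
Hypotheses (s0 : 0 <= s) (st : s <= t).
Local Notation dW := (fun w => W t w - W s w).

Lemma brownian_measurable u : 0 <= u -> measurable_fun setT (W u).
Proof.
by move=> u0; case: hW => aW _ _ _ _; exact: (fmeas_measurable hF u0 (fmeas_adapted hF aW u0)).
Qed.

Let t0 : 0 <= t := le_trans s0 st.

Lemma increment_measurable : measurable_fun setT dW.
Proof. by apply: measurable_funB; exact: brownian_measurable. Qed.

Let law : s < t -> forall B : set R, measurable B ->
  P (dW @^-1` B) = normal_prob 0 (Num.sqrt (t - s)) B.
Proof. by move=> lt_st B mB; case: hW => _ _ _ h _; exact: h. Qed.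

Let rt0 : s < t -> 0 < Num.sqrt (t - s).
Proof. by rewrite sqrtr_gt0 subr_gt0. Qed.

Lemma increment_moment1 : itg P setT dW /\ \int[P]_w dW w = 0.
Proof.
have [lt_st|ts] := ltP s t.
  exact: (normal_mean (rt0 lt_st) increment_measurable (law lt_st)).
have -> : dW = fun=> 0.
  have -> : t = s by apply/eqP; rewrite eq_le st ts.
  by apply/funext => w; rewrite subrr.
by split; [exact: itg0|exact: rint0].
Qed.

Lemma increment_moment2 : itg P setT (fun w => dW w ^+ 2) /\
  \int[P]_w (dW w ^+ 2) = kappa * (t - s).
Proof.
have [lt_st|ts] := ltP s t.
  have := normal_moment2 (rt0 lt_st) increment_measurable (law lt_st).
  by rewrite sqr_sqrtr// subr_ge0.
have <- : s = t by apply/eqP; rewrite eq_le st ts.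
rewrite subrr mulr0; under eq_rint do rewrite subrr expr0n/=.
split; last exact: rint0.
apply: (eq_itg (f := fun=> 0) measurableT); last exact: itg0.
  by move=> w _; rewrite subrr expr0n.
Qed.

Lemma increment_moment4 : itg P setT (fun w => dW w ^+ 4) /\
  \int[P]_w (dW w ^+ 4) = gauss_moment 4 * (t - s) ^+ 2.
Proof.
have [lt_st|ts] := ltP s t.
  have := normal_moment4 (rt0 lt_st) increment_measurable (law lt_st).
  by rewrite -[4%N]/(2 * 2)%N exprM sqr_sqrtr// subr_ge0.
have <- : s = t by apply/eqP; rewrite eq_le st ts.
rewrite subrr expr0n/= mulr0; under eq_rint do rewrite subrr expr0n/=.
split; last exact: rint0.
apply: (eq_itg (f := fun=> 0) measurableT); last exact: itg0.
  by move=> w _; rewrite subrr expr0n.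
Qed.

(** For s < t the increment is independent of [F s], which factors the expectation. The case s = t
    is outside the definition of Brownian motion, but then the increment is the constant 0. *)
Let indep (xi : T -> R) (g : R -> R) : fmeas s xi -> itg P setT xi ->
  measurable_fun setT g -> itg P setT (fun w => g (dW w)) ->
  itg P setT (fun w => xi w * g (dW w)) /\
  \int[P]_w (xi w * g (dW w)) = (\int[P]_w xi w) * \int[P]_w g (dW w).
Proof.
move=> /(fmeasP hF _ s0) mxi ixi mg ig.
have [lt_st|ts] := ltP s t; last first.
  have E : t = s by apply/eqP; rewrite eq_le st ts.
  rewrite E; split.
    by apply: (eq_itg measurableT _ (itgZ measurableT (g 0) ixi)) => w _; rewrite subrr mulrC.
  under eq_rint do rewrite subrr mulrC.
  under [X in _ = _ * X]eq_rint do rewrite subrr.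
  by rewrite rintZ// rint_cst mulrC.
apply: indep_expectation => // A B mA mB.
case: hW => _ _ _ _ h.
have mgB : measurable (g @^-1` B) by rewrite -[X in measurable X]setTI; exact: mg.
exact: (h s t s0 lt_st _ (g @^-1` B) (mxi _ mA) mgB).
Qed.

Lemma increment_mean (xi : T -> R) : fmeas s xi -> itg P setT xi ->
  itg P setT (fun w => xi w * dW w) /\ \int[P]_w (xi w * dW w) = 0.
Proof.
move=> mxi ixi; have [i1 e1] := increment_moment1.
have [//|-> ->] := indep mxi ixi (g := idfun) _ i1; first exact: measurable_id.
by rewrite e1 mulr0.
Qed.

Lemma increment_var (xi : T -> R) : fmeas s xi -> itg P setT xi ->
  itg P setT (fun w => xi w * dW w ^+ 2) /\
  \int[P]_w (xi w * dW w ^+ 2) = kappa * (t - s) * \int[P]_w xi w.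
Proof.
move=> mxi ixi; have [i1 e1] := increment_moment2.
have [|-> ->] := indep mxi ixi (g := fun x => x ^+ 2) _ i1.
  exact: measurable_funX.
by rewrite e1 mulrC.
Qed.

End one.

End brownian_increments.

(** * Orthogonality of independent Brownian motions given the past *)

Section independent_brownian_motions.
Context {R : realType} {d : measure_display} {T : measurableType d}.
Variables (P : probability T R) (F : R -> set_system T).
Hypothesis hF : usual_conditions P F.
Local Notation kappa := (gauss_moment (R := R) 2).
Local Notation fmeas := (fmeas F).

Definition independent_pair (W1 W2 : R -> T -> R) : Prop :=
  forall A B, sigma_process W1 A -> sigma_process W2 B ->
    P (A `&` B) = (P A * P B)%E.

Lemma independent_processes_pair n (W : 'I_n -> R -> T -> R) i j :
  independent_processes P W -> i != j -> independent_pair (W i) (W j).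
Proof.
move=> hW ij A B mA mB.
pose C k := if k == i then A else if k == j then B else setT.
have mC k : sigma_process (W k) (C k).
  rewrite /C; case: eqP => [->//|_]; case: eqP => [->//|_].
  by rewrite /sigma_process; exact: (@measurableT _ (g_sigma_algebraType _)).
have := hW C mC.
rewrite (bigD1 i)//= (bigD1 j)/=; last by rewrite eq_sym.
rewrite big1 => [|k /andP[/negbTE ki /negbTE kj]]; last first.
  by rewrite /C ki kj probability_setT.
rewrite mule1 {2}/C eqxx {2}/C eqxx eq_sym (negbTE ij) => <-; congr (P _).
apply/seteqP; split => w.
  move=> [Aw Bw] k _; rewrite /C; case: eqP => // _; case: eqP => //.
move=> h; have := h i Logic.I; have := h j Logic.I.
by rewrite /C !eqxx eq_sym (negbTE ij).
Qed.

Variables W1 W2 : R -> T -> R.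
Hypotheses (hW1 : is_standard_brownian P F W1) (hW2 : is_standard_brownian P F W2).
Hypothesis hI : independent_pair W1 W2.
Local Notation d1 := (fun u v w => W1 v w - W1 u w).
Local Notation d2 := (fun u v w => W2 v w - W2 u w).

Let smeas (W : R -> T -> R) (f : T -> R) :=
  @measurable_fun _ _ (g_sigma_algebraType
    [set A | exists t (B : set R), [/\ 0 <= t, measurable B & A = W t @^-1` B]]) R setT f.

Let sigma_meas (W : R -> T -> R) u : 0 <= u ->
  smeas W (W u).
Proof.
move=> u0 _ B mB; rewrite setTI; apply: sub_sigma_algebra.
by exists u, B.
Qed.

Let increments_indep (f g : T -> R) :
  smeas W1 f ->
  smeas W2 g ->
  itg P setT f -> itg P setT g ->
  itg P setT (fun w => f w * g w) /\
  \int[P]_w (f w * g w) = (\int[P]_w f w) * \int[P]_w g w.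
Proof.
move=> mf mg hf hg; apply: indep_expectation => // A B mA mB; apply: hI.
  by have := mf measurableT A mA; rewrite setTI.
by have := mg measurableT B mB; rewrite setTI.
Qed.

Variables s t : R.
Hypotheses (s0 : 0 <= s) (st : s <= t).

Lemma itg_increments u v u' v' : 0 <= u -> u <= v -> 0 <= u' -> u' <= v' ->
  itg P setT (fun w => d1 u v w * d2 u' v' w).
Proof.
move=> u0 uv u'0 u'v'; apply: itg_mul_sq => //.
- exact: (increment_measurable hF hW1 u0 uv).
- exact: (increment_measurable hF hW2 u'0 u'v').
- by case: (increment_moment2 hF hW1 u0 uv).
- by case: (increment_moment2 hF hW2 u'0 u'v').
Qed.

Variables (xi : T -> R) (C : R).
Hypotheses (mxi : fmeas s xi) (xiC : forall w, `|xi w| <= C).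

Let itg_xi (f : T -> R) : itg P setT f -> itg P setT (fun w => xi w * f w).
Proof.
move=> hf; apply: (itg_mulb measurableT hf) => [|w _]; last exact: xiC.
exact: (fmeas_measurable hF s0 mxi).
Qed.

Section subdivision.
Variable n : nat.
Hypothesis n0 : (0 < n)%N.

Let h := (t - s) / n%:R.
Let u (i : nat) := s + i%:R * h.

Let h0 : 0 <= h. Proof. by rewrite divr_ge0 ?subr_ge0. Qed.
Let su i : s <= u i. Proof. by rewrite lerDl mulr_ge0. Qed.
Let u0 i : 0 <= u i. Proof. exact: le_trans s0 (su i). Qed.
Let uS i : u i <= u i.+1.
Proof. by rewrite lerD2l ler_wpM2r// ler_nat. Qed.
Let uSB i : u i.+1 - u i = h.
Proof. by rewrite /u -natr1; ring. Qed.
Let uhom i j : (i <= j)%N -> u i <= u j.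
Proof. by move=> ij; rewrite lerD2l ler_wpM2r// ler_nat. Qed.

Let Z w := \sum_(i < n) d1 (u i) (u i.+1) w * d2 (u i) (u i.+1) w.

(** Expanding the product at [u i.+1] produces two mixed terms, each a variable of [F (u i)] times
    one later increment of a single Brownian motion; both have mean 0. The remaining new term is the
    product of the two increments over the small interval. *)
Let cross_step i :
  \int[P]_w (xi w * (d1 s (u i.+1) w * d2 s (u i.+1) w)) =
  \int[P]_w (xi w * (d1 s (u i) w * d2 s (u i) w)) +
  \int[P]_w (xi w * (d1 (u i) (u i.+1) w * d2 (u i) (u i.+1) w)).
Proof.
have mxi' : fmeas (u i) xi by exact: (fmeas_le hF s0 (su i) mxi).
have m1 : fmeas (u i) (d1 s (u i)).
  apply: measurable_funB; first by apply: (fmeas_adapted hF) => //; case: hW1.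
  by apply: (fmeas_le hF s0 (su i)); apply: (fmeas_adapted hF) => //; case: hW1.
have m2 : fmeas (u i) (d2 s (u i)).
  apply: measurable_funB; first by apply: (fmeas_adapted hF) => //; case: hW2.
  by apply: (fmeas_le hF s0 (su i)); apply: (fmeas_adapted hF) => //; case: hW2.
have [i1 e1] := increment_mean hF hW2 (u0 i) (uS i)
  (measurable_funM mxi' m1) (itg_xi (increment_moment1 hF hW1 s0 (su i)).1).
have [i2 e2] := increment_mean hF hW1 (u0 i) (uS i)
  (measurable_funM mxi' m2) (itg_xi (increment_moment1 hF hW2 s0 (su i)).1).
have ia := itg_xi (itg_increments s0 (su i) s0 (su i)).
have ib := itg_xi (itg_increments (u0 i) (uS i) (u0 i) (uS i)).
rewrite -[RHS]addr0 -e1 -[RHS]addr0 -e2 -!rintD//.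
- by apply: eq_rint => // w _; rewrite /=; ring.
- by apply: itgD => //; exact: itgD.
- exact: itgD.
Qed.

Let crossE : \int[P]_w (xi w * (d1 s t w * d2 s t w)) = \int[P]_w (xi w * Z w).
Proof.
have un : u n = t by rewrite /u /h mulrC divfK ?subrKC// pnatr_eq0 -lt0n.
rewrite -[in LHS]un {un}.
have iS k : \int[P]_w (xi w * (d1 s (u k) w * d2 s (u k) w)) =
    \sum_(i < k) \int[P]_w (xi w * (d1 (u i) (u i.+1) w * d2 (u i) (u i.+1) w)).
  elim: k => [|k IH].
    rewrite big_ord0 -[RHS](rint0 P measurableT); apply: eq_rint => // w _.
    by rewrite /u mul0r addr0; ring.
  by rewrite cross_step IH big_ord_recr.
rewrite iS -rint_sum//.
  by apply: eq_rint => // w _; rewrite /Z mulr_sumr.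
move=> i _; exact: (itg_xi (itg_increments (u0 i) (uS i) (u0 i) (uS i))).
Qed.

(** [Z] no longer involves [xi], so the independence of the processes W1 and W2 applies: each term
    of the double sum factors, and only the n diagonal ones survive, with value (kappa h)^2. *)
Let Z2 : itg P setT (fun w => Z w ^+ 2) /\
  \int[P]_w (Z w ^+ 2) = (kappa * (t - s)) ^+ 2 / n%:R.
Proof.
have E w : Z w ^+ 2 = \sum_(i < n) \sum_(j < n)
  (d1 (u i) (u i.+1) w * d1 (u j) (u j.+1) w) *
  (d2 (u i) (u i.+1) w * d2 (u j) (u j.+1) w).
  rewrite expr2 /Z mulr_suml; apply: eq_bigr => i _; rewrite mulr_sumr.
  by apply: eq_bigr => j _; ring.
have iW (W : R -> T -> R) : is_standard_brownian P F W -> forall i j,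
    itg P setT (fun w => (W (u i.+1) w - W (u i) w) * (W (u j.+1) w - W (u j) w)) /\
    \int[P]_w ((W (u i.+1) w - W (u i) w) * (W (u j.+1) w - W (u j) w)) =
      (i == j)%:R * (kappa * h).
  move=> hW i j.
  have ii : itg P setT (fun w => (W (u i.+1) w - W (u i) w) * (W (u j.+1) w - W (u j) w)).
    apply: itg_mul_sq => //.
    - exact: (increment_measurable hF hW (u0 i) (uS i)).
    - exact: (increment_measurable hF hW (u0 j) (uS j)).
    - by case: (increment_moment2 hF hW (u0 i) (uS i)).
    - by case: (increment_moment2 hF hW (u0 j) (uS j)).
  split => //.
  have lt_case k l : (k < l)%N ->
      \int[P]_w ((W (u k.+1) w - W (u k) w) * (W (u l.+1) w - W (u l) w)) = 0.
    move=> kl; apply: (increment_mean hF hW (u0 l) (uS l) _ _).2.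
      have aW : adapted F W by case: hW.
      apply: measurable_funB; last first.
        by apply: (fmeas_le hF (u0 k) (uhom (ltnW kl))); exact: (fmeas_adapted hF aW).
      by apply: (fmeas_le hF (u0 k.+1) (uhom kl)); exact: (fmeas_adapted hF aW).
    by case: (increment_moment1 hF hW (u0 k) (uS k)).
  case: (ltngtP i j) => [ij|ji|->].
  - by rewrite lt_case// mul0r.
  - by rewrite mul0r -(lt_case _ _ ji); apply: eq_rint => // w _; ring.
  - rewrite mul1r -(uSB j) -(increment_moment2 hF hW (u0 j) (uS j)).2.
    by apply: eq_rint => // w _; rewrite expr2.
have m12 W i j : smeas W (fun w => (W (u i.+1) w - W (u i) w) * (W (u j.+1) w - W (u j) w)).
  have mW k : smeas W (W (u k)) by exact: (sigma_meas (u0 k)).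
  apply: measurable_funM; apply: measurable_funB; exact: mW.
have term i j := increments_indep (m12 W1 i j) (m12 W2 i j) (iW _ hW1 i j).1 (iW _ hW2 i j).1.
split.
  apply: (eq_itg measurableT (f := fun w => \sum_(i < n) \sum_(j < n)
  (d1 (u i) (u i.+1) w * d1 (u j) (u j.+1) w) *
  (d2 (u i) (u i.+1) w * d2 (u j) (u j.+1) w))); first by move=> w _; rewrite E.
  by apply: itg_sum => // i _; apply: itg_sum => // j _; case: (term i j).
under eq_rint do rewrite E.
rewrite rint_sum//; last by move=> i _; apply: itg_sum => // j _; case: (term i j).
transitivity (\sum_(i < n) (kappa * h) ^+ 2).
  apply: eq_bigr => i _; rewrite rint_sum//; last by move=> j _; case: (term i j).
  rewrite (bigD1 i)//= big1 => [|j ji].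
    by rewrite (term i i).2 !(iW _ _ i i).2// eqxx !mul1r addr0 expr2.
  by rewrite (term i j).2 (iW _ _ i j).2// (inj_eq val_inj) eq_sym (negbTE ji) !mul0r.
rewrite sumr_const card_ord -mulr_natr /h; field.
by rewrite pnatr_eq0 -lt0n.
Qed.

(** Young's inequality |Z| <= l + Z^2 / l, the second moment of Z being given by [Z2]. *)
Lemma cross_bound (l : R) : 0 < l -> `|\int[P]_w (xi w * (d1 s t w * d2 s t w))| <=
  C * (l + (kappa * (t - s)) ^+ 2 / n%:R / l).
Proof.
move=> l0; rewrite crossE; have [iZ eZ] := Z2.
have i1 : itg P setT (fun w => l + l^-1 * Z w ^+ 2).
  by apply: itgD => //; [exact: itg_cst measurableT (prob_fin P) l|exact: itgZ].
rewrite [leRHS](_ : _ = \int[P]_w (C * (l + l^-1 * Z w ^+ 2))); last first.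
  rewrite rintZ// rintD//; last exact: itgZ; last exact: (itg_cst measurableT (prob_fin P) l).
  by rewrite rintZ// rint_cst eZ [l^-1 * _]mulrC.
apply: ler_rint_norm => //.
- apply: itg_xi; apply: itg_sum => // i _.
  exact: (itg_increments (u0 i) (uS i) (u0 i) (uS i)).
- exact: itgZ.
move=> w _; rewrite normrM ler_pM//.
rewrite -[Z w ^+ 2]real_normK ?num_real// -(ler_pM2l l0).
rewrite mulrDr mulrA divff ?gt_eqF// mul1r -expr2.
by have := sqr_ge0 (l - `|Z w|); have := normr_ge0 (Z w); nra.
Qed.

End subdivision.

(** [xi] may depend on the past of both motions, so their independence cannot be applied to the
    expectation directly. It is applied to [Z], which is small in mean square on a fine subdivision:
    n tends to infinity and then l to 0 in [cross_bound]. *)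
Lemma cross_increment :
  itg P setT (fun w => xi w * (d1 s t w * d2 s t w)) /\
  \int[P]_w (xi w * (d1 s t w * d2 s t w)) = 0.
Proof.
split; first exact: (itg_xi (itg_increments s0 st s0 st)).
suff bound (e : R) : 0 < e -> `|\int[P]_w (xi w * (d1 s t w * d2 s t w))| <= e.
  apply/eqP; rewrite -normr_le0; apply/ler_addgt0Pr => e e0; rewrite add0r.
  exact: bound.
move=> e0.
have C0 : 0 <= C by apply: le_trans (xiC point).
(* With this [l] the number 2 C l is at most e; n is then so large that the variance term of
   [cross_bound] is at most l. *)
pose l : R := e / (2 * (C + 1)).
have l0 : 0 < l by rewrite divr_gt0// mulr_gt0// ltr_wpDl.
pose K := (kappa * (t - s)) ^+ 2 / l.
have K0 : 0 <= K / l by apply: divr_ge0; [apply: divr_ge0; [exact: sqr_ge0|exact: ltW]|exact: ltW].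
have [n Kn] : exists n : nat, K / l < n%:R.
  by exists (Num.bound (K / l)); exact: archi_boundP.
have n0 : (0 < n)%N.
  by rewrite -(ltr_nat R); exact: le_lt_trans Kn.
apply: (le_trans (cross_bound n0 l0)).
have nR : 0 < n%:R :> R by rewrite ltr0n.
have h1 : (kappa * (t - s)) ^+ 2 / n%:R / l <= l.
  have -> : (kappa * (t - s)) ^+ 2 / n%:R / l = K / n%:R.
    by rewrite /K -[LHS]mulrA [n%:R^-1 * _]mulrC mulrA.
  rewrite -(ler_pM2r nR) divfK ?gt_eqF// -[leLHS](divfK (lt0r_neq0 l0)).
  by rewrite [l * _]mulrC ler_pM2r// ltW.
apply: (@le_trans _ _ (C * (2 * l))); first by rewrite ler_wpM2l// mulr2n mulrDl mul1r lerD2l.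
have -> : C * (2 * l) = e * (C / (C + 1)) by rewrite /l; field; rewrite gt_eqF ?ltr_wpDl.
apply: ler_piMr; first exact: ltW.
by rewrite ler_pdivrMr ?ltr_wpDl// mul1r lerDl.
Qed.

End independent_brownian_motions.

Section covariation.
Context {R : realType} {d : measure_display} {T : measurableType d}.
Variables (P : probability T R) (F : R -> set_system T).
Hypothesis hF : usual_conditions P F.
Local Notation fmeas := (fmeas F).

(** Weak form of d<W1, W2> = r dt, tested against bounded variables of the past. The rate r is kappa
    for W1 = W2 and 0 for independent motions. *)
Definition covariation (r : R) (W1 W2 : R -> T -> R) : Prop :=
  forall s t (xi : T -> R) C, 0 <= s -> s <= t -> fmeas s xi ->
    (forall w, `|xi w| <= C) ->
    \int[P]_w (xi w * ((W1 t w - W1 s w) * (W2 t w - W2 s w))) =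
    r * (t - s) * \int[P]_w xi w.

Lemma covariationC r W1 W2 : covariation r W1 W2 -> covariation r W2 W1.
Proof.
move=> h s t xi C s0 st mxi xiC; rewrite -(h s t xi C)//.
by apply: eq_rint => // w _; ring.
Qed.

Lemma covariation_brownian W : is_standard_brownian P F W ->
  covariation (gauss_moment 2) W W.
Proof.
move=> hW s t xi C s0 st mxi xiC.
have ixi := itg_fmeas_bounded hF s0 mxi xiC.
rewrite -(increment_var hF hW s0 st mxi ixi).2.
by apply: eq_rint => // w _; rewrite expr2.
Qed.

Lemma covariation_independent W1 W2 :
  is_standard_brownian P F W1 -> is_standard_brownian P F W2 ->
  independent_pair P W1 W2 -> covariation 0 W1 W2.
Proof.
move=> hW1 hW2 hI s t xi C s0 st mxi xiC.
by rewrite (cross_increment hF hW1 hW2 hI s0 st mxi xiC).2 mul0r mul0r.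
Qed.

(** Length of the intersection of the intervals ]u, v] and ]u', v']. *)
Definition overlap (u v u' v' : R) := Num.max 0 (Num.min v v' - Num.max u u').

(** The part of the first increment before u' and the part of the longer one after min (v, v') are
    each multiplied by an increment over a disjoint interval, so they contribute 0. The common
    interval is left. *)
Let cov_le r W1 W2 u v u' v' (eta : T -> R) C :
  is_standard_brownian P F W1 -> is_standard_brownian P F W2 ->
  covariation r W1 W2 ->
  0 <= u -> u <= u' -> u <= v -> u' <= v' ->
  fmeas u' eta -> (forall w, `|eta w| <= C) ->
  \int[P]_w (eta w * ((W1 v w - W1 u w) * (W2 v' w - W2 u' w))) =
  r * overlap u v u' v' * \int[P]_w eta w.
Proof.
move=> hW1 hW2 hc u0 uu' uv u'v' me eC.
have u'0 : 0 <= u' by exact: le_trans uu'.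
have aW1 : adapted F W1 by case: hW1.
have aW2 : adapted F W2 by case: hW2.
have v0 : 0 <= v by exact: le_trans uv.
have v'0 : 0 <= v' by exact: le_trans u'v'.
have mW1 a b : 0 <= a -> a <= b -> fmeas b (W1 a).
  by move=> a0 ab; apply: (fmeas_le hF a0 ab); exact: (fmeas_adapted hF aW1).
have mW2 a b : 0 <= a -> a <= b -> fmeas b (W2 a).
  by move=> a0 ab; apply: (fmeas_le hF a0 ab); exact: (fmeas_adapted hF aW2).
have ie (f : T -> R) : itg P setT f -> itg P setT (fun w => eta w * f w).
  move=> hf; apply: (itg_mulb measurableT hf) => [|w _]; last exact: eC.
  exact: (fmeas_measurable hF u'0 me).
have i12 := itg_increments hF hW1 hW2.
have overlapE : overlap u v u' v' = Num.max 0 (Num.min v v' - u').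
  by rewrite /overlap (max_r uu').
rewrite overlapE.
have early x y : 0 <= x -> x <= y -> y <= u' ->
  \int[P]_w (eta w * ((W1 y w - W1 x w) * (W2 v' w - W2 u' w))) = 0.
  move=> x0 xy yu'; have y0 : 0 <= y by exact: le_trans xy.
  rewrite -[RHS](increment_mean hF hW2 u'0 u'v'
    (xi := fun w => eta w * (W1 y w - W1 x w)) _ _).2.
  - by apply: eq_rint => // w _; ring.
  - apply: measurable_funM => //; apply: measurable_funB; apply: mW1 => //.
    exact: le_trans xy yu'.
  - by apply: ie; case: (increment_moment1 hF hW1 x0 xy).
have [vu'|u'v] := leP v u'.
  rewrite early// max_l ?mulr0 ?mul0r// subr_le0.
  by rewrite ge_min vu'.
have u'v_ := ltW u'v.
have main : \int[P]_w (eta w * ((W1 v w - W1 u' w) * (W2 v' w - W2 u' w))) =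
    r * (Num.min v v' - u') * \int[P]_w eta w.
  have [vv'|/ltW v'v] := leP v v'.
  - rewrite -(hc u' v eta C)// -[RHS]addr0.
    have <- : \int[P]_w ((eta w * (W1 v w - W1 u' w)) * (W2 v' w - W2 v w)) = 0.
      apply: (increment_mean hF hW2 v0 vv' _ _).2.
        apply: measurable_funM; first exact: (fmeas_le hF u'0 u'v_).
        by apply: measurable_funB; apply: mW1.
      by apply: ie; case: (increment_moment1 hF hW1 u'0 u'v_).
    rewrite -rintD//; last 2 first.
    + by apply: ie; apply: i12.
    + apply: (eq_itg measurableT (f := fun w => eta w * ((W1 v w - W1 u' w) * (W2 v' w - W2 v w)))).
        by move=> w _; ring.
      by apply: ie; apply: i12.
    by apply: eq_rint => // w _; ring.
  - rewrite -(hc u' v' eta C)// -[RHS]addr0.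
    have <- : \int[P]_w ((eta w * (W2 v' w - W2 u' w)) * (W1 v w - W1 v' w)) = 0.
      apply: (increment_mean hF hW1 v'0 v'v _ _).2.
        apply: measurable_funM; first exact: (fmeas_le hF u'0 u'v').
        by apply: measurable_funB; apply: mW2.
      by apply: ie; case: (increment_moment1 hF hW2 u'0 u'v').
    rewrite -rintD//; last 2 first.
    + by apply: ie; apply: i12.
    + apply: (eq_itg measurableT (f := fun w => eta w * ((W1 v w - W1 v' w) * (W2 v' w - W2 u' w)))).
        by move=> w _; ring.
      by apply: ie; apply: i12.
    by apply: eq_rint => // w _; ring.
rewrite max_r; last by rewrite subr_ge0 le_min u'v_ u'v'.
rewrite -main -[LHS]subr0 -(early u u')// -rintB//; last 2 first.
- by apply: ie; apply: i12.
- by apply: ie; apply: i12.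
by apply: eq_rint => // w _; ring.
Qed.

Lemma overlapC u v u' v' : overlap u v u' v' = overlap u' v' u v.
Proof. by rewrite /overlap [Num.min v v']minC [Num.max u u']maxC. Qed.

Lemma overlap_eq0 u v u' v' : v <= u \/ v' <= u' -> overlap u v u' v' = 0.
Proof.
move=> vu; rewrite /overlap max_l// subr_le0 ge_min !le_max.
by case: vu => ->; rewrite ?orbT.
Qed.

Lemma covariation_overlap r W1 W2 u v u' v' (eta : T -> R) C :
  is_standard_brownian P F W1 -> is_standard_brownian P F W2 ->
  covariation r W1 W2 ->
  0 <= u -> 0 <= u' -> u <= v -> u' <= v' ->
  fmeas (Num.max u u') eta -> (forall w, `|eta w| <= C) ->
  \int[P]_w (eta w * ((W1 v w - W1 u w) * (W2 v' w - W2 u' w))) =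
  r * overlap u v u' v' * \int[P]_w eta w.
Proof.
move=> hW1 hW2 hc u0 u'0 uv u'v'.
have [uu'|/ltW u'u] := leP u u' => me eC; first exact: (@cov_le r W1 W2 u v u' v' eta C).
rewrite overlapC -(@cov_le r W2 W1 u' v' u v eta C)//; last exact: covariationC.
by apply: eq_rint => // w _; ring.
Qed.

End covariation.

(** * Integrals of simple processes *)

Section simple_integrals.
Context {R : realType} {d : measure_display} {T : measurableType d}.
Variables (P : probability T R) (F : R -> set_system T).
Hypothesis hF : usual_conditions P F.
Local Notation fmeas := (fmeas F).
Local Notation mu := (@lebesgue_measure R).
Implicit Types (S : simple_process F) (W : R -> T -> R).

(** Projection of a onto [s, t] when s <= t. Clipping the nodes of a simple process writes the
    increment over [s, t] of its integral as one sum ([simple_integral_increment]). *)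
Definition clip (s t a : R) : R := Num.max s (Num.min a t).

Lemma clip_ge s t a : s <= clip s t a. Proof. by rewrite le_max lexx. Qed.

Lemma clip_le s t a : s <= t -> clip s t a <= t.
Proof. by move=> st; rewrite ge_max st ge_min lexx orbT. Qed.

Lemma clip_homo s t a b : a <= b -> clip s t a <= clip s t b.
Proof.
move=> ab; rewrite /clip ge_max !le_max lexx/=.
by rewrite le_min !ge_min ab lexx !orbT.
Qed.

Lemma clip_lt s t a x : s < x <= t -> (clip s t a < x) = (a < x).
Proof. by move=> /andP[sx xt]; rewrite gt_max gt_min sx/= (ltNge t) xt orbF. Qed.

Lemma sp_time_ge S j : 0 <= sp_time S j.
Proof.
elim: j => [|j IH]; first exact: sp_time_ge0.
by apply: le_trans IH _; exact: sp_time_nondecreasing.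
Qed.

Section increments.
Variables (s t : R).
Hypotheses (s0 : 0 <= s) (st : s <= t).

Definition increment_term W S j w :=
  sp_coef S j w *
    (W (clip s t (sp_time S j.+1)) w - W (clip s t (sp_time S j)) w).

Lemma simple_integral_increment W S w :
  simple_integral W S t w - simple_integral W S s w =
  \sum_(j < sp_size S) increment_term W S j w.
Proof.
rewrite /simple_integral -sumrB; apply: eq_bigr => j _; rewrite /increment_term -mulrBr.
congr (_ * _).
have E a : W (Num.min a t) w - W (Num.min a s) w = W (clip s t a) w - W s w.
  rewrite /clip; have [as_|sa] := leP a s.
    have at_ : a <= t by exact: le_trans st.
    by rewrite (min_l at_) (max_l as_) !subrr.
  by rewrite (max_r (_ : s <= Num.min a t))// le_min (ltW sa) st.
have := E (sp_time S j.+1); have := E (sp_time S j); lra.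
Qed.

Let u0 S j : 0 <= clip s t (sp_time S j).
Proof. exact: le_trans s0 (clip_ge _ _ _). Qed.

Let uS S j : clip s t (sp_time S j) <= clip s t (sp_time S j.+1).
Proof. by apply: clip_homo; exact: sp_time_nondecreasing. Qed.

(** A node beyond t is clipped down to a time at which its coefficient need not be measurable; but
    the following node is then beyond t as well, and the clipped interval is empty. *)
Let coef_fmeas S j : clip s t (sp_time S j) < clip s t (sp_time S j.+1) ->
  fmeas (clip s t (sp_time S j)) (sp_coef S j).
Proof.
move=> lt; apply: (fmeas_le hF (sp_time_ge S j)); last first.
  by apply/(fmeasP hF) => //; [exact: sp_time_ge|exact: sp_coef_measurable].
rewrite /clip le_max; apply/orP; right; rewrite le_min lexx/= leNgt.
apply/negP => tj; move: lt; rewrite ltNge => /negP; apply.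
rewrite /clip (min_r (ltW tj)) min_r//.
by apply: le_trans (ltW tj) _; exact: sp_time_nondecreasing.
Qed.

Lemma coef_measurable S j : measurable_fun setT (sp_coef S j).
Proof.
apply: (fmeas_measurable hF (sp_time_ge S j)).
by apply/(fmeasP hF); [exact: sp_time_ge|exact: sp_coef_measurable].
Qed.

Lemma simple_eval_clip S x w : s < x <= t -> simple_eval S x w =
  \sum_(j < sp_size S) sp_coef S j w *
    (\1_(`]clip s t (sp_time S j), clip s t (sp_time S j.+1)]%classic) x).
Proof.
move=> sxt; apply: eq_bigr => j _; congr (_ * _); rewrite indicE mem_setE in_itv/=.
by rewrite clip_lt// !leNgt clip_lt.
Qed.

Lemma lebesgue_itv_fin : (mu `]s, t]%classic < +oo)%E.
Proof. by rewrite lebesgue_measure_itv/=; case: ifPn => _; rewrite -?EFinD ltry. Qed.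

Lemma integral_overlap a b a' b' : s <= a -> b <= t ->
  \int[mu]_(x in `]s, t]) (\1_(`]a, b]%classic) x * \1_(`]a', b']%classic) x) =
  overlap a b a' b'.
Proof.
move=> sa bt.
pose A := `]Num.max a a', Num.min b b']%classic : set R.
transitivity (\int[mu]_(x in `]s, t]) (\1_A x : R)).
  apply: eq_rint => // x _; rewrite /A !indicE !mem_setE !in_itv/= gt_max le_min.
  by case: (a < x); case: (x <= b); case: (a' < x); case: (x <= b');
    rewrite /= ?mulr0 ?mul0r ?mulr1.
have AE : A `&` `]s, t]%classic = A.
  apply/seteqP; split => y; first by case.
  move=> Ay; split => //; move: Ay; rewrite /A /= !in_itv/= gt_max le_min.
  by move=> /andP[/andP[ay _] /andP[yb _]]; rewrite (le_lt_trans sa ay) (le_trans yb bt).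
have muA : (\int[mu]_(x in `]s, t]) (\1_A x)%:E = mu A)%E.
  have mA : measurable A by exact: measurable_itv.
  by rewrite integral_indic//; exact: (congr1 mu AE).
rewrite /Rintegral muA /A lebesgue_measure_itv/= /overlap lte_fin.
case: ltP => h.
  have h' : 0 <= Num.min b b' - Num.max a a' by rewrite subr_ge0 ltW.
  by rewrite (max_r h').
have h' : Num.min b b' - Num.max a a' <= 0 by rewrite subr_le0.
by rewrite (max_l h').
Qed.

Lemma itg_indic_itv a b a' b' :
  itg mu `]s, t]%classic (fun x => \1_(`]a, b]%classic) x * \1_(`]a', b']%classic) x).
Proof.
apply: (itg_bounded _ lebesgue_itv_fin (C := 1)) => //.
  by apply: measurable_funM; apply: measurable_indic.
move=> x _; rewrite !indicE; case: (_ \in _); case: (_ \in _);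
  by rewrite ?mulr0 ?mul0r ?mulr1 ?normr0 ?normr1 ?ler01.
Qed.

Lemma integral_simple_eval S S' w :
  \int[mu]_(x in `]s, t]) (simple_eval S x w * simple_eval S' x w) =
  \sum_(i < sp_size S) \sum_(j < sp_size S') sp_coef S i w * sp_coef S' j w *
    overlap (clip s t (sp_time S i)) (clip s t (sp_time S i.+1))
            (clip s t (sp_time S' j)) (clip s t (sp_time S' j.+1)).
Proof.
pose I i := `]clip s t (sp_time S i), clip s t (sp_time S i.+1)]%classic.
pose J i := `]clip s t (sp_time S' i), clip s t (sp_time S' i.+1)]%classic.
transitivity (\int[mu]_(x in `]s, t]) (\sum_(i < sp_size S) \sum_(j < sp_size S')
    (sp_coef S i w * sp_coef S' j w) * (\1_(I i) x * \1_(J j) x))).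
  apply: eq_rint => // x; rewrite /= in_itv/= => sxt.
  rewrite !simple_eval_clip// mulr_suml; apply: eq_bigr => i _.
  by rewrite mulr_sumr; apply: eq_bigr => j _; ring.
rewrite rint_sum//; last first.
  by move=> i _; apply: itg_sum => // j _; apply: itgZ => //; exact: itg_indic_itv.
apply: eq_bigr => i _; rewrite rint_sum//; last first.
  by move=> j _; apply: itgZ => //; exact: itg_indic_itv.
apply: eq_bigr => j _; rewrite rintZ//; last exact: itg_indic_itv.
by rewrite integral_overlap ?clip_ge ?clip_le.
Qed.

Variables (xi : T -> R) (C : R).
Hypotheses (mxi : fmeas s xi) (xiC : forall w, `|xi w| <= C).

Let mxi' : measurable_fun setT xi. Proof. exact: (fmeas_measurable hF s0 mxi). Qed.

Let itg_xi (f : T -> R) : itg P setT f -> itg P setT (fun w => xi w * f w).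
Proof.
by move=> hf; apply: (itg_mulb measurableT hf) => // w _; exact: xiC.
Qed.

Lemma itg_increment_term_sq W S j : is_standard_brownian P F W ->
  itg P setT (fun w => increment_term W S j w ^+ 2).
Proof.
move=> hW; have [K hK] := sp_coef_bounded S.
apply: (eq_itg measurableT (f := fun w => sp_coef S j w ^+ 2 *
    (W (clip s t (sp_time S j.+1)) w - W (clip s t (sp_time S j)) w) ^+ 2)).
  by move=> w _; rewrite /increment_term exprMn.
apply: (itg_mulb measurableT (C := K ^+ 2)).
- by case: (increment_moment2 hF hW (u0 S j) (uS S j)).
- by apply: measurable_funX; exact: coef_measurable.
- move=> w _; rewrite ger0_norm ?sqr_ge0// -[_ ^+ 2]real_normK ?num_real//.
  by rewrite lerXn2r ?nnegrE//; exact: le_trans (hK j w).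
Qed.

Lemma increment_term_measurable W S j : is_standard_brownian P F W ->
  measurable_fun setT (increment_term W S j).
Proof.
move=> hW; apply: measurable_funM; first exact: coef_measurable.
exact: (increment_measurable hF hW (u0 S j) (uS S j)).
Qed.

(** Polarized Ito isometry, given the past. Both sides are expanded over pairs of nodes and agree
    term by term: the products of increments are computed by [covariation_overlap], those of
    indicators by [integral_overlap]. The coefficients of a pair are both known at the later of the
    two left endpoints. *)
Lemma simple_covariation r W1 W2 S S' :
  is_standard_brownian P F W1 -> is_standard_brownian P F W2 ->
  covariation P F r W1 W2 ->
  let D1 w := simple_integral W1 S t w - simple_integral W1 S s w in
  let D2 w := simple_integral W2 S' t w - simple_integral W2 S' s w in
  let Q w := \int[mu]_(x in `]s, t]) (simple_eval S x w * simple_eval S' x w) in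
  \int[P]_w (xi w * (D1 w * D2 w)) = r * \int[P]_w (xi w * Q w).
Proof.
move=> hW1 hW2 hc D1 D2 Q.
pose o i j := overlap (clip s t (sp_time S i)) (clip s t (sp_time S i.+1))
            (clip s t (sp_time S' j)) (clip s t (sp_time S' j.+1)).
have [K hK] := sp_coef_bounded S; have [K' hK'] := sp_coef_bounded S'.
pose eta (i j : nat) w := xi w * (sp_coef S i w * sp_coef S' j w).
have eC i j w : `|eta i j w| <= C * (K * K').
  by rewrite /eta !normrM !ler_pM// mulr_ge0.
have meta i j : measurable_fun setT (eta i j).
  apply: measurable_funM => //; apply: measurable_funM; exact: coef_measurable.
have ieta i j : itg P setT (eta i j).
  exact: (itg_bounded measurableT (prob_fin P) (C := C * (K * K'))).
have iterm i j : itg P setT (fun w => xi w * (increment_term W1 S i w * increment_term W2 S' j w)).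
  apply: itg_xi; apply: itg_mul_sq => //; do ?exact: increment_term_measurable;
  exact: itg_increment_term_sq.
transitivity (\sum_(i < sp_size S) \sum_(j < sp_size S')
    \int[P]_w (xi w * (increment_term W1 S i w * increment_term W2 S' j w))).
  under [RHS]eq_bigr do rewrite -rint_sum//.
  rewrite -rint_sum//; last by move=> i _; apply: itg_sum.
  apply: eq_rint => // w _; rewrite /D1 /D2 !simple_integral_increment.
  rewrite mulr_suml mulr_sumr; apply: eq_bigr => i _; rewrite mulr_sumr mulr_sumr.
  by apply: eq_bigr => j _; ring.
transitivity (\sum_(i < sp_size S) \sum_(j < sp_size S')
    r * \int[P]_w (o i j * eta i j w)); last first.
  rewrite (_ : \int[P]_w (xi w * Q w) = \int[P]_w (\sum_(i < sp_size S)
      \sum_(j < sp_size S') (o i j * eta i j w))).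
    rewrite rint_sum//; last by move=> i _; apply: itg_sum => // j _; exact: itgZ.
    rewrite mulr_sumr; apply: eq_bigr => i _; rewrite rint_sum ?mulr_sumr//.
    by move=> j _; exact: itgZ.
  apply: eq_rint => // w _; rewrite /Q integral_simple_eval mulr_sumr.
  apply: eq_bigr => i _; rewrite mulr_sumr; apply: eq_bigr => j _.
  by rewrite /eta /o; ring.
apply: eq_bigr => i _; apply: eq_bigr => j _; rewrite rintZ// mulrA.
(* Empty clipped intervals are set apart: [coef_fmeas] does not cover them, and both sides
   vanish. *)
have := uS S i; have := uS S' j; rewrite !le_eqVlt.
set u := clip s t (sp_time S i); set v := clip s t (sp_time S i.+1).
set u' := clip s t (sp_time S' j); set v' := clip s t (sp_time S' j.+1).
have ov0 : v <= u \/ v' <= u' -> o i j = 0.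
  exact: overlap_eq0.
move=> /predU1P[u'v'|u'v'].
  move=> _; rewrite ov0; last by right; rewrite u'v'.
  rewrite mulr0 mul0r -[RHS](rint0 P measurableT); apply: eq_rint => // w _.
  by rewrite /increment_term -/u' -/v' u'v' subrr !mulr0.
move=> /predU1P[uv|uv].
  rewrite ov0; last by left; rewrite uv.
  rewrite mulr0 mul0r -[RHS](rint0 P measurableT); apply: eq_rint => // w _.
  by rewrite /increment_term -/u -/v uv subrr !(mulr0, mul0r).
rewrite -(@covariation_overlap _ _ _ _ _ hF r W1 W2 u v u' v' (eta i j) (C * (K * K')))//.
- by apply: eq_rint => // w _; rewrite /increment_term /eta; ring.
- exact: u0.
- exact: u0.
- exact: ltW.
- exact: ltW.
have um : u <= Num.max u u' by rewrite le_max lexx.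
have u'm : u' <= Num.max u u' by rewrite le_max lexx orbT.
apply: measurable_funM.
  by apply: (fmeas_le hF s0 _ mxi); apply: le_trans um; exact: clip_ge.
apply: measurable_funM.
  by apply: (fmeas_le hF (u0 S i) um); exact: coef_fmeas.
by apply: (fmeas_le hF (u0 S' j) u'm); exact: coef_fmeas.
Qed.

Lemma simple_integral_mean W S : is_standard_brownian P F W ->
  \int[P]_w (xi w * (simple_integral W S t w - simple_integral W S s w)) = 0.
Proof.
move=> hW; have [K hK] := sp_coef_bounded S.
transitivity (\sum_(i < sp_size S) \int[P]_w (xi w * increment_term W S i w)).
  rewrite -rint_sum//.
    by apply: eq_rint => // w _; rewrite simple_integral_increment mulr_sumr.
  move=> i _; apply: itg_xi; apply: (itg_le measurableT (g := fun w => 1 + increment_term W S i w ^+ 2)).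
  - exact: increment_term_measurable.
  - by apply: itgD => //; [exact: (itg_cst measurableT (prob_fin P))|exact: itg_increment_term_sq].
  move=> w _; rewrite -[_ ^+ 2]real_normK ?num_real//.
  by have := sqr_ge0 (`|increment_term W S i w| - 1); nra.
apply: big1 => i _.
have := uS S i; rewrite le_eqVlt.
set u := clip s t (sp_time S i); set v := clip s t (sp_time S i.+1).
move=> /predU1P[uv|uv].
  rewrite -[RHS](rint0 P measurableT); apply: eq_rint => // w _.
  by rewrite /increment_term -/u -/v uv subrr !mulr0.
have mex : fmeas u (fun w => xi w * sp_coef S i w).
  by apply: measurable_funM; [exact: (fmeas_le hF s0 (clip_ge _ _ _) mxi)|exact: coef_fmeas].
rewrite -[RHS](increment_mean hF hW (u0 S i) (uS S i) mex _).2.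
  by apply: eq_rint => // w _; rewrite /increment_term; ring.
apply: (itg_fmeas_bounded hF (u0 S i) mex (C := C * K)) => w.
by rewrite normrM ler_pM.
Qed.

End increments.

Lemma sum_pow4_le n : exists2 K : R, 0 <= K & forall x : nat -> R,
  (\sum_(i < n) x i) ^+ 4 <= K * \sum_(i < n) x i ^+ 4.
Proof.
elim: n => [|n [K K0 IH]].
  by exists 0 => // x; rewrite !big_ord0 expr0n mul0r.
exists (8 * (K + 1)) => [|x]; first by rewrite mulr_ge0// addr_ge0.
rewrite !big_ord_recr/=; set a := \sum_(i < n) x i; have := IH x.
set b := \sum_(i < n) x i ^+ 4; rewrite -/a => h.
have b0 : 0 <= b by apply: sumr_ge0 => i _; exact: exprn_even_ge0.
have x0 : 0 <= x n ^+ 4 by exact: exprn_even_ge0.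
apply: (@le_trans _ _ (8 * (a ^+ 4 + x n ^+ 4))); last first.
  rewrite -mulrA ler_wpM2l// mulrDl mul1r mulrDr.
  by have := mulr_ge0 K0 x0; lra.
set y := x n.
have -> : a ^+ 4 = (a ^+ 2) ^+ 2 by rewrite -exprM.
have -> : y ^+ 4 = (y ^+ 2) ^+ 2 by rewrite -exprM.
have -> : (a + y) ^+ 4 = ((a + y) ^+ 2) ^+ 2 by rewrite -exprM.
apply: (@le_trans _ _ ((2 * (a ^+ 2 + y ^+ 2)) ^+ 2)).
  rewrite lerXn2r ?nnegrE ?sqr_ge0//.
    by rewrite mulr_ge0// addr_ge0 ?sqr_ge0.
  by have := sqr_ge0 (a - y); nra.
by have := sqr_ge0 (a ^+ 2 - y ^+ 2); nra.
Qed.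

(** The constant depends on S but not on the interval. The order (t - s)^2 is what makes the
    third-order variation of a simple integral vanish along grids. *)
Lemma simple_integral_moment4 W S : is_standard_brownian P F W ->
  exists2 K : R, 0 <= K & forall s t, 0 <= s -> s <= t ->
    let D w := simple_integral W S t w - simple_integral W S s w in
    itg P setT (fun w => D w ^+ 4) /\ \int[P]_w (D w ^+ 4) <= K * (t - s) ^+ 2.
Proof.
move=> hW; have [C hC] := sp_coef_bounded S.
have C0 : 0 <= C by exact: le_trans (hC 0%N point).
have [K K0 hK] := sum_pow4_le (sp_size S).
exists (K * ((sp_size S)%:R * (C ^+ 4 * gauss_moment 4))).
  rewrite mulr_ge0// mulr_ge0// mulr_ge0//; first exact: exprn_even_ge0.
  exact: gauss_moment4_ge0.
move=> s t s0 st D.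
have u0 j : 0 <= clip s t (sp_time S j) by exact: le_trans s0 (clip_ge _ _ _).
have uS j : clip s t (sp_time S j) <= clip s t (sp_time S j.+1).
  by apply: clip_homo; exact: sp_time_nondecreasing.
have term j : itg P setT (fun w => increment_term s t W S j w ^+ 4) /\
    \int[P]_w (increment_term s t W S j w ^+ 4) <= C ^+ 4 * gauss_moment 4 * (t - s) ^+ 2.
  have [i4 e4] := increment_moment4 hF hW (u0 j) (uS j).
  have le w : increment_term s t W S j w ^+ 4 <= C ^+ 4 *
      (W (clip s t (sp_time S j.+1)) w - W (clip s t (sp_time S j)) w) ^+ 4.
    rewrite /increment_term exprMn ler_wpM2r ?exprn_even_ge0//.
    rewrite -[sp_coef S j w ^+ 4]ger0_norm ?exprn_even_ge0// normrX.
    by rewrite lerXn2r ?nnegrE//; exact: le_trans (hC j w).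
  have it : itg P setT (fun w => increment_term s t W S j w ^+ 4).
    apply: (itg_le measurableT _ (itgZ measurableT (C ^+ 4) i4)).
      by apply: measurable_funX; exact: increment_term_measurable.
    by move=> w _; rewrite ger0_norm ?exprn_even_ge0.
  split => //; apply: (le_trans (ler_rint measurableT it (itgZ measurableT (C ^+ 4) i4) (fun w _ => le w))).
  rewrite rintZ// e4 mulrA ler_wpM2l ?mulr_ge0 ?exprn_even_ge0 ?gauss_moment4_ge0//.
  rewrite lerXn2r ?nnegrE ?subr_ge0//.
  by have := clip_ge s t (sp_time S j); have := clip_le (sp_time S j.+1) st; lra.
have isum : itg P setT (fun w => K * \sum_(j < sp_size S) increment_term s t W S j w ^+ 4).
  by apply: itgZ => //; apply: itg_sum => // j _; case: (term j).
have le w : D w ^+ 4 <= K * \sum_(j < sp_size S) increment_term s t W S j w ^+ 4.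
  by rewrite /D (simple_integral_increment st); exact: (hK (fun j => increment_term s t W S j w)).
have iD : itg P setT (fun w => D w ^+ 4).
  apply: (itg_le measurableT _ isum); last by move=> w _; rewrite ger0_norm ?exprn_even_ge0.
  apply: measurable_funX.
  rewrite (_ : D = fun w => \sum_(j < sp_size S) increment_term s t W S j w); last first.
    by apply/funext => w; rewrite /D (simple_integral_increment st).
  by apply: measurable_sum => j; exact: increment_term_measurable.
split => //; apply: (le_trans (ler_rint measurableT iD isum (fun w _ => le w))).
rewrite rintZ; last 2 first.
- exact: measurableT.
- by apply: itg_sum => // j _; case: (term j).
rewrite rint_sum//; last by move=> j _; case: (term j).
rewrite [leRHS](_ : _ = K * ((sp_size S)%:R * (C ^+ 4 * gauss_moment 4 * (t - s) ^+ 2))); last by ring.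
rewrite ler_wpM2l// mulr_natl -[X in _ *+ X](card_ord (sp_size S)) -sumr_const.
by apply: ler_sum => j _; case: (term j).
Qed.

Lemma simple_increment_measurable W S s t : is_standard_brownian P F W ->
  0 <= s -> s <= t ->
  measurable_fun setT (fun w => simple_integral W S t w - simple_integral W S s w).
Proof.
move=> hW s0 st.
under eq_fun do rewrite (simple_integral_increment st).
by apply: measurable_sum => j; exact: increment_term_measurable.
Qed.

Lemma itg_simple_increment_sq W S s t : is_standard_brownian P F W ->
  0 <= s -> s <= t ->
  itg P setT (fun w => (simple_integral W S t w - simple_integral W S s w) ^+ 2).
Proof.
move=> hW s0 st; have [K K0 /(_ s t s0 st)[i4 _]] := simple_integral_moment4 S hW.
apply: (itg_le measurableT _ (itgD measurableT (itg_cst measurableT (prob_fin P) 1) i4)).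
  by apply: measurable_funX; exact: simple_increment_measurable.
move=> w _; rewrite ger0_norm ?sqr_ge0//.
set x := _ - _; have -> : x ^+ 4 = (x ^+ 2) ^+ 2 by rewrite -exprM.
by have := sqr_ge0 (x ^+ 2 - 1); have := sqr_ge0 x; nra.
Qed.

End simple_integrals.

(** * Ito integrals of bounded processes *)

Section time_integrals.
Context {R : realType} {d : measure_display} {T : measurableType d}.
Variable P : probability T R.
Local Notation mu := (@lebesgue_measure R).
Implicit Types (f g : R -> T -> R) (s t : R).

Definition jmeas s t f : Prop :=
  measurable_fun (`]s, t]%classic `*` setT : set (measurableTypeR R * T)%type)
    (fun z => f z.1 z.2).

Definition tint s t f (w : T) : R := \int[mu]_(x in `]s, t]) f x w.

Lemma jmeas_sub s t s' t' f : s' <= s -> t <= t' -> jmeas s' t' f -> jmeas s t f.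
Proof.
move=> ss tt; apply: measurable_funS.
  by apply: measurableX => //; exact: measurable_itv.
move=> [x w] [/= + _]; rewrite !in_itv/= => /andP[sx xt]; split => //=.
by rewrite (le_lt_trans ss sx) (le_trans xt tt).
Qed.

Lemma jointly_measurable_jmeas s t f : 0 <= s -> jointly_measurable f -> jmeas s t f.
Proof.
move=> s0 mf.
have mf' : measurable_fun ([set z | 0 <= z.1] : set (measurableTypeR R * T)%type)
  (fun z => f z.1 z.2) := mf.
apply: measurable_funS mf'.
  rewrite (_ : [set z | 0 <= z.1] = (fst : measurableTypeR R * T -> measurableTypeR R) @^-1` `[0, +oo[%classic).
    by rewrite -[X in measurable X]setTI; apply: measurable_fst => //; exact: measurable_itv.
  by apply/seteqP; split => z /=; rewrite in_itv/= andbT.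
move=> [x w] [/= + _]; rewrite in_itv/= => /andP[sx _].
exact: le_trans s0 (ltW sx).
Qed.

Lemma jmeasD s t f g : jmeas s t f -> jmeas s t g -> jmeas s t (fun x w => f x w + g x w).
Proof. by move=> mf mg; exact: measurable_funD. Qed.

Lemma jmeasB s t f g : jmeas s t f -> jmeas s t g -> jmeas s t (fun x w => f x w - g x w).
Proof. by move=> mf mg; exact: measurable_funB. Qed.

Lemma jmeasM s t f g : jmeas s t f -> jmeas s t g -> jmeas s t (fun x w => f x w * g x w).
Proof. by move=> mf mg; exact: measurable_funM. Qed.

Lemma jmeas_norm s t f : jmeas s t f -> jmeas s t (fun x w => `|f x w|).
Proof. by move=> mf; exact: (measurableT_comp (@normr_measurable R setT)). Qed.

Lemma jmeas_section s t f w : jmeas s t f ->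
  measurable_fun (`]s, t]%classic : set (measurableTypeR R)) (f ^~ w).
Proof.
move=> mf; apply: (measurable_comp (F := `]s, t]%classic `*` setT)
  (f := fun z => f z.1 z.2) (g := fun x : measurableTypeR R => (x, w))) => //.
- by apply: measurableX => //; exact: measurable_itv.
- by move=> _ [x sx <-].
- apply: measurable_funTS.
  exact: pair2_measurable.
Qed.

Section bounded.
Variables (s t : R) (f : R -> T -> R) (C : R).
Hypotheses (st : s <= t) (mf : jmeas s t f) (fC : forall x w, `|f x w| <= C).

Lemma itg_section w : itg mu `]s, t]%classic (f ^~ w).
Proof.
apply: (itg_bounded _ (lebesgue_itv_fin s t) (C := C)) => //.
exact: jmeas_section.
Qed.

Lemma lebesgue_itvE : fine (mu `]s, t]%classic) = t - s.
Proof.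
rewrite lebesgue_measure_itv/= lte_fin; case: ltP => //= ts.
by apply/eqP; rewrite eq_sym subr_eq0 eq_le ts st.
Qed.

Lemma tint_bound w : `|tint s t f w| <= C * (t - s).
Proof.
rewrite -lebesgue_itvE -Rintegral_cst; last exact: measurable_itv.
apply: ler_rint_norm => //; first exact: itg_section.
exact: (itg_cst _ (lebesgue_itv_fin s t)).
Qed.

Lemma tint_measurable : measurable_fun setT (tint s t f).
Proof.
(* Adding C makes the integrand nonnegative, so that Tonelli gives the measurability of its
   integral; the contribution C (t - s) is then subtracted. *)
pose g (z : measurableTypeR R * T) : R := ((fun z => f z.1 z.2 + C) \_ (`]s, t]%classic `*` setT)) z.
have mD : measurable (`]s, t]%classic `*` setT : set (measurableTypeR R * T)%type).
  by apply: measurableX => //; exact: measurable_itv.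
have mg : measurable_fun setT (EFin \o g).
  apply/measurable_EFinP; apply/(measurable_restrictT _ mD).
  exact: measurable_funD.
have g0 z : (0 <= (EFin \o g) z)%E.
  rewrite lee_fin /g patchE; case: ifPn => // _.
  by have := fC z.1 z.2; rewrite ler_norml => /andP[+ _]; lra.
have mG := measurable_fun_fubini_tonelli_G (m1 := mu) (EFin \o g) mg g0.
rewrite (_ : tint s t f = fun w => fine (fubini_G mu (EFin \o g) w) - C * (t - s)).
  by apply: measurable_funB => //; apply: measurableT_comp.
apply/funext => w; rewrite /fubini_G.
have -> : fine (\int[mu]_x (EFin \o g) (x, w))%E = \int[mu]_(x in `]s, t]) (f x w + C).
  rewrite Rintegral_mkcond /Rintegral; congr fine; apply: eq_integral => x _.
  by rewrite /= /g !patchE in_setX/= in_setT andbT.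
rewrite rintD//.
- by rewrite Rintegral_cst// lebesgue_itvE addrK.
- exact: itg_section.
- exact: (itg_cst _ (lebesgue_itv_fin s t)).
Qed.

Lemma itg_tint : itg P setT (tint s t f).
Proof.
apply: (itg_bounded measurableT (prob_fin P) (C := C * (t - s))).
  exact: tint_measurable.
by move=> w _; exact: tint_bound.
Qed.

End bounded.

Lemma tint_cat s t u f C : s <= t -> t <= u -> jmeas s u f ->
  (forall x w, `|f x w| <= C) -> forall w, tint s u f w = tint s t f w + tint t u f w.
Proof.
move=> st tu mf fC w; rewrite /tint.
rewrite (@itv_bndbnd_setU _ _ (BRight s) (BRight t) (BRight u)) ?bnd_simp//.
rewrite Rintegral_setU//.
- rewrite -(@itv_bndbnd_setU _ _ (BRight s) (BRight t) (BRight u)) ?bnd_simp//.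
  exact: (itg_section mf fC).
- apply/disj_setPS => x [] /=; rewrite !in_itv/= => /andP[_ xt] /andP[tx _].
  by move: (lt_le_trans tx xt); rewrite ltxx.
Qed.

Lemma tint_grid q h n f C : 0 <= h -> jmeas q (q + n%:R * h) f ->
  (forall x w, `|f x w| <= C) -> forall w,
  \sum_(i < n) tint (q + i%:R * h) (q + i.+1%:R * h) f w = tint q (q + n%:R * h) f w.
Proof.
move=> h0 + fC w; elim: n => [_|n IH mf].
  by rewrite big_ord0 mul0r addr0 /tint set_itvoc0 Rintegral_set0.
have le1 : q <= q + n%:R * h by rewrite lerDl mulr_ge0.
have le2 : q + n%:R * h <= q + n.+1%:R * h by rewrite lerD2l ler_wpM2r// ler_nat.
rewrite big_ord_recr/= IH; last exact: jmeas_sub mf.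
by rewrite -(tint_cat le1 le2 mf fC).
Qed.

End time_integrals.

(** The approximation errors are always taken at most l^2, so that the factor 1/l of
    [product_perturbation] leaves a quantity of order l. *)
Lemma perturbation_le {R : realFieldType} (l x y : R) : 0 < l -> l <= 1 -> x <= l * l -> y <= l * l ->
  (1 + l^-1) * (x + y) <= l * 4.
Proof.
move=> l0 l1 hx hy; have l20 : 0 <= 1 + l^-1 by rewrite addr_ge0// invr_ge0 ltW.
apply: le_trans (ler_wpM2l l20 (lerD hx hy)) _.
have -> : (1 + l^-1) * (l * l + l * l) = 2 * (l * l) + 2 * l by field; exact: lt0r_neq0.
have : l * l <= l by rewrite ler_piMl// ltW.
by lra.
Qed.

(** With p = x' - x and q = y' - y the difference is x q + p y + p q, and Young's inequality with
    weight l bounds the first two terms. The limit objects x, y get the small factor l, the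
    approximation errors p, q the large one. *)
Lemma product_perturbation {R : realType} (l x y x' y' : R) : 0 < l ->
  `|x' * y' - x * y| <=
  l * (x ^+ 2 + y ^+ 2) + (1 + l^-1) * ((x' - x) ^+ 2 + (y' - y) ^+ 2).
Proof.
move=> l0; set p := x' - x; set q := y' - y.
have -> : x' * y' - x * y = x * q + p * y + p * q by rewrite /p /q; ring.
clearbody p q.
have pq : `|p * q| <= p ^+ 2 + q ^+ 2.
  rewrite ler_norml; have := sqr_ge0 (p + q); have := sqr_ge0 (p - q).
  have := sqr_ge0 p; have := sqr_ge0 q.
  by move=> ? ? ? ?; apply/andP; split; nra.
have young (a b : R) : `|a * b| <= l * a ^+ 2 + l^-1 * b ^+ 2.
  rewrite ler_norml; apply/andP; split.
    have : 0 <= l * (a + l^-1 * b) ^+ 2 by rewrite mulr_ge0 ?sqr_ge0 ?ltW.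
    have -> : l * (a + l^-1 * b) ^+ 2 = l * a ^+ 2 + l^-1 * b ^+ 2 + 2 * (a * b).
      by field; exact: lt0r_neq0.
    have : 0 <= l * a ^+ 2 by rewrite mulr_ge0 ?sqr_ge0 ?ltW.
    have : 0 <= l^-1 * b ^+ 2 by rewrite mulr_ge0 ?sqr_ge0 ?invr_ge0 ?ltW.
    lra.
  have : 0 <= l * (a - l^-1 * b) ^+ 2 by rewrite mulr_ge0 ?sqr_ge0 ?ltW.
  have -> : l * (a - l^-1 * b) ^+ 2 = l * a ^+ 2 + l^-1 * b ^+ 2 - 2 * (a * b).
    by field; exact: lt0r_neq0.
  have : 0 <= l * a ^+ 2 by rewrite mulr_ge0 ?sqr_ge0 ?ltW.
  have : 0 <= l^-1 * b ^+ 2 by rewrite mulr_ge0 ?sqr_ge0 ?invr_ge0 ?ltW.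
  lra.
have := young x q; have := young y p; rewrite [y * p]mulrC.
have := ler_normD (x * q + p * y) (p * q); have := ler_normD (x * q) (p * y).
move=> h1 h2 h3 h4.
have -> : l * (x ^+ 2 + y ^+ 2) + (1 + l^-1) * (p ^+ 2 + q ^+ 2) =
  (l * x ^+ 2 + l^-1 * q ^+ 2) + (l * y ^+ 2 + l^-1 * p ^+ 2) + (p ^+ 2 + q ^+ 2) by ring.
lra.
Qed.

Lemma eq0_of_small {R : realType} (x K : R) :
  (forall l, 0 < l -> l <= 1 -> `|x| <= l * K) -> x = 0.
Proof.
move=> h; apply/eqP; rewrite -normr_le0; apply/ler_addgt0Pr => e e0; rewrite add0r.
have K0 : 0 <= K by have := h 1 ltr01 (lexx _); rewrite mul1r; exact: le_trans.
pose l : R := Num.min 1 (e / (K + 1)).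
have K1 : 0 < K + 1 by rewrite ltr_wpDl.
have l0 : 0 < l by rewrite lt_min ltr01 divr_gt0.
have l1 : l <= 1 by rewrite ge_min lexx.
apply: le_trans (h l l0 l1) _.
apply: (@le_trans _ _ (e / (K + 1) * K)).
  by rewrite ler_wpM2r// ge_min lexx orbT.
rewrite mulrAC ler_pdivrMr//; apply: ler_wpM2l; first exact: ltW.
by rewrite lerDl.
Qed.

Section ito_integrals.
Context {R : realType} {d : measure_display} {T : measurableType d}.
Variables (P : probability T R) (F : R -> set_system T).
Hypothesis hF : usual_conditions P F.
Local Notation fmeas := (fmeas F).
Local Notation mu := (@lebesgue_measure R).
Implicit Types (S : simple_process F) (W H M : R -> T -> R).

Lemma simple_eval_bounded S : exists C, forall x w, `|simple_eval S x w| <= C.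
Proof.
have [K hK] := sp_coef_bounded S; exists (\sum_(j < sp_size S) K) => x w.
apply: le_trans (ler_norm_sum _ _ _) _; apply: ler_sum => j _.
rewrite normrM -[leRHS]mulr1; apply: ler_pM => //.
by case: (_ && _); rewrite ?normr1 ?normr0.
Qed.

Lemma simple_eval_jmeas S s t : jmeas s t (simple_eval S).
Proof.
apply: measurable_funTS; apply: measurable_sum => j.
apply: measurable_funM; first by apply: (measurableT_comp (coef_measurable hF S j)).
have -> : (fun z : measurableTypeR R * T => (sp_time S j < z.1 <= sp_time S j.+1)%R%:R : R) =
    (\1_(`]sp_time S j, sp_time S j.+1]%classic : set (measurableTypeR R))) \o fst.
  by apply/funext => z; rewrite /= indicE mem_setE in_itv.
apply: measurableT_comp => //; apply: measurable_indic; exact: measurable_itv.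
Qed.

(** [is_ito_integral] approximates from time 0 at each t; this is the version for increments over
    [s, t], with one simple process serving both the integral and the integrand. *)
Definition approximable W H M s t : Prop := forall e, 0 < e -> exists S,
  [/\ itg P setT (fun w => ((simple_integral W S t w - simple_integral W S s w)
        - (M t w - M s w)) ^+ 2),
      \int[P]_w (((simple_integral W S t w - simple_integral W S s w)
        - (M t w - M s w)) ^+ 2) <= e &
      \int[P]_w (tint s t (fun x w => (simple_eval S x w - H x w) ^+ 2) w) <= e].

Lemma approximable_simple W S s t : approximable W (simple_eval S) (simple_integral W S) s t.
Proof.
move=> e e0; exists S.
have E w : ((simple_integral W S t w - simple_integral W S s w)
        - (simple_integral W S t w - simple_integral W S s w)) ^+ 2 = 0.
  by rewrite subrr expr0n.
split.
- by apply: (eq_itg measurableT (f := fun=> 0)); [move=> w _; rewrite E|exact: itg0].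
- by under eq_rint do rewrite E; rewrite rint0// ltW.
- rewrite (_ : tint _ _ _ = fun=> 0); first by rewrite rint0// ltW.
  apply/funext => w; rewrite /tint; under eq_rint do rewrite subrr expr0n/=.
  by rewrite rint0//; exact: measurable_itv.
Qed.

(** Common interface of simple integrals ([bounded_ito_simple]) and of Ito integrals of bounded
    integrands ([bounded_ito_integral]), so that the covariation formula applies to mixed pairs, as
    in [ito_isometry_diff]. M enters through its increments only. *)
Record bounded_ito W H M (B : R) : Prop := {
  bito_brownian : is_standard_brownian P F W;
  bito_bound : forall x w, `|H x w| <= B;
  bito_jmeas : forall s t, 0 <= s -> jmeas s t H;
  bito_sq : forall s t, 0 <= s -> s <= t ->
     measurable_fun setT (fun w => M t w - M s w) /\
     itg P setT (fun w => (M t w - M s w) ^+ 2);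
  bito_approx : forall s t, 0 <= s -> s <= t -> approximable W H M s t }.

Lemma bounded_ito_simple W S : is_standard_brownian P F W ->
  exists B, bounded_ito W (simple_eval S) (simple_integral W S) B.
Proof.
move=> hW; have [B hB] := simple_eval_bounded S; exists B; split => //.
- by move=> s t _; exact: simple_eval_jmeas.
- move=> s t s0 st; split; first exact: (simple_increment_measurable hF).
  exact: itg_simple_increment_sq.
- by move=> s t _ _; exact: approximable_simple.
Qed.

Lemma near0_lt (u : nat -> \bar R) (e : R) : (u n @[n --> \oo] --> 0)%E -> 0 < e ->
  \forall n \near \oo, (u n < e%:E)%E.
Proof.
move=> u0 e0; apply: (u0 [set x | (x < e%:E)%E]).
by apply: open_ereal_lt'; rewrite lte_fin.
Qed.

Lemma sqr_jmeas s t (f : R -> T -> R) : jmeas s t f -> jmeas s t (fun x w => f x w ^+ 2).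
Proof. by move=> mf; exact: measurable_funX. Qed.

Lemma bounded_ito_integral W H M B : is_standard_brownian P F W ->
  is_ito_integral P F W H M -> (forall x w, `|H x w| <= B) -> bounded_ito W H M B.
Proof.
move=> hW [aH jH aM cM [S hS]] hB.
have mM t : 0 <= t -> measurable_fun setT (M t).
  by move=> t0; exact: (fmeas_measurable hF t0 (fmeas_adapted hF aM t0)).
have appr s t : 0 <= s -> s <= t -> approximable W H M s t.
  move=> s0 st e e0; have t0 := le_trans s0 st.
  (* By (x - y)^2 <= 2 x^2 + 2 y^2, errors e / 4 at the times s and t give the error e on the
     increment. *)
  have e4 : 0 < e / 4 by rewrite divr_gt0.
  have [hs1 hs2] := hS s s0; have [ht1 ht2] := hS t t0.
  have : \forall n \near \oo,
     [/\ (\int[P]_w ((simple_integral W (S n) s w - M s w) ^+ 2)%:E < (e / 4)%:E)%E,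
     (\int[P]_w ((simple_integral W (S n) t w - M t w) ^+ 2)%:E < (e / 4)%:E)%E &
     (\int[P]_w \int[mu]_(x in `[0%R, t])
             ((simple_eval (S n) x w - H x w) ^+ 2)%:E < (e / 4)%:E)%E].
    by near=> n; split; near: n; exact: near0_lt.
  move=> [n _ /(_ n (leqnn n))[h1 h2 h3]]; exists (S n).
  have mI u : 0 <= u -> measurable_fun setT (fun w => simple_integral W (S n) u w - M u w).
    move=> u0; apply: measurable_funB; last exact: mM.
    apply: measurable_sum => j; apply: measurable_funM; first exact: (coef_measurable hF).
    apply: measurable_funB; apply: (brownian_measurable hF hW);
      by rewrite le_min u0 sp_time_ge.
  have isq u : 0 <= u -> (\int[P]_w ((simple_integral W (S n) u w - M u w) ^+ 2)%:E < (e / 4)%:E)%E ->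
     itg P setT (fun w => (simple_integral W (S n) u w - M u w) ^+ 2) /\
     \int[P]_w ((simple_integral W (S n) u w - M u w) ^+ 2) <= e / 4.
    move=> u0 h.
    have i : itg P setT (fun w => (simple_integral W (S n) u w - M u w) ^+ 2).
      apply: itg_ge0P => //; first by apply: measurable_funX; exact: mI.
      - by move=> w _; exact: sqr_ge0.
      - by apply: lt_le_trans h _; exact: leey.
    by split => //; rewrite -lee_fin EFin_rint// ltW.
  have [is_ es] := isq s s0 h1; have [it et] := isq t t0 h2.
  have le w : ((simple_integral W (S n) t w - simple_integral W (S n) s w)
        - (M t w - M s w)) ^+ 2 <= 2 * (simple_integral W (S n) t w - M t w) ^+ 2 +
        2 * (simple_integral W (S n) s w - M s w) ^+ 2.
    set a := simple_integral W (S n) t w; set b := simple_integral W (S n) s w.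
    by have := sqr_ge0 ((a - M t w) + (b - M s w)); nra.
  have i2 := itgD measurableT (itgZ measurableT 2 it) (itgZ measurableT 2 is_).
  have iD : itg P setT (fun w => ((simple_integral W (S n) t w - simple_integral W (S n) s w)
        - (M t w - M s w)) ^+ 2).
    apply: (itg_le measurableT _ i2).
      apply: measurable_funX; apply: measurable_funB; first exact: (simple_increment_measurable hF).
      by apply: measurable_funB; exact: mM.
    by move=> w _; rewrite ger0_norm ?sqr_ge0.
  split => //.
    apply: le_trans (ler_rint measurableT iD i2 (fun w _ => le w)) _.
    rewrite rintD//; [|exact: itgZ|exact: itgZ]; rewrite !rintZ//; lra.
  have [K hK] := simple_eval_bounded (S n).
  pose f x w := (simple_eval (S n) x w - H x w) ^+ 2.
  have mf a b : 0 <= a -> jmeas a b f.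
    move=> a0; apply: sqr_jmeas; apply: jmeasB; first exact: simple_eval_jmeas.
    exact: jointly_measurable_jmeas.
  have fC x w : `|f x w| <= (K + B) ^+ 2.
    rewrite /f ger0_norm ?sqr_ge0// -[leLHS]real_normK ?num_real//.
    rewrite lerXn2r ?nnegrE//; first by apply: le_trans (lerD (hK x w) (hB x w)).
    by apply: le_trans (ler_normB _ _) (lerD (hK x w) (hB x w)).
  have iT := itg_tint P st (mf s t s0) fC.
  rewrite -lee_fin EFin_rint//; apply: le_trans (ltW (lt_trans h3 _)); last first.
    by rewrite lte_fin; lra.
  apply: ge0_le_integral => //.
  - by move=> w _; rewrite lee_fin; apply: rint_ge0 => x _; exact: sqr_ge0.
  - by apply/measurable_EFinP; exact: itg_measurable iT.
  - rewrite (_ : (fun w => _) = fun w => (tint 0 t f w)%:E).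
      by apply/measurable_EFinP; exact: (tint_measurable t0 (mf 0 t (lexx _)) fC).
    apply/funext => w; rewrite /tint EFin_rint; last exact: (itg_section (mf 0 t (lexx _)) fC).
      rewrite integral_itv_obnd_cbnd//.
      by apply/measurable_EFinP; exact: (jmeas_section w (mf 0 t (lexx _))).
    exact: measurable_itv.
  move=> w _; rewrite /tint EFin_rint; [|exact: measurable_itv|exact: (itg_section (mf s t s0) fC)].
  have m0t := jmeas_section w (mf 0 t (lexx _)).
  rewrite -integral_itv_obnd_cbnd; last exact/measurable_EFinP.
  apply: ge0_subset_integral => //.
  - exact/measurable_EFinP.
  - by move=> x _; rewrite lee_fin sqr_ge0.
  - by move=> x /=; rewrite !in_itv/= => /andP[sx ->]; rewrite (le_lt_trans s0 sx).
split => //.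
- by move=> s t s0; exact: jointly_measurable_jmeas.
move=> s t s0 st.
have mD : measurable_fun setT (fun w => M t w - M s w).
  by apply: measurable_funB; apply: mM => //; exact: le_trans st.
split => //.
(* A single simple integral at finite L^2 distance gives the square integrability of the increment
   of M. *)
have [S1 [i1 _ _]] := appr s t s0 st 1 ltr01.
have i2 := itg_simple_increment_sq hF S1 hW s0 st.
have mI := simple_increment_measurable hF S1 hW s0 st.
pose dI w := simple_integral W S1 t w - simple_integral W S1 s w.
apply: (eq_itg measurableT (f := fun w => (dI w + - (dI w - (M t w - M s w))) ^+ 2)).
  by move=> w _; congr (_ ^+ 2); ring.
apply: itg_sqrD => //.
- apply: (measurableT_comp (@oppr_measurable R setT)).
  by apply: measurable_funB.
- by apply: (eq_itg measurableT _ i1) => w _; rewrite sqrrN.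
Unshelve. all: by end_near.
Qed.

Section covariation.
Variables (W1 H1 M1 W2 H2 M2 : R -> T -> R) (B1 B2 : R).
Hypotheses (I1 : bounded_ito W1 H1 M1 B1) (I2 : bounded_ito W2 H2 M2 B2).
Variables (s t : R) (xi : T -> R) (C : R).
Hypotheses (s0 : 0 <= s) (st : s <= t) (mxi : fmeas s xi) (xiC : forall w, `|xi w| <= C).

Local Notation dM1 := (fun w => M1 t w - M1 s w).
Local Notation dM2 := (fun w => M2 t w - M2 s w).

Let C0 : 0 <= C. Proof. exact: le_trans (xiC point). Qed.

Let itg_xi (f : T -> R) : itg P setT f -> itg P setT (fun w => xi w * f w).
Proof.
move=> hf; apply: (itg_mulb measurableT hf) => [|w _]; last exact: xiC.
exact: (fmeas_measurable hF s0 mxi).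
Qed.

Let xi_bound (f g : T -> R) (K : R) : itg P setT f -> itg P setT g ->
  (forall w, `|f w| <= g w) -> \int[P]_w g w <= K ->
  `|\int[P]_w (xi w * f w)| <= C * K.
Proof.
move=> hf hg fg gK; apply: (@le_trans _ _ (C * \int[P]_w g w)); last by rewrite ler_wpM2l.
rewrite -rintZ//; apply: ler_rint_norm => //; [exact: itg_xi|exact: itgZ|].
by move=> w _; rewrite normrM ler_pM.
Qed.

(** For a simple process the mean is exactly 0. The increment of M is within l^2 of a simple one in
    mean square, and |x| <= l + x^2 / l turns this into an error 2 l in mean. *)
Lemma ito_mean : itg P setT dM1 /\ \int[P]_w (xi w * dM1 w) = 0.
Proof.
have [mM iM2] := bito_sq I1 s0 st.
have i1P (f : T -> R) : measurable_fun setT f -> itg P setT (fun w => f w ^+ 2) -> itg P setT f.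
  move=> mf hf; apply: (itg_le measurableT mf (itgD measurableT (itg_cst measurableT (prob_fin P) 1) hf)).
  move=> w _; rewrite -[_ ^+ 2]real_normK ?num_real//.
  by have := sqr_ge0 (`|f w| - 1); nra.
have iM := i1P _ mM iM2; split => //.
apply: (@eq0_of_small _ _ (C * 2)) => l l0 l1.
have [S [iS eS _]] := bito_approx I1 s0 st (mulr_gt0 l0 l0).
have mI := simple_increment_measurable hF S (bito_brownian I1) s0 st.
have iI := i1P _ mI (itg_simple_increment_sq hF S (bito_brownian I1) s0 st).
pose dI w := simple_integral W1 S t w - simple_integral W1 S s w.
have -> : \int[P]_w (xi w * dM1 w) = \int[P]_w (xi w * (dM1 w - dI w)).
  rewrite -[LHS]subr0 -(simple_integral_mean hF s0 st mxi xiC S (bito_brownian I1)).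
  rewrite -rintB//; [|exact: itg_xi|exact: itg_xi].
  by apply: eq_rint => // w _; rewrite /dI; ring.
rewrite mulrCA; apply: (xi_bound (g := fun w => l + l^-1 * (dI w - dM1 w) ^+ 2)).
- exact: itgB.
- apply: itgD => //; [exact: (itg_cst measurableT (prob_fin P))|exact: itgZ].
- move=> w; rewrite distrC; set x := dI w - dM1 w.
  rewrite -[x ^+ 2]real_normK ?num_real// -(ler_pM2l l0) mulrDr mulrA divff ?lt0r_neq0// mul1r -expr2.
  by have := sqr_ge0 (l - `|x|); have := normr_ge0 x; nra.
- rewrite rintD//; [|exact: (itg_cst measurableT (prob_fin P))|exact: itgZ].
  rewrite rint_cst rintZ// mulr2n mulrDr mulr1 lerD2l ler_pdivrMl//.
Qed.

(** The identity is exact for simple processes. Both sides depend continuously on the integrands in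
    L^2; [X1] and [X2] make this quantitative for the left and the right side through
    [product_perturbation]. *)
Lemma ito_covariation r : covariation P F r W1 W2 ->
  \int[P]_w (xi w * (dM1 w * dM2 w)) =
  r * \int[P]_w (xi w * tint s t (fun x w => H1 x w * H2 x w) w).
Proof.
move=> hc.
have [mM1 iM1] := bito_sq I1 s0 st; have [mM2 iM2] := bito_sq I2 s0 st.
pose q1 x w := H1 x w ^+ 2; pose q2 x w := H2 x w ^+ 2.
have bnd (B : R) (x : R) : `|x| <= B -> `|x ^+ 2| <= B ^+ 2.
  by move=> h; rewrite normrX lerXn2r ?nnegrE//; exact: le_trans h.
have mq1 : jmeas s t q1 by apply: sqr_jmeas; exact: bito_jmeas I1 _ _ s0.
have mq2 : jmeas s t q2 by apply: sqr_jmeas; exact: bito_jmeas I2 _ _ s0.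
have bq1 x w : `|q1 x w| <= B1 ^+ 2 by apply: bnd; exact: (bito_bound I1).
have bq2 x w : `|q2 x w| <= B2 ^+ 2 by apply: bnd; exact: (bito_bound I2).
pose A := \int[P]_w (dM1 w ^+ 2) + \int[P]_w (dM2 w ^+ 2).
pose Q := \int[P]_w tint s t q1 w + \int[P]_w tint s t q2 w.
apply/eqP; rewrite -subr_eq0; apply/eqP.
apply: (@eq0_of_small _ _ (C * (A + 4) + `|r| * (C * (Q + 4)))) => l l0 l1.
have [S1 [iS1 eS1 tS1]] := bito_approx I1 s0 st (mulr_gt0 l0 l0).
have [S2 [iS2 eS2 tS2]] := bito_approx I2 s0 st (mulr_gt0 l0 l0).
pose dI1 w := simple_integral W1 S1 t w - simple_integral W1 S1 s w.
pose dI2 w := simple_integral W2 S2 t w - simple_integral W2 S2 s w.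
have mI1 := simple_increment_measurable hF S1 (bito_brownian I1) s0 st.
have mI2 := simple_increment_measurable hF S2 (bito_brownian I2) s0 st.
have jI1 := itg_simple_increment_sq hF S1 (bito_brownian I1) s0 st.
have jI2 := itg_simple_increment_sq hF S2 (bito_brownian I2) s0 st.
have iMM := itg_mul_sq measurableT mM1 mM2 iM1 iM2.
have iII := itg_mul_sq measurableT mI1 mI2 jI1 jI2.
pose HH x w := H1 x w * H2 x w.
pose SS x w := simple_eval S1 x w * simple_eval S2 x w.
have [K1 hK1] := simple_eval_bounded S1; have [K2 hK2] := simple_eval_bounded S2.
have mHH : jmeas s t HH by apply: jmeasM; [exact: bito_jmeas I1 _ _ s0|exact: bito_jmeas I2 _ _ s0].
have mSS : jmeas s t SS by apply: jmeasM; exact: simple_eval_jmeas.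
have bHH x w : `|HH x w| <= B1 * B2 by rewrite normrM ler_pM// ?(bito_bound I1)// (bito_bound I2).
have bSS x w : `|SS x w| <= K1 * K2 by rewrite normrM ler_pM.
have iHH := itg_tint P st mHH bHH; have iSS := itg_tint P st mSS bSS.
pose e1 x w := (simple_eval S1 x w - H1 x w) ^+ 2.
pose e2 x w := (simple_eval S2 x w - H2 x w) ^+ 2.
have me1 : jmeas s t e1.
  by apply: sqr_jmeas; apply: jmeasB; [exact: simple_eval_jmeas|exact: bito_jmeas I1 _ _ s0].
have me2 : jmeas s t e2.
  by apply: sqr_jmeas; apply: jmeasB; [exact: simple_eval_jmeas|exact: bito_jmeas I2 _ _ s0].
have be1 x w : `|e1 x w| <= (K1 + B1) ^+ 2.
  by apply: bnd; apply: le_trans (ler_normB _ _) (lerD (hK1 x w) (bito_bound I1 x w)).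
have be2 x w : `|e2 x w| <= (K2 + B2) ^+ 2.
  by apply: bnd; apply: le_trans (ler_normB _ _) (lerD (hK2 x w) (bito_bound I2 x w)).
have sc := simple_covariation hF s0 st mxi xiC S1 S2
  (bito_brownian I1) (bito_brownian I2) hc.
have X1 : `|\int[P]_w (xi w * (dI1 w * dI2 w - dM1 w * dM2 w))| <= C * (l * (A + 4)).
  apply: (xi_bound (g := fun w => l * (dM1 w ^+ 2 + dM2 w ^+ 2) +
      (1 + l^-1) * ((dI1 w - dM1 w) ^+ 2 + (dI2 w - dM2 w) ^+ 2))).
  - exact: itgB.
  - by apply: itgD => //; apply: itgZ => //; exact: itgD.
  - by move=> w; exact: product_perturbation.
  - rewrite rintD//; [|by apply: itgZ => //; exact: itgD|by apply: itgZ => //; exact: itgD].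
    rewrite !rintZ//; [|exact: itgD|exact: itgD]; rewrite !rintD// -/A [leRHS]mulrDr lerD2l.
    exact: perturbation_le.
have X2 : `|\int[P]_w (xi w * (tint s t SS w - tint s t HH w))| <= C * (l * (Q + 4)).
  apply: (xi_bound (g := fun w => l * (tint s t q1 w + tint s t q2 w) +
      (1 + l^-1) * (tint s t e1 w + tint s t e2 w))).
  - exact: itgB.
  - by apply: itgD => //; apply: itgZ => //; apply: itgD => //; apply: itg_tint; eassumption.
  - move=> w; rewrite /tint -rintB//; [|exact: (itg_section mSS bSS)|exact: (itg_section mHH bHH)].
    have j1 := itg_section mq1 bq1 w; have j2 := itg_section mq2 bq2 w.
    have j3 := itg_section me1 be1 w; have j4 := itg_section me2 be2 w.
    have mD : measurable (`]s, t]%classic : set (measurableTypeR R)) by exact: measurable_itv.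
    rewrite -!rintD// -!rintZ//; [|exact: itgD|exact: itgD].
    rewrite -rintD//; [|by apply: itgZ => //; exact: itgD|by apply: itgZ => //; exact: itgD].
    apply: ler_rint_norm => //.
    + by apply: itgB => //; [exact: (itg_section mSS bSS)|exact: (itg_section mHH bHH)].
    + by apply: itgD => //; apply: itgZ => //; exact: itgD.
    + by move=> x _; exact: product_perturbation.
  - have j1 := itg_tint P st mq1 bq1; have j2 := itg_tint P st mq2 bq2.
    have j3 := itg_tint P st me1 be1; have j4 := itg_tint P st me2 be2.
    rewrite rintD//; [|by apply: itgZ => //; exact: itgD|by apply: itgZ => //; exact: itgD].
    rewrite !rintZ//; [|exact: itgD|exact: itgD]; rewrite !rintD// -/Q [leRHS]mulrDr lerD2l.
    exact: perturbation_le.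
have E1 : \int[P]_w (xi w * (dI1 w * dI2 w - dM1 w * dM2 w)) =
    \int[P]_w (xi w * (dI1 w * dI2 w)) - \int[P]_w (xi w * (dM1 w * dM2 w)).
  rewrite -rintB//; [|exact: itg_xi|exact: itg_xi].
  by apply: eq_rint => // w _; ring.
have E2 : \int[P]_w (xi w * (tint s t SS w - tint s t HH w)) =
    \int[P]_w (xi w * tint s t SS w) - \int[P]_w (xi w * tint s t HH w).
  rewrite -rintB//; [|exact: itg_xi|exact: itg_xi].
  by apply: eq_rint => // w _; ring.
rewrite -/HH; move: X1 X2; rewrite E1 E2 sc -/(SS) => X1 X2.
set a := \int[P]_w (xi w * (dM1 w * dM2 w)) in X1 *.
set b := \int[P]_w (xi w * tint s t HH w) in X2 *.
set c := \int[P]_w (xi w * tint s t SS w) in X2.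
have -> : a - r * b = - (r * c - a) + r * (c - b) by ring.
apply: le_trans (ler_normD _ _) _; rewrite normrN normrM mulrDr lerD//.
  by rewrite mulrCA.
rewrite [leRHS](_ : _ = `|r| * (C * (l * (Q + 4)))); last by ring.
by rewrite ler_wpM2l.
Qed.

End covariation.

End ito_integrals.

(** * Third-order variation *)

Section truncated_cube.
Context {R : realType}.
Implicit Types a b c x y : R.

(** |x|^3 near 0 and x^2 at infinity: small enough to absorb a cubic remainder, yet integrable for
    every square integrable increment. *)
Definition psi x : R := x ^+ 2 * Num.min 1 `|x|.

Lemma psi_ge0 x : 0 <= psi x.
Proof. by rewrite /psi mulr_ge0 ?sqr_ge0// le_min ler01 normr_ge0. Qed.

Lemma psi_le_sq x : psi x <= x ^+ 2.
Proof. by rewrite /psi ler_piMr ?sqr_ge0// ge_min lexx. Qed.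

Lemma psi_homo x y : `|x| <= `|y| -> psi x <= psi y.
Proof.
move=> xy; rewrite /psi -[x ^+ 2]real_normK ?num_real// -[y ^+ 2]real_normK ?num_real//.
rewrite ler_pM ?sqr_ge0 ?le_min ?ler01 ?normr_ge0//.
  by rewrite lerXn2r ?nnegrE.
by rewrite ge_min lexx/= ge_min xy orbT.
Qed.

Lemma psiM c x : psi (c * x) <= (c ^+ 2 + `|c| ^+ 3) * psi x.
Proof.
rewrite /psi exprMn normrM.
rewrite [leLHS](_ : _ = x ^+ 2 * (c ^+ 2 * Num.min 1 (`|c| * `|x|))); last by ring.
rewrite [leRHS](_ : _ = x ^+ 2 * ((c ^+ 2 + `|c| ^+ 3) * Num.min 1 `|x|)); last by ring.
rewrite ler_wpM2l ?sqr_ge0//.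
have c0 := normr_ge0 c; have x0 := normr_ge0 x.
have c2 : c ^+ 2 = `|c| ^+ 2 by rewrite real_normK ?num_real.
have [x1|x1] := leP 1 `|x|.
  rewrite mulr1; apply: (@le_trans _ _ (c ^+ 2)).
    by rewrite ler_piMr ?sqr_ge0// ge_min lexx.
  by rewrite lerDl exprn_ge0.
rewrite mulrDl; apply: (@le_trans _ _ (`|c| ^+ 3 * `|x|)).
  rewrite c2 [`|c| ^+ 3]exprSr -mulrA ler_wpM2l ?sqr_ge0//.
  by rewrite ge_min lexx orbT.
by rewrite lerDr mulr_ge0 ?sqr_ge0.
Qed.

Lemma psi_double x : psi (2 * x) <= 8 * psi x.
Proof.
rewrite /psi normrM ger0_norm// exprMn -[leLHS]mulrA.
have x0 := normr_ge0 x; have q0 := sqr_ge0 x.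
have -> : 8 * (x ^+ 2 * Num.min 1 `|x|) = 2 ^+ 2 * (x ^+ 2 * (2 * Num.min 1 `|x|)) by ring.
rewrite ler_wpM2l// ler_wpM2l//.
have [x1|x1] := leP 1 `|x|; first by rewrite mulr1 ge_min ler1n.
by rewrite ge_min lexx orbT.
Qed.

Lemma psiD a b : psi (a + b) <= 8 * psi a + 8 * psi b.
Proof.
have [ab|/ltW ba] := leP `|a| `|b|.
  apply: le_trans (psi_homo (y := 2 * b) _) _.
    by rewrite normrM ger0_norm//; have := ler_normD a b; lra.
  by apply: le_trans (psi_double b) _; rewrite lerDr mulr_ge0// psi_ge0.
apply: le_trans (psi_homo (y := 2 * a) _) _.
  by rewrite normrM ger0_norm//; have := ler_normD a b; lra.
by apply: le_trans (psi_double a) _; rewrite lerDl mulr_ge0// psi_ge0.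
Qed.

(** Used with x the increment of a simple integral and y the approximation error, for which nothing
    better than a second moment is available. *)
Lemma psiD_sq x y : psi (x + y) <= 8 * psi x + 4 * y ^+ 2.
Proof.
have h := ler_normD x y; have x0 := psi_ge0 x; have y0 := sqr_ge0 y.
have [xy|/ltW yx] := leP `|x| `|y|.
  apply: le_trans (psi_homo (y := 2 * y) _) _; first by rewrite normrM ger0_norm//; lra.
  apply: le_trans (psi_le_sq _) _; rewrite exprMn; lra.
apply: le_trans (psi_homo (y := 2 * x) _) _; first by rewrite normrM ger0_norm//; lra.
by have := psi_double x; lra.
Qed.

(** The first term is enough when |x| <= e, the second one otherwise. It brings the fourth moments
    of simple integrals into play. *)
Lemma psi_le_pow4 e x : 0 < e -> psi x <= e * x ^+ 2 + (e ^+ 2)^-1 * x ^+ 4.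
Proof.
move=> e0; have q0 := sqr_ge0 x.
have f0 : 0 <= (e ^+ 2)^-1 * x ^+ 4.
  by rewrite mulr_ge0 ?exprn_even_ge0// invr_ge0 sqr_ge0.
have [xe|ex] := leP `|x| e.
  apply: (@le_trans _ _ (e * x ^+ 2)); last by rewrite lerDl.
  by rewrite mulrC /psi ler_wpM2l// ge_min xe orbT.
apply: (@le_trans _ _ ((e ^+ 2)^-1 * x ^+ 4)); last first.
  by rewrite lerDr mulr_ge0// ltW.
apply: le_trans (psi_le_sq x) _.
rewrite ler_pdivlMl ?exprn_gt0// -[4%N]/(2 + 2)%N exprD ler_wpM2r//.
rewrite -[x ^+ 2]real_normK ?num_real// lerXn2r ?nnegrE//; first exact: ltW.
exact: ltW.
Qed.

Lemma psi_measurable : measurable_fun setT psi.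
Proof.
apply: measurable_funM; first exact: measurable_funX.
by apply: measurable_minr => //; exact: normr_measurable.
Qed.

End truncated_cube.

Section small_variation.
Context {R : realType} {d : measure_display} {T : measurableType d}.
Variables (P : probability T R) (F : R -> set_system T).
Hypothesis hF : usual_conditions P F.
Local Notation kappa := (gauss_moment (R := R) 2).

Definition grid (q t : R) (n i : nat) : R := q + i%:R * ((t - q) / n%:R).

Definition small_variation (M : R -> T -> R) (q t : R) : Prop :=
  forall e, 0 < e -> exists n0, forall n, (n0 <= n)%N -> (0 < n)%N ->
    \sum_(i < n) \int[P]_w psi (M (grid q t n i.+1) w - M (grid q t n i) w) <= e.

Lemma itg_psi (f : T -> R) : measurable_fun setT f -> itg P setT (fun w => f w ^+ 2) ->
  itg P setT (fun w => psi (f w)).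
Proof.
move=> mf hf; apply: (itg_le measurableT _ hf).
  by apply: (measurableT_comp (@psi_measurable R)).
by move=> w _; rewrite ger0_norm ?psi_ge0// psi_le_sq.
Qed.

Lemma small_variationB (M N : R -> T -> R) (c q t : R) : 0 <= q -> q <= t ->
  (forall s t, 0 <= s -> s <= t -> measurable_fun setT (fun w => M t w - M s w) /\
     itg P setT (fun w => (M t w - M s w) ^+ 2)) ->
  (forall s t, 0 <= s -> s <= t -> measurable_fun setT (fun w => N t w - N s w) /\
     itg P setT (fun w => (N t w - N s w) ^+ 2)) ->
  small_variation M q t -> small_variation N q t ->
  small_variation (fun u w => c * (M u w - N u w)) q t.
Proof.
move=> q0 qt hM hN sM sN e e0.
pose K := 8 * (c ^+ 2 + `|c| ^+ 3) + 8 * ((- c) ^+ 2 + `|- c| ^+ 3).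
have K0 : 0 <= K.
  by rewrite /K normrN sqrrN addr_ge0// mulr_ge0// addr_ge0 ?sqr_ge0 ?exprn_ge0.
have e1 : 0 < e / (2 * (K + 1)) by rewrite divr_gt0// mulr_gt0// ltr_wpDl.
have [n1 h1] := sM _ e1; have [n2 h2] := sN _ e1.
exists (maxn n1 n2) => n; rewrite geq_max => /andP[n1n n2n] n0.
have := h1 n n1n n0; have := h2 n n2n n0.
rewrite /grid; set h := (t - q) / n%:R => {}h2 {}h1.
have hh : 0 <= h by rewrite divr_ge0 ?subr_ge0.
have p0 i : 0 <= q + i%:R * h by rewrite addr_ge0// mulr_ge0.
have pS i : q + i%:R * h <= q + i.+1%:R * h by rewrite lerD2l ler_wpM2r// ler_nat.
have term i : \int[P]_w psi (c * (M (q + i.+1%:R * h) w - N (q + i.+1%:R * h) w) -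
      c * (M (q + i%:R * h) w - N (q + i%:R * h) w)) <=
    K * \int[P]_w psi (M (q + i.+1%:R * h) w - M (q + i%:R * h) w) +
    K * \int[P]_w psi (N (q + i.+1%:R * h) w - N (q + i%:R * h) w).
  have [mM iM] := hM _ _ (p0 i) (pS i); have [mN iN] := hN _ _ (p0 i) (pS i).
  have jM := itg_psi mM iM; have jN := itg_psi mN iN.
  set dM := fun w => M (q + i.+1%:R * h) w - M (q + i%:R * h) w in mM iM jM *.
  set dN := fun w => N (q + i.+1%:R * h) w - N (q + i%:R * h) w in mN iN jN *.
  rewrite -!rintZ// -rintD//; [|exact: itgZ|exact: itgZ].
  have le w : psi (c * (M (q + i.+1%:R * h) w - N (q + i.+1%:R * h) w) -
      c * (M (q + i%:R * h) w - N (q + i%:R * h) w)) <= K * psi (dM w) + K * psi (dN w).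
    have -> : c * (M (q + i.+1%:R * h) w - N (q + i.+1%:R * h) w) -
      c * (M (q + i%:R * h) w - N (q + i%:R * h) w) = c * dM w + (- c) * dN w.
      by rewrite /dM /dN; ring.
    apply: le_trans (psiD _ _) _; apply: lerD.
      apply: (@le_trans _ _ (8 * ((c ^+ 2 + `|c| ^+ 3) * psi (dM w)))).
        by rewrite ler_wpM2l// psiM.
      rewrite mulrA ler_wpM2r ?psi_ge0// /K lerDl.
      by rewrite mulr_ge0// addr_ge0 ?sqr_ge0 ?exprn_ge0.
    apply: (@le_trans _ _ (8 * (((- c) ^+ 2 + `|- c| ^+ 3) * psi (dN w)))).
      by rewrite ler_wpM2l// psiM.
    rewrite mulrA ler_wpM2r ?psi_ge0// /K lerDr.
    by rewrite mulr_ge0// addr_ge0 ?sqr_ge0 ?exprn_ge0.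
  have iR : itg P setT (fun w => K * psi (dM w) + K * psi (dN w)).
    by apply: itgD => //; exact: itgZ.
  apply: ler_rint => //; apply: (itg_le measurableT _ iR) => [|w _].
    apply: (measurableT_comp (@psi_measurable R)).
    rewrite (_ : (fun w => _) = fun w => c * dM w - c * dN w).
      by apply: measurable_funB; apply: measurable_funM.
    by apply/funext => w; rewrite /dM /dN; ring.
  by rewrite ger0_norm ?psi_ge0.
apply: le_trans (ler_sum _ (fun (i : 'I_n) _ => term i)) _.
rewrite big_split/= -!mulr_sumr.
apply: (@le_trans _ _ (K * (e / (2 * (K + 1))) + K * (e / (2 * (K + 1))))).
  by rewrite lerD// ler_wpM2l.
have -> : K * (e / (2 * (K + 1))) + K * (e / (2 * (K + 1))) = e * (K / (K + 1)).
  by field; rewrite gt_eqF// ltr_wpDl.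
apply: ler_piMr; first exact: ltW.
by rewrite ler_pdivrMr ?ltr_wpDl// mul1r lerDl.
Qed.

Section one_integral.
Variables (W H M : R -> T -> R) (B : R).
Hypothesis I : bounded_ito P F W H M B.

Let one_fmeas s : fmeas F s (fun=> 1 : R).
Proof. exact: measurable_cst. Qed.

Let norm_one (w : T) : `|1 : R| <= 1.
Proof. by rewrite normr1. Qed.

(** [bounded_ito] is not stated for differences of integrals; the square is expanded and
    [ito_covariation] applied to the three pairs. *)
Lemma ito_isometry_diff (S : simple_process F) BS s t : 0 <= s -> s <= t ->
  bounded_ito P F W (simple_eval S) (simple_integral W S) BS ->
  let D w := (M t w - M s w) - (simple_integral W S t w - simple_integral W S s w) in
  [/\ measurable_fun setT D, itg P setT (fun w => D w ^+ 2) &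
    \int[P]_w (D w ^+ 2) =
    kappa * \int[P]_w tint s t (fun x w => (simple_eval S x w - H x w) ^+ 2) w].
Proof.
move=> s0 st J D.
have hc := covariation_brownian hF (bito_brownian I).
have [mM iM] := bito_sq I s0 st; have [mI iI] := bito_sq J s0 st.
have iMM := itg_mul_sq measurableT mM mM iM iM.
have iMI := itg_mul_sq measurableT mM mI iM iI.
have iII := itg_mul_sq measurableT mI mI iI iI.
have e1 := ito_covariation hF I I s0 st (@one_fmeas s) norm_one hc.
have e2 := ito_covariation hF I J s0 st (@one_fmeas s) norm_one hc.
have e3 := ito_covariation hF J J s0 st (@one_fmeas s) norm_one hc.
have mH : jmeas s t H by exact: (bito_jmeas I).
have mS : jmeas s t (simple_eval S) by exact: (bito_jmeas J).
have bM (f g : R -> T -> R) (a b : R) : (forall x w, `|f x w| <= a) ->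
    (forall x w, `|g x w| <= b) -> forall x w, `|f x w * g x w| <= a * b.
  by move=> fa gb x w; rewrite normrM ler_pM.
have bH := bito_bound I; have bS := bito_bound J.
have one (f : T -> R) : \int[P]_w (1 * f w) = \int[P]_w f w.
  by apply: eq_rint => // w _; rewrite mul1r.
have mD : measurable_fun setT D by exact: measurable_funB.
split => //.
  apply: (eq_itg measurableT (f := fun w => (M t w - M s w) ^+ 2 -
    2 * ((M t w - M s w) * (simple_integral W S t w - simple_integral W S s w)) +
    (simple_integral W S t w - simple_integral W S s w) ^+ 2)).
    by move=> w _; rewrite /D; ring.
  by apply: itgD => //; apply: itgB => //; exact: itgZ.
rewrite (_ : \int[P]_w (D w ^+ 2) = \int[P]_w (1 * ((M t w - M s w) * (M t w - M s w))) -
    2 * \int[P]_w (1 * ((M t w - M s w) * (simple_integral W S t w - simple_integral W S s w))) +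
    \int[P]_w (1 * ((simple_integral W S t w - simple_integral W S s w) *
       (simple_integral W S t w - simple_integral W S s w)))); last first.
  rewrite !one.
  rewrite -rintZ// -rintB//; last exact: itgZ.
  rewrite -rintD//; last by apply: itgB => //; exact: itgZ.
  by apply: eq_rint => // w _; rewrite /D; ring.
rewrite e1 e2 e3.
have i1 := itg_tint P st (jmeasM mH mH) (bM _ _ _ _ bH bH).
have i2 := itg_tint P st (jmeasM mH mS) (bM _ _ _ _ bH bS).
have i3 := itg_tint P st (jmeasM mS mS) (bM _ _ _ _ bS bS).
rewrite !one.
have alg (k a b c : R) : k * a - 2 * (k * b) + k * c = k * (a - 2 * b + c) by ring.
have -> : \int[P]_w tint s t (fun x w0 => (simple_eval S x w0 - H x w0) ^+ 2) w =
  \int[P]_w tint s t (fun x w => H x w * H x w) w -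
  2 * \int[P]_w tint s t (fun x w => H x w * simple_eval S x w) w +
  \int[P]_w tint s t (fun x w => simple_eval S x w * simple_eval S x w) w.
  rewrite -rintZ// -rintB//; last exact: itgZ.
  rewrite -rintD//; last by apply: itgB => //; exact: itgZ.
  apply: eq_rint => // w _.
  have mD' : measurable (`]s, t]%classic : set (measurableTypeR R)) by exact: measurable_itv.
  have j1 := itg_section (jmeasM mH mH) (bM _ _ _ _ bH bH) w.
  have j2 := itg_section (jmeasM mH mS) (bM _ _ _ _ bH bS) w.
  have j3 := itg_section (jmeasM mS mS) (bM _ _ _ _ bS bS) w.
  rewrite /tint -rintZ// -rintB//; last exact: itgZ.
  rewrite -rintD//; last by apply: itgB => //; exact: itgZ.
  by apply: eq_rint => // x _; ring.
exact: alg.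
Qed.

Lemma ito_second_moment s t : 0 <= s -> s <= t ->
  \int[P]_w ((M t w - M s w) ^+ 2) <= kappa * B ^+ 2 * (t - s).
Proof.
move=> s0 st.
have hc := covariation_brownian hF (bito_brownian I).
have [mM iM] := bito_sq I s0 st.
have := ito_covariation hF I I s0 st (@one_fmeas s) norm_one hc.
have one (f : T -> R) : \int[P]_w (1 * f w) = \int[P]_w f w.
  by apply: eq_rint => // w _; rewrite mul1r.
rewrite !one => e.
rewrite (_ : \int[P]_w ((M t w - M s w) ^+ 2) =
   \int[P]_w ((M t w - M s w) * (M t w - M s w))); last first.
  by apply: eq_rint => // w _; rewrite expr2.
have bH := bito_bound I; have mH : jmeas s t H by exact: (bito_jmeas I).
have bHH x w : `|H x w * H x w| <= B ^+ 2 by rewrite normrM expr2 ler_pM.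
rewrite e -mulrA; apply: ler_wpM2l; first exact/ltW/gauss_moment2_gt0.
rewrite -[leRHS](rint_cst P); apply: ler_rint => //.
- exact: (itg_tint P st (jmeasM mH mH) bHH).
- exact: (itg_cst measurableT (prob_fin P)).
- by move=> w _; apply: le_trans (ler_norm _) (tint_bound st (jmeasM mH mH) bHH w).
Qed.

End one_integral.

(** M is compared with the integral of one simple process. By the isometry the error sums over the
    grid to kappa times the L^2 error of the integrand, whatever n is. For the simple integral,
    [psi_le_pow4] gives a term of order a, uniformly in n, and fourth moments whose sum is of order
    1/n. *)
Lemma ito_small_variation W H M B q t : bounded_ito P F W H M B ->
  0 <= q -> q <= t -> small_variation M q t.
Proof.
move=> I q0 qt e e0.
have k0 : 0 < kappa := gauss_moment2_gt0.
(* The terms below cost e1 for the second moments (choice of [a]), e1 for the fourth moments (choice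
   of n) and 4 kappa e1 for the approximation; 2 + 4 kappa is less than the denominator. *)
pose e1 := e / (9 + 4 * kappa).
have e10 : 0 < e1 by rewrite divr_gt0// addr_gt0// mulr_gt0.
have [S [_ _ tS]] := bito_approx I q0 qt e10.
have [BS J] := bounded_ito_simple hF S (bito_brownian I).
have [K4 K40 h4] := simple_integral_moment4 hF S (bito_brownian I).
pose A := kappa * BS ^+ 2 * (t - q).
have A0 : 0 <= A.
  apply: mulr_ge0; last by rewrite subr_ge0.
  by apply: mulr_ge0; [exact: ltW|exact: sqr_ge0].
pose a := e1 / (8 * (A + 1)).
have a0 : 0 < a by rewrite divr_gt0// mulr_gt0// ltr_wpDl.
pose G := 8 * (K4 * (t - q) ^+ 2 / a ^+ 2).
have G0 : 0 <= G / e1.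
  apply: divr_ge0; last exact: ltW.
  apply: mulr_ge0 => //; apply: divr_ge0; last exact: sqr_ge0.
  by apply: mulr_ge0 => //; exact: sqr_ge0.
exists (Num.bound (G / e1)) => n n1 n0.
rewrite /grid; set h := (t - q) / n%:R.
have nR : 0 < n%:R :> R by rewrite ltr0n.
have Gn : G / n%:R <= e1.
  rewrite ler_pdivrMr// mulrC -ler_pdivrMr//.
  by apply: le_trans (ltW (archi_boundP G0)) _; rewrite ler_nat.
have hh : 0 <= h by rewrite divr_ge0 ?subr_ge0.
have p0 i : 0 <= q + i%:R * h by rewrite addr_ge0// mulr_ge0.
have pS i : q + i%:R * h <= q + i.+1%:R * h by rewrite lerD2l ler_wpM2r// ler_nat.
have pB i : q + i.+1%:R * h - (q + i%:R * h) = h by rewrite -natr1; ring.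
pose f x w := (simple_eval S x w - H x w) ^+ 2.
have term i : \int[P]_w psi (M (q + i.+1%:R * h) w - M (q + i%:R * h) w) <=
   8 * (a * (kappa * BS ^+ 2 * h) + (a ^+ 2)^-1 * (K4 * h ^+ 2)) +
   4 * (kappa * \int[P]_w tint (q + i%:R * h) (q + i.+1%:R * h) f w).
  have [mM iM] := bito_sq I (p0 i) (pS i); have [mI iI] := bito_sq J (p0 i) (pS i).
  have [i4 l4] := h4 _ _ (p0 i) (pS i); rewrite pB in l4.
  have l2 : \int[P]_w ((simple_integral W S (q + i.+1%:R * h) w -
       simple_integral W S (q + i%:R * h) w) ^+ 2) <= kappa * BS ^+ 2 * h.
    by rewrite -[h in leRHS](pB i); exact: (ito_second_moment J).
  have [mD iD eD] := ito_isometry_diff I (p0 i) (pS i) J.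
  rewrite -/f in eD; rewrite -eD.
  set dM := fun w => M (q + i.+1%:R * h) w - M (q + i%:R * h) w in mM iM *.
  set dI := fun w => simple_integral W S (q + i.+1%:R * h) w -
       simple_integral W S (q + i%:R * h) w in mI iI i4 l4 l2 mD iD *.
  have le w : psi (dM w) <= 8 * (a * dI w ^+ 2 + (a ^+ 2)^-1 * dI w ^+ 4) +
      4 * (dM w - dI w) ^+ 2.
    have -> : dM w = dI w + (dM w - dI w) by ring.
    have := psi_le_pow4 (dI w) a0; set x := dI w; set y := dM w - dI w => h1.
    have -> : x + y - x = y by ring.
    apply: (@le_trans _ _ (8 * psi x + 4 * y ^+ 2)); last by rewrite lerD2r ler_wpM2l.
    exact: psiD_sq.
  have iR1 : itg P setT (fun w => a * dI w ^+ 2 + (a ^+ 2)^-1 * dI w ^+ 4).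
    by apply: itgD => //; exact: itgZ.
  apply: le_trans (ler_rint measurableT (itg_psi mM iM) _ (fun w _ => le w)) _.
    by apply: itgD => //; exact: itgZ.
  rewrite rintD//; [|exact: itgZ|exact: itgZ].
  rewrite lerD//; last by rewrite rintZ.
  rewrite rintZ// ler_wpM2l// rintD//; [|exact: itgZ|exact: itgZ].
  rewrite !rintZ// lerD//; first by apply: ler_wpM2l => //; exact: ltW.
  by rewrite ler_wpM2l// invr_ge0 sqr_ge0.
apply: le_trans (ler_sum _ (fun (i : 'I_n) _ => term i)) _.
rewrite big_split/= sumr_const card_ord -mulr_sumr -mulr_sumr.
have qn : q + n%:R * h = t by rewrite /h mulrC divfK ?lt0r_neq0// subrKC.
have mf : jmeas q (q + n%:R * h) f.
  by apply: sqr_jmeas; apply: jmeasB; [exact: (bito_jmeas J)|exact: (bito_jmeas I)].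
have bf x w : `|f x w| <= (BS + B) ^+ 2.
  rewrite normrX lerXn2r ?nnegrE//.
    by apply: addr_ge0; [exact: le_trans (normr_ge0 _) (bito_bound J x w)|exact: le_trans (normr_ge0 _) (bito_bound I x w)].
  by apply: le_trans (ler_normB _ _) (lerD (bito_bound J x w) (bito_bound I x w)).
have -> : \sum_(i < n) \int[P]_w tint (q + i%:R * h) (q + i.+1%:R * h) f w =
    \int[P]_w tint q t f w.
  rewrite -rint_sum//.
    by apply: eq_rint => // w _; rewrite (tint_grid hh mf bf) qn.
  move=> i _; apply: (itg_tint P (pS i) (C := (BS + B) ^+ 2)) => //.
  apply: jmeas_sub mf; first by rewrite lerDl mulr_ge0.
  by rewrite lerD2l ler_wpM2r// ler_nat.
have -> : (8 * (a * (kappa * BS ^+ 2 * h) + (a ^+ 2)^-1 * (K4 * h ^+ 2))) *+ n =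
    8 * (a * A) + G / n%:R.
  rewrite -mulr_natr /G /A /h; field.
  by rewrite !lt0r_neq0.
have aA : 8 * (a * A) <= e1.
  have -> : 8 * (a * A) = e1 * (A / (A + 1)).
    by rewrite /a; field; rewrite gt_eqF// ltr_wpDl.
  apply: ler_piMr; first exact: ltW.
  by rewrite ler_pdivrMr ?ltr_wpDl// mul1r lerDl.
have l3 : 4 * (kappa * \int[P]_w tint q t f w) <= 4 * kappa * e1.
  by rewrite mulrA ler_wpM2l// mulr_ge0// ltW.
have -> : e = 9 * e1 + 4 * kappa * e1.
  by rewrite /e1; field; rewrite gt_eqF// addr_gt0// mulr_gt0.
have := ltW e10; lra.
Qed.

End small_variation.

(** * The logarithmic potential *)

Section log_potential.
Context {R : realType}.
Implicit Types x y z w s e k : R.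

(** The function g (x) = ln (1 + x) - x + x^2 / 2 vanishes at 0 and has derivative x^2 / (1 + x). By
    the mean value theorem g is nonnegative on the right of 0, and on the left |g (z)| is at most
    |z|^3 / k because 1 + c >= k between z and 0. *)
Lemma ln1p_lower k z : 0 < k -> k <= 1 -> k <= 1 + z ->
  z - z ^+ 2 / 2 - `|z| ^+ 3 / k <= ln (1 + z).
Proof.
move=> k0 k1 kz.
pose g x : R := ln (1 + x) - x + x ^+ 2 / 2.
pose dg x : R := (1 + x)^-1 - 1 + x.
have dgE x : -1 < x -> is_derive x 1 g (dg x).
  move=> x1; have x10 : 0 < 1 + x by lra.
  have h1 : is_derive x (1 : R) (fun x => ln (1 + x)) (1 + x)^-1.
    rewrite -[X in is_derive _ _ _ X]mulr1.
    apply: (@is_derive1_comp _ (@ln R) (fun x => 1 + x)); first exact: is_derive1_ln.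
    by rewrite -[X in is_derive _ _ _ X]add0r; exact: (is_deriveD (is_derive_cst (1 : R) x 1) (is_derive_id x 1)).
  rewrite /g /dg; apply: is_derive_eq.
  by rewrite /GRing.scale/=; field; exact: lt0r_neq0.
have cg a b : -1 < a -> {within `[a, b], continuous g}.
  move=> a1; apply: derivable_within_continuous => x; rewrite in_itv/= => /andP[ax _].
  by case: (dgE x (lt_le_trans a1 ax)).
have g0 : g 0 = 0 by rewrite /g addr0 ln1 subr0 expr0n/= mul0r addr0.
have dgf x : -1 < x -> dg x = x ^+ 2 / (1 + x).
  by move=> x1; rewrite /dg; field; lra.
suff : - (`|z| ^+ 3 / k) <= g z by rewrite /g; lra.
have [z0|z0] := leP 0 z.
  apply: (@le_trans _ _ 0); first by rewrite oppr_le0 divr_ge0 ?exprn_ge0// ltW.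
  have [||c + e] := @MVT_segment _ g dg 0 z z0.
  - by move=> x; rewrite in_itv/= => /andP[x0 _]; apply: dgE; lra.
  - by apply: cg; lra.
  rewrite in_itv/= => /andP[c0 _]; move: e; rewrite g0 subr0 => ->.
  rewrite subr0 mulr_ge0// dgf; last lra.
  by rewrite divr_ge0 ?sqr_ge0//; lra.
have z1 : -1 < z by lra.
have [||c + e] := @MVT_segment _ g dg z 0 (ltW z0).
- by move=> x; rewrite in_itv/= => /andP[x0 _]; apply: dgE; lra.
- exact: cg.
rewrite in_itv/= => /andP[zc c0]; move: e; rewrite g0 !sub0r => e.
have {e} -> : g z = dg c * z by rewrite -[g z]opprK e mulrN opprK.
rewrite dgf; last lra.
have cz : c ^+ 2 / (1 + c) <= z ^+ 2 / k.
  apply: ler_pM; rewrite ?sqr_ge0 ?invr_ge0//; first lra.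
    by rewrite -[c ^+ 2]sqrrN -[z ^+ 2]sqrrN lerXn2r ?nnegrE//; lra.
  by rewrite lef_pV2 ?posrE//; lra.
rewrite ltr0_norm// exprSr -[(- z) ^+ 2]sqrrN opprK.
rewrite [leLHS](_ : _ = z ^+ 2 / k * z); last by ring.
by rewrite ler_nM2r.
Qed.

(** Purely algebraic: with q = sqrt (1 + z), the error of the quadratic expansion is (q - 1)^3 (q +
    3) / 8. *)
Lemma sqrt1p_lower z : -1 <= z ->
  1 + z / 2 - z ^+ 2 / 8 - `|z| ^+ 3 / 2 <= Num.sqrt (1 + z).
Proof.
move=> z1; have z10 : 0 <= 1 + z by lra.
set q := Num.sqrt (1 + z); have q0 : 0 <= q by exact: sqrtr_ge0.
have qq : q ^+ 2 = 1 + z by rewrite sqr_sqrtr.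
have {qq} -> : z = q ^+ 2 - 1 by rewrite qq; ring.
clearbody q; clear z z1 z10.
have [q1|q1] := leP 1 q.
  have h : 0 <= `|q ^+ 2 - 1| ^+ 3 by rewrite exprn_ge0.
  have : 0 <= (q - 1) ^+ 3 * (q + 3) by rewrite mulr_ge0 ?exprn_ge0//; lra.
  have -> : (q - 1) ^+ 3 * (q + 3) =
     8 * (q - (1 + (q ^+ 2 - 1) / 2 - (q ^+ 2 - 1) ^+ 2 / 8)) by field.
  lra.
have -> : `|q ^+ 2 - 1| = (1 - q) * (1 + q).
  rewrite ler0_norm; first by ring.
  by rewrite subr_le0 expr_le1// ltW.
have : (1 - q) ^+ 3 * (q + 3) <= 4 * ((1 - q) * (1 + q)) ^+ 3.
  rewrite exprMn mulrCA ler_wpM2l ?exprn_ge0//; first lra.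
  have : 1 <= (1 + q) ^+ 3 by rewrite -[1 in leLHS](expr1n _ 3) lerXn2r ?nnegrE//; lra.
  lra.
have -> : (1 - q) ^+ 3 * (q + 3) =
     - 8 * (q - (1 + (q ^+ 2 - 1) / 2 - (q ^+ 2 - 1) ^+ 2 / 8)) by field.
lra.
Qed.

Definition pot (k w : R) : R := ln w + k * Num.sqrt w.

(** Second-order expansion in z = v / w with an explicit cubic remainder; 1 + z >= e / b is the
    bound that [ln1p_lower] asks for. A lower bound suffices, since the potential is to be shown to
    grow in mean. *)
Lemma pot_lower k e b w v : 0 <= k -> 0 < e -> e <= b -> 1 <= b ->
  e <= w -> w <= b -> e <= w + v ->
  pot k w + (1 / w + k / (2 * Num.sqrt w)) * v
    - (1 / (2 * w ^+ 2) + k / (8 * w * Num.sqrt w)) * v ^+ 2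
    - (b / e + k * b) / e ^+ 3 * `|v| ^+ 3 <= pot k (w + v).
Proof.
move=> k0 e0 eb b1 ew wb ewv.
have w0 : 0 < w by exact: lt_le_trans ew.
set s := Num.sqrt w; have s0 : 0 < s by rewrite sqrtr_gt0.
have ss : s ^+ 2 = w by rewrite sqr_sqrtr// ltW.
pose z := v / w.
have wz : w + v = w * (1 + z) by rewrite /z mulrDr mulr1 mulrC divfK ?lt0r_neq0.
have z1 : 0 < 1 + z by rewrite -(pmulr_rgt0 _ w0) -wz; exact: lt_le_trans ewv.
have kz : e / b <= 1 + z.
  rewrite ler_pdivrMr ?(lt_le_trans e0)//; apply: le_trans ewv _.
  by rewrite wz [leRHS]mulrC; apply: ler_wpM2r => //; exact: ltW.
have b0 : 0 < b by exact: lt_le_trans eb.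
have eb1 : e / b <= 1 by rewrite ler_pdivrMr// mul1r.
have lnE : ln (w + v) = ln w + ln (1 + z) by rewrite wz lnM ?posrE.
have sqE : Num.sqrt (w + v) = s * Num.sqrt (1 + z) by rewrite wz sqrtrM// ltW.
have L := ln1p_lower (divr_gt0 e0 b0) eb1 kz.
have S : 1 + z / 2 - z ^+ 2 / 8 - `|z| ^+ 3 / 2 <= Num.sqrt (1 + z).
  by apply: sqrt1p_lower; lra.
have sb : s <= b.
  have : s ^+ 2 <= b ^+ 2.
    by rewrite ss; apply: le_trans wb _; rewrite expr2 ler_peMl// ltW.
  by rewrite ler_pXn2r// nnegrE ltW.
have nz : `|z| ^+ 3 <= `|v| ^+ 3 / e ^+ 3.
  rewrite /z normrM exprMn ler_wpM2l ?exprn_ge0// normfV -exprVn.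
  rewrite gtr0_norm//; apply: lerXn2r; rewrite ?nnegrE ?invr_ge0; [exact: ltW|exact: ltW|].
  by rewrite lef_pV2 ?posrE.
have S' := ler_wpM2l (mulr_ge0 k0 (ltW s0)) S.
have c3 : `|z| ^+ 3 / (e / b) + k * s * (`|z| ^+ 3 / 2) <= (b / e + k * b) / e ^+ 3 * `|v| ^+ 3.
  rewrite [leRHS](_ : _ = `|v| ^+ 3 / e ^+ 3 * (b / e + k * b)); last by ring.
  rewrite [leLHS](_ : _ = `|z| ^+ 3 * (b / e + k * s / 2)); last first.
    by field; rewrite !lt0r_neq0.
  apply: ler_pM => //.
    by apply: addr_ge0; [apply: divr_ge0; exact: ltW|apply: divr_ge0 => //; apply: mulr_ge0 => //; exact: ltW].
  rewrite lerD2l -mulrA ler_wpM2l//; lra.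
rewrite /pot -/s lnE sqE.
have e1 : (1 / w + k / (2 * s)) * v = z + k * s * (z / 2).
  by rewrite /z -ss; field; rewrite lt0r_neq0.
have e2 : (1 / (2 * w ^+ 2) + k / (8 * w * s)) * v ^+ 2 = z ^+ 2 / 2 + k * s * (z ^+ 2 / 8).
  by rewrite /z -ss; field; rewrite lt0r_neq0.
rewrite e1 e2.
have -> : k * (s * Num.sqrt (1 + z)) = k * s * Num.sqrt (1 + z) by ring.
move: L S' c3; move: (ln (1 + z)) (Num.sqrt (1 + z)) (k * s) => a q c L.
rewrite !(mulrDr, mulrBr, mulr1, mulrN) => S' c3.
lra.
Qed.

End log_potential.

(** * Growth of the potential over one increment *)

Section potential_step.
Context {R : realType}.
Implicit Types k e x y b m h w p n a : R.

(* pot_d1 is the derivative of pot, pot_d2 is minus half of its second derivative. *)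
Definition pot_d1 k w := 1 / w + k / (2 * Num.sqrt w).
Definition pot_d2 k w := 1 / (2 * w ^+ 2) + k / (8 * w * Num.sqrt w).

(** Remainder constant of [pot_lower] for b = 2, the bound on w inside the unit disc when e <= 1. *)
Definition pot_C0 k e := (2 / e + k * 2) / e ^+ 3.

(** The terms with 5 and 27 pay for small increments ([pot_step_small]), the last group for large
    ones ([pot_step_large]); the sum serves both. *)
Definition pot_C1 k e := 5 * pot_d2 k e + 27 * pot_C0 k e + (2 + 3 * k + 3 * pot_d1 k e - ln e).

Lemma pot_d1_ge0 k e w : 0 <= k -> 0 < e -> e <= w -> 0 <= pot_d1 k w.
Proof.
move=> k0 e0 ew; have w0 := lt_le_trans e0 ew.
by rewrite addr_ge0// divr_ge0// ?mulr_ge0// ?sqrtr_ge0// ltW.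
Qed.

Lemma pot_d2_ge0 k e w : 0 <= k -> 0 < e -> e <= w -> 0 <= pot_d2 k w.
Proof.
move=> k0 e0 ew; have w0 := lt_le_trans e0 ew.
apply: addr_ge0; apply: divr_ge0 => //; apply: mulr_ge0; rewrite ?sqr_ge0 ?sqrtr_ge0//.
by rewrite mulr_ge0// ltW.
Qed.

Lemma pot_d1_le k e w : 0 <= k -> 0 < e -> e <= w -> pot_d1 k w <= pot_d1 k e.
Proof.
move=> k0 e0 ew; have w0 := lt_le_trans e0 ew; have sw := ler_wsqrtr ew.
have se : 0 < Num.sqrt e by rewrite sqrtr_gt0.
have sw0 : 0 < Num.sqrt w by rewrite sqrtr_gt0.
rewrite lerD// ?ler_wpM2l// lef_pV2 ?posrE// ?mulr_gt0// ler_wpM2l//.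
Qed.

Lemma pot_d2_le k e w : 0 <= k -> 0 < e -> e <= w -> pot_d2 k w <= pot_d2 k e.
Proof.
move=> k0 e0 ew; have w0 := lt_le_trans e0 ew; have sw := ler_wsqrtr ew.
have se : 0 < Num.sqrt e by rewrite sqrtr_gt0.
have sw0 : 0 < Num.sqrt w by rewrite sqrtr_gt0.
rewrite lerD// ?ler_wpM2l// lef_pV2 ?posrE ?mulr_gt0 ?exprn_gt0//.
  by rewrite ler_wpM2l// lerXn2r ?nnegrE// ltW.
apply: ler_pM => //; last by rewrite ler_wpM2l.
by rewrite mulr_ge0// ltW.
Qed.

Lemma norm2_le y1 y2 : y1 ^+ 2 + y2 ^+ 2 <= (`|y1| + `|y2|) ^+ 2.
Proof.
rewrite -[y1 ^+ 2]real_normK ?num_real// -[y2 ^+ 2]real_normK ?num_real//.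
by have := mulr_ge0 (normr_ge0 y1) (normr_ge0 y2); nra.
Qed.

Lemma abs_le1_of_norm2 x1 x2 : x1 ^+ 2 + x2 ^+ 2 <= 1 -> `|x1| <= 1 /\ `|x2| <= 1.
Proof.
move=> h; have := sqr_ge0 x1; have := sqr_ge0 x2 => h1 h2.
by split; rewrite -(@expr_le1 _ 2)// real_normK ?num_real//; lra.
Qed.

Lemma dot_le x1 x2 y1 y2 : x1 ^+ 2 + x2 ^+ 2 <= 1 ->
  `|x1 * y1 + x2 * y2| <= `|y1| + `|y2|.
Proof.
move=> /abs_le1_of_norm2[h1 h2]; apply: le_trans (ler_normD _ _) _.
by rewrite !normrM lerD// ler_piMl.
Qed.

Lemma pot_C0_ge0 k e : 0 <= k -> 0 < e -> 0 <= pot_C0 k e.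
Proof.
move=> k0 e0.
apply: divr_ge0; last by rewrite exprn_ge0// ltW.
by apply: addr_ge0; [apply: divr_ge0 => //; exact: ltW|exact: mulr_ge0].
Qed.

(** No expansion is made: w' is only known to be at least e, which gives [pot k w' >= ln e], and
    every term on the left is at most a constant times a^2. *)
Lemma pot_step_large k e w w' p n a : 0 <= k -> 0 < e -> e <= 1 -> e <= w -> w <= 2 -> e <= w' -> 1 <= a ->
  `|p| <= a -> 0 <= n -> n <= a ^+ 2 ->
  pot k w + 2 * pot_d1 k w * p + pot_d1 k w * n - 4 * pot_d2 k w * p ^+ 2 - pot_C1 k e * a ^+ 2
    <= pot k w'.
Proof.
move=> k0 e0 e1 ew w2 ew' a1 pa n0 na; have C00 := pot_C0_ge0 k0 e0; have lne0 := ln_le0 e1.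
have w0 := lt_le_trans e0 ew; have w'0 := lt_le_trans e0 ew'.
have F0 := pot_d1_ge0 k0 e0 ew; have E0 := pot_d2_ge0 k0 e0 ew; have FF := pot_d1_le k0 e0 ew.
have aa : 1 <= a ^+ 2 by rewrite expr_ge1//; lra.
have a_le : a <= a ^+ 2 by rewrite expr2 ler_peMl//; lra.
have pw : pot k w <= 2 + 3 * k.
  apply: lerD; first by apply: le_trans (ltW (ln_sublinear w0)) _.
  rewrite mulrC ler_wpM2r//; have := sqr_sqrtr (ltW w0).
  have := sqr_ge0 (Num.sqrt w - 1); nra.
have pw' : ln e <= pot k w'.
  rewrite -[leLHS]addr0; apply: lerD; first by rewrite ler_ln ?posrE.
  by rewrite mulr_ge0 ?sqrtr_ge0.
have Ep : 0 <= 4 * pot_d2 k w * p ^+ 2 by rewrite mulr_ge0 ?sqr_ge0// mulr_ge0.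
have pp : pot_d1 k w * p <= pot_d1 k e * a ^+ 2.
  apply: (@le_trans _ _ (pot_d1 k w * a ^+ 2)); last by rewrite ler_wpM2r// sqr_ge0.
  by rewrite ler_wpM2l//; apply: le_trans (ler_norm p) (le_trans pa a_le).
have nn : pot_d1 k w * n <= pot_d1 k e * a ^+ 2.
  apply: (@le_trans _ _ (pot_d1 k w * a ^+ 2)); last by rewrite ler_wpM2r// sqr_ge0.
  by rewrite ler_wpM2l.
have X : (2 + 3 * k - ln e) <= (2 + 3 * k - ln e) * a ^+ 2 by rewrite ler_peMr//; move: k0 lne0; clear; lra.
have Y : 0 <= (5 * pot_d2 k e + 27 * pot_C0 k e) * a ^+ 2.
  by rewrite mulr_ge0 ?sqr_ge0// addr_ge0// mulr_ge0// (pot_d2_ge0 k0 e0).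
have -> : pot_C1 k e * a ^+ 2 = (5 * pot_d2 k e + 27 * pot_C0 k e) * a ^+ 2 + (2 + 3 * k - ln e) * a ^+ 2 +
  3 * (pot_d1 k e * a ^+ 2) by rewrite /pot_C1; ring.
rewrite -[2 * pot_d1 k w * p]mulrA.
move: pw pw' Ep pp nn X Y; clear.
move: (pot k w) (pot k w') (ln e) (pot_d1 k w * p) (pot_d1 k w * n) (4 * _ * _) (pot_d1 k e * _)
  ((5 * pot_d2 k e + _) * _) ((2 + 3 * k - _) * _) => *; lra.
Qed.

(** Here p stands for the scalar product of position and increment and n for the squared length of
    the increment, so that w increases by 2 p + n. In (2 p + n)^2 only 4 p^2 is of second order; p n
    and n^2 are at most a^3. *)
Lemma pot_step_small k e w p n a : 0 <= k -> 0 < e -> e <= 1 -> e <= w -> w <= 2 -> e <= w + (2 * p + n) -> 0 <= a -> a <= 1 ->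
  `|p| <= a -> 0 <= n -> n <= a ^+ 2 ->
  pot k w + 2 * pot_d1 k w * p + pot_d1 k w * n - 4 * pot_d2 k w * p ^+ 2 - pot_C1 k e * a ^+ 3
    <= pot k (w + (2 * p + n)).
Proof.
move=> k0 e0 e1 ew w2 ew' a0 a1 pa n0 na; have C00 := pot_C0_ge0 k0 e0; have lne0 := ln_le0 e1.
have e2 : e <= 2 by lra.
have := @pot_lower R k e 2 w (2 * p + n) k0 e0 e2 (ler1n R 2) ew w2 ew'.
rewrite -/(pot_d1 k w) -/(pot_d2 k w) -/(pot_C0 k e).
have E0 := pot_d2_ge0 k0 e0 ew; have EE := pot_d2_le k0 e0 ew.
have F0 : 0 <= pot_d1 k e by exact: (pot_d1_ge0 k0 e0).
have a2 : a ^+ 2 <= a by rewrite expr2 ler_piMl.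
have a3 : 0 <= a ^+ 3 by rewrite exprn_ge0.
have v3 : `|2 * p + n| ^+ 3 <= 27 * a ^+ 3.
  have -> : 27 * a ^+ 3 = (3 * a) ^+ 3 by ring.
  rewrite lerXn2r ?nnegrE ?mulr_ge0//; apply: le_trans (ler_normD _ _) _.
  by rewrite normrM (ger0_norm n0) ger0_norm//; move: pa na a2; clear; lra.
have v2 : (2 * p + n) ^+ 2 <= 4 * p ^+ 2 + 5 * a ^+ 3.
  have pn : p * n <= a ^+ 3.
    apply: le_trans (ler_norm _) _; rewrite normrM exprS ler_pM//.
    by rewrite ger0_norm.
  have nn : n ^+ 2 <= a ^+ 3.
    rewrite expr2; apply: (@le_trans _ _ (a ^+ 2 * a ^+ 2)); first by rewrite ler_pM.
    by rewrite [leRHS]exprSr ler_wpM2l ?sqr_ge0.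
  have -> : (2 * p + n) ^+ 2 = 4 * p ^+ 2 + (4 * (p * n) + n ^+ 2) by ring.
  by move: pn nn; clear; lra.
have X : pot_d2 k w * (2 * p + n) ^+ 2 <= 4 * pot_d2 k w * p ^+ 2 + 5 * pot_d2 k e * a ^+ 3.
  apply: (@le_trans _ _ (pot_d2 k w * (4 * p ^+ 2 + 5 * a ^+ 3))); first by rewrite ler_wpM2l.
  rewrite mulrDr lerD//; first by rewrite mulrA [pot_d2 k w * 4]mulrC.
  by rewrite mulrA [pot_d2 k w * 5]mulrC ler_wpM2r// ler_wpM2l.
have Y : pot_C0 k e * `|2 * p + n| ^+ 3 <= pot_C0 k e * (27 * a ^+ 3) by rewrite ler_wpM2l.
have Z : 0 <= (2 + 3 * k + 3 * pot_d1 k e - ln e) * a ^+ 3.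
  by rewrite mulr_ge0//; move: k0 F0 lne0; clear; lra.
have -> : pot_C1 k e * a ^+ 3 = 5 * pot_d2 k e * a ^+ 3 + pot_C0 k e * (27 * a ^+ 3) +
   (2 + 3 * k + 3 * pot_d1 k e - ln e) * a ^+ 3 by rewrite /pot_C1; ring.
have -> : pot_d1 k w * (2 * p + n) = 2 * pot_d1 k w * p + pot_d1 k w * n by ring.
move: X Y Z; clear.
by move=> *; lra.
Qed.

(** The two regimes a >= 1 and a <= 1 correspond to the two branches a^2 and a^3 of [psi], with a =
    |y1| + |y2|. *)
Lemma pot_step_increment k e x1 x2 y1 y2 : 0 <= k -> 0 < e -> e <= 1 -> x1 ^+ 2 + x2 ^+ 2 <= 1 ->
  forall w p, w = x1 ^+ 2 + x2 ^+ 2 + e -> p = x1 * y1 + x2 * y2 ->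
  pot k w + 2 * pot_d1 k w * p + pot_d1 k w * (y1 ^+ 2 + y2 ^+ 2) - 4 * pot_d2 k w * p ^+ 2
    - pot_C1 k e * psi (`|y1| + `|y2|)
    <= pot k ((x1 + y1) ^+ 2 + (x2 + y2) ^+ 2 + e).
Proof.
move=> k0 e0 e1 x1x2 _ _ -> ->.
set w := x1 ^+ 2 + x2 ^+ 2 + e; set p := x1 * y1 + x2 * y2.
have w'E : (x1 + y1) ^+ 2 + (x2 + y2) ^+ 2 + e = w + (2 * p + (y1 ^+ 2 + y2 ^+ 2)).
  by rewrite /w /p; ring.
have ew : e <= w by rewrite /w; have := sqr_ge0 x1; have := sqr_ge0 x2; lra.
have w2 : w <= 2 by rewrite /w; lra.
have ew' : e <= (x1 + y1) ^+ 2 + (x2 + y2) ^+ 2 + e.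
  by have := sqr_ge0 (x1 + y1); have := sqr_ge0 (x2 + y2); lra.
have a0 : 0 <= `|y1| + `|y2| by rewrite addr_ge0.
have n0 : 0 <= y1 ^+ 2 + y2 ^+ 2 by rewrite addr_ge0 ?sqr_ge0.
rewrite /psi [`| `|y1| + `|y2| |]ger0_norm//.
have [a1|/ltW a1] := leP 1 (`|y1| + `|y2|).
  by rewrite mulr1; apply: pot_step_large => //; [exact: dot_le|exact: norm2_le].
by rewrite -exprSr w'E; apply: pot_step_small => //; [rewrite -w'E|exact: dot_le|exact: norm2_le].
Qed.

Lemma psi_abs x : psi `|x| = psi x.
Proof. by rewrite /psi normr_id real_normK ?num_real. Qed.

(** Increments are split into a drift part b and a martingale part m. Among the terms with b, only
    the scalar product of b with the position is of first order in h. It is bounded with |x1|, |x2|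
    <= sqrt w, and so stays comparable to what k sqrt w brings in. All the others go into C, which
    depends on e. *)
Lemma pot_step k e B : 0 <= k -> 0 < e -> e <= 1 -> 0 <= B -> exists2 C, 0 <= C &
  forall x1 x2 b1 b2 m1 m2 h, x1 ^+ 2 + x2 ^+ 2 <= 1 -> 0 <= h ->
    `|b1| <= B * h -> `|b2| <= B * h ->
  forall w p, w = x1 ^+ 2 + x2 ^+ 2 + e -> p = x1 * m1 + x2 * m2 ->
  pot k w + 2 * pot_d1 k w * p + pot_d1 k w * (m1 ^+ 2 + m2 ^+ 2) - 4 * pot_d2 k w * p ^+ 2
    - 4 * pot_d1 k w * Num.sqrt w * B * h
    - C * (h ^+ 2 + h * (`|m1| + `|m2|) + (psi m1 + psi m2))
    <= pot k ((x1 + (b1 + m1)) ^+ 2 + (x2 + (b2 + m2)) ^+ 2 + e).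
Proof.
move=> k0 e0 e1 B0; have C00 := pot_C0_ge0 k0 e0; have lne0 := ln_le0 e1.
have F0 : 0 <= pot_d1 k e by exact: (pot_d1_ge0 k0 e0).
have E0 : 0 <= pot_d2 k e by exact: (pot_d2_ge0 k0 e0).
have C10 : 0 <= pot_C1 k e.
  by rewrite /pot_C1; move: F0 E0 C00 lne0 k0; clear; lra.
(* Each summand dominates a coefficient occurring in [T2], [T3] or [T4], but multiplies the whole
   error sum; the facts [U1] to [U11] say that the surplus is nonnegative. *)
exists (4 * pot_d1 k e * B + 16 * pot_d2 k e * B + 16 * pot_d2 k e * B ^+ 2 + 64 * pot_C1 k e + 16 * pot_C1 k e * B ^+ 2).
  by rewrite !addr_ge0 ?mulr_ge0 ?sqr_ge0.
move=> x1 x2 b1 b2 m1 m2 h xx h0 hb1 hb2 _ _ -> ->.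
set w := x1 ^+ 2 + x2 ^+ 2 + e; set p := x1 * m1 + x2 * m2.
have := @pot_step_increment k e x1 x2 (b1 + m1) (b2 + m2) k0 e0 e1 xx w _ erefl erefl.
set y1 := b1 + m1; set y2 := b2 + m2; set c := `|m1| + `|m2|.
have c0 : 0 <= c by rewrite addr_ge0.
have Bh : 0 <= B * h by rewrite mulr_ge0.
have ew : e <= w by rewrite /w; have := sqr_ge0 x1; have := sqr_ge0 x2; lra.
have w0 := lt_le_trans e0 ew.
have Fw := pot_d1_ge0 k0 e0 ew; have FF := pot_d1_le k0 e0 ew.
have Ew := pot_d2_ge0 k0 e0 ew; have EE := pot_d2_le k0 e0 ew.
set s := Num.sqrt w; have s0 : 0 <= s by exact: sqrtr_ge0.
have ss : s ^+ 2 = w by rewrite sqr_sqrtr// ltW.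
have xs x y : x ^+ 2 + y ^+ 2 + e = w -> `|x| <= s.
  move=> xyw; rewrite -(@ler_pXn2r _ 2) ?nnegrE// real_normK ?num_real// ss -xyw.
  by have := sqr_ge0 y; have := ltW e0; lra.
have x1s : `|x1| <= s by exact: (xs x1 x2).
have x2s : `|x2| <= s by apply: (xs x2 x1); rewrite /w; ring.
have [x11 x21] := abs_le1_of_norm2 xx.
pose pb := x1 * b1 + x2 * b2.
have pbs : `|pb| <= 2 * s * (B * h).
  apply: le_trans (ler_normD _ _) _; rewrite !normrM -mulrA mulr_natl mulr2n.
  by rewrite lerD// ler_pM.
have pb1 : `|pb| <= 2 * (B * h).
  apply: le_trans (ler_normD _ _) _; rewrite !normrM mulr_natl mulr2n.
  by rewrite lerD// -[leRHS]mul1r ler_pM.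
have pc : `|p| <= c by exact: dot_le.
have pE : x1 * y1 + x2 * y2 = pb + p by rewrite /pb /p /y1 /y2; ring.
rewrite pE => S.
have T1 : - (4 * pot_d1 k w * s * B * h) <= 2 * pot_d1 k w * pb.
  have : pot_d1 k w * `|pb| <= pot_d1 k w * (2 * s * (B * h)) by rewrite ler_wpM2l.
  have : pot_d1 k w * (- `|pb|) <= pot_d1 k w * pb by rewrite ler_wpM2l// lerNnormlW.
  rewrite [4 * pot_d1 k w * s * B * h](_ : _ = 2 * (pot_d1 k w * (2 * s * (B * h)))); last by ring.
  rewrite -[2 * pot_d1 k w * pb]mulrA mulrN; clear; lra.
have bm b m : `|b| <= B * h -> `|m| <= c -> m ^+ 2 - 2 * (B * h) * `|m| <= (b + m) ^+ 2.
  move=> hb mc; have -> : (b + m) ^+ 2 = m ^+ 2 + 2 * (b * m) + b ^+ 2 by ring.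
  have := sqr_ge0 b; have := lerNnormlW (lexx `|b * m|).
  have : `|b * m| <= B * h * `|m| by rewrite normrM ler_wpM2r.
  by move: (b * m) (B * h) (b ^+ 2) => u v z; clear; lra.
have T2 : pot_d1 k w * (m1 ^+ 2 + m2 ^+ 2) - 2 * pot_d1 k e * B * (h * c) <= pot_d1 k w * (y1 ^+ 2 + y2 ^+ 2).
  have m1c : `|m1| <= c by rewrite /c lerDl.
  have m2c : `|m2| <= c by rewrite /c lerDr.
  have n1 := bm b1 m1 hb1 m1c; have n2 := bm b2 m2 hb2 m2c.
  have : pot_d1 k w * (m1 ^+ 2 + m2 ^+ 2 - 2 * (B * h) * c) <= pot_d1 k w * (y1 ^+ 2 + y2 ^+ 2).
    rewrite ler_wpM2l// /c mulrDr; move: n1 n2; rewrite -/y1 -/y2; clear; lra.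
  have : pot_d1 k w * (2 * (B * h) * c) <= pot_d1 k e * (2 * (B * h) * c).
    by rewrite ler_wpM2r// mulr_ge0// mulr_ge0.
  have -> : pot_d1 k e * (2 * (B * h) * c) = 2 * pot_d1 k e * B * (h * c) by ring.
  rewrite mulrBr; clear; lra.
have T3 : 4 * pot_d2 k w * (pb + p) ^+ 2 <= 4 * pot_d2 k w * p ^+ 2 +
    (16 * pot_d2 k e * B * (h * c) + 16 * pot_d2 k e * B ^+ 2 * h ^+ 2).
  have q : (pb + p) ^+ 2 <= p ^+ 2 + (4 * (B * h) * c + 4 * (B * h) ^+ 2).
    have -> : (pb + p) ^+ 2 = p ^+ 2 + (2 * (pb * p) + pb ^+ 2) by ring.
    have h1 : pb * p <= 2 * (B * h) * c.
      by apply: le_trans (ler_norm _) _; rewrite normrM ler_pM.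
    have h2 : pb ^+ 2 <= (2 * (B * h)) ^+ 2.
      by rewrite -[leLHS]real_normK ?num_real// lerXn2r ?nnegrE// mulr_ge0.
    have h3 : (2 * (B * h)) ^+ 2 = 4 * (B * h) ^+ 2 by ring.
    by rewrite h3 in h2; move: h1 h2; clear; lra.
  have q' := ler_wpM2l Ew q.
  have : pot_d2 k w * (4 * (B * h) * c + 4 * (B * h) ^+ 2) <= pot_d2 k e * (4 * (B * h) * c + 4 * (B * h) ^+ 2).
    by rewrite ler_wpM2r// addr_ge0 ?mulr_ge0 ?sqr_ge0.
  have -> : 16 * pot_d2 k e * B * (h * c) + 16 * pot_d2 k e * B ^+ 2 * h ^+ 2 =
    4 * (pot_d2 k e * (4 * (B * h) * c + 4 * (B * h) ^+ 2)) by ring.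
  move: q'; rewrite [pot_d2 k w * (p ^+ 2 + _)]mulrDr -!mulrA; clear; lra.
have T4 : pot_C1 k e * psi (`|y1| + `|y2|) <= 64 * pot_C1 k e * (psi m1 + psi m2) + 16 * pot_C1 k e * B ^+ 2 * h ^+ 2.
  have yc : `|y1| + `|y2| <= c + 2 * (B * h).
    have := ler_normD b1 m1; have := ler_normD b2 m2; rewrite -/y1 -/y2 /c.
    by move: hb1 hb2; clear; lra.
  have q : psi (`|y1| + `|y2|) <= 64 * (psi m1 + psi m2) + 16 * (B * h) ^+ 2.
    apply: le_trans (psi_homo (y := c + 2 * (B * h)) _) _.
      have ry : 0 <= c + 2 * (B * h) by apply: addr_ge0 => //; exact: mulr_ge0.
      by rewrite (ger0_norm ry) ger0_norm// addr_ge0.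
    apply: le_trans (psiD_sq _ _) _.
    have := psiD `|m1| `|m2|; rewrite !psi_abs -/c.
    have -> : (2 * (B * h)) ^+ 2 = 4 * (B * h) ^+ 2 by ring.
    clear; lra.
  apply: le_trans (ler_wpM2l C10 q) _.
  by rewrite le_eqVlt; apply/orP; left; apply/eqP; ring.
have Psi0 : 0 <= psi m1 + psi m2 by rewrite addr_ge0 ?psi_ge0.
have U1 : 0 <= 4 * pot_d1 k e * B * h ^+ 2 by do ![done | exact: sqr_ge0 | apply: mulr_ge0].
have U2 : 0 <= 4 * pot_d1 k e * B * (psi m1 + psi m2) by do ![done | exact: sqr_ge0 | apply: mulr_ge0].
have U3 : 0 <= 2 * pot_d1 k e * B * (h * c) by do ![done | exact: sqr_ge0 | apply: mulr_ge0].
have U4 : 0 <= 16 * pot_d2 k e * B * h ^+ 2 by do ![done | exact: sqr_ge0 | apply: mulr_ge0].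
have U5 : 0 <= 16 * pot_d2 k e * B * (psi m1 + psi m2) by do ![done | exact: sqr_ge0 | apply: mulr_ge0].
have U6 : 0 <= 16 * pot_d2 k e * B ^+ 2 * (h * c) by do ![done | exact: sqr_ge0 | apply: mulr_ge0].
have U7 : 0 <= 16 * pot_d2 k e * B ^+ 2 * (psi m1 + psi m2).  by do ![done | exact: sqr_ge0 | apply: mulr_ge0].
have U8 : 0 <= 64 * pot_C1 k e * h ^+ 2 by do ![done | exact: sqr_ge0 | apply: mulr_ge0].
have U9 : 0 <= 64 * pot_C1 k e * (h * c) by do ![done | exact: sqr_ge0 | apply: mulr_ge0].
have U10 : 0 <= 16 * pot_C1 k e * B ^+ 2 * (h * c) by do ![done | exact: sqr_ge0 | apply: mulr_ge0].
have U11 : 0 <= 16 * pot_C1 k e * B ^+ 2 * (psi m1 + psi m2).  by do ![done | exact: sqr_ge0 | apply: mulr_ge0].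
apply: le_trans S.
set Psi := psi m1 + psi m2 in T4 U2 U5 U7 U11 *.
have -> : 2 * pot_d1 k w * (pb + p) = 2 * pot_d1 k w * pb + 2 * pot_d1 k w * p by ring.
have -> : (4 * pot_d1 k e * B + 16 * pot_d2 k e * B + 16 * pot_d2 k e * B ^+ 2 + 64 * pot_C1 k e + 16 * pot_C1 k e * B ^+ 2) *
   (h ^+ 2 + h * c + Psi) =
  4 * pot_d1 k e * B * h ^+ 2 + 2 * (2 * pot_d1 k e * B * (h * c)) + 4 * pot_d1 k e * B * Psi +
  (16 * pot_d2 k e * B * h ^+ 2 + 16 * pot_d2 k e * B * (h * c) + 16 * pot_d2 k e * B * Psi) +
  (16 * pot_d2 k e * B ^+ 2 * h ^+ 2 + 16 * pot_d2 k e * B ^+ 2 * (h * c) + 16 * pot_d2 k e * B ^+ 2 * Psi) +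
  (64 * pot_C1 k e * h ^+ 2 + 64 * pot_C1 k e * (h * c) + 64 * pot_C1 k e * Psi) +
  (16 * pot_C1 k e * B ^+ 2 * h ^+ 2 + 16 * pot_C1 k e * B ^+ 2 * (h * c) + 16 * pot_C1 k e * B ^+ 2 * Psi) by ring.
move: T1 T2 T3 T4 U1 U2 U3 U4 U5 U6 U7 U8 U9 U10 U11; clear.
move: (pot k w) (2 * pot_d1 k w * pb) (2 * pot_d1 k w * p) (pot_d1 k w * (y1 ^+ 2 + _)) (pot_d1 k w * (m1 ^+ 2 + _))
  (4 * pot_d2 k w * (pb + p) ^+ 2) (4 * pot_d2 k w * p ^+ 2) (pot_C1 k e * psi _)
  (4 * pot_d1 k w * s * B * h) (2 * pot_d1 k e * B * (h * c)) (4 * pot_d1 k e * B * h ^+ 2) (4 * pot_d1 k e * B * Psi)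
  (16 * pot_d2 k e * B * h ^+ 2) (16 * pot_d2 k e * B * (h * c)) (16 * pot_d2 k e * B * Psi)
  (16 * pot_d2 k e * B ^+ 2 * h ^+ 2) (16 * pot_d2 k e * B ^+ 2 * (h * c)) (16 * pot_d2 k e * B ^+ 2 * Psi)
  (64 * pot_C1 k e * h ^+ 2) (64 * pot_C1 k e * (h * c)) (64 * pot_C1 k e * Psi)
  (16 * pot_C1 k e * B ^+ 2 * h ^+ 2) (16 * pot_C1 k e * B ^+ 2 * (h * c)) (16 * pot_C1 k e * B ^+ 2 * Psi).
move=> *; lra.
Qed.

End potential_step.

Section almost_everywhere.
Context {R : realType} {d : measure_display} {T : measurableType d} (P : probability T R).

Lemma ae_ler_rint (f g : T -> R) : itg P setT f -> itg P setT g ->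
  {ae P, forall w, f w <= g w} -> \int[P]_w f w <= \int[P]_w g w.
Proof.
move=> hf hg fg; have mf := itg_measurable hf; have mg := itg_measurable hg.
pose h w := Num.min (f w) (g w).
have hh : itg P setT h.
  apply: (itg_le measurableT _ (itgD measurableT (itg_norm hf) (itg_norm hg))).
    exact: measurable_minr.
  move=> w _; rewrite /h minEle; case: ifP => _.
    by rewrite lerDl.
  by rewrite lerDr.
have -> : \int[P]_w f w = \int[P]_w h w.
  congr fine; apply: ae_eq_integral => //; try exact/measurable_EFinP/(itg_measurable _).
  - by apply/measurable_EFinP.
  - by apply/measurable_EFinP; exact: itg_measurable hh.
  by apply: filterS fg => w fw _; rewrite /h min_l.
by apply: ler_rint => // w _; rewrite /h ge_min lexx orbT.
Qed.

End almost_everywhere.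

Lemma half_le1 {R : realFieldType} (e : R) : 0 < e -> 2 * e <= 1 -> e <= 1.
Proof. by lra. Qed.

Lemma add_le2 {R : realFieldType} (x e : R) : 0 < e -> 2 * e <= 1 -> x <= 1 -> x + e <= 2.
Proof. by lra. Qed.

(** * Planar semimartingales *)

Section planar_processes.
Context {R : realType} {d : measure_display} {T : measurableType d}.
Variables (P : probability T R) (F : R -> set_system T).
Hypothesis hF : usual_conditions P F.
Local Notation fmeas := (fmeas F).

(* (X1, X2) has martingale part (M1, M2), drift bounded by B and bracket       *)
(* diag(c + V1, c + V2) ds; the defects V1, V2 vanish in the region of interest. *)
Record planar_process (X1 X2 M1 M2 V1 V2 : R -> T -> R) (B c c2 CV q t : R) : Prop := {
  pp_start : 0 <= q;
  pp_end : q < t;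
  pp_B : 0 <= B;
  pp_c : 0 < c;
  pp_c2 : 0 <= c2;
  pp_adapted1 : adapted F X1;
  pp_adapted2 : adapted F X2;
  pp_sq1 : forall s u, 0 <= s -> s <= u ->
    measurable_fun setT (fun w => M1 u w - M1 s w) /\ itg P setT (fun w => (M1 u w - M1 s w) ^+ 2);
  pp_sq2 : forall s u, 0 <= s -> s <= u ->
    measurable_fun setT (fun w => M2 u w - M2 s w) /\ itg P setT (fun w => (M2 u w - M2 s w) ^+ 2);
  pp_mean1 : forall s u xi C, 0 <= s -> s <= u -> fmeas s xi -> (forall w, `|xi w| <= C) ->
    \int[P]_w (xi w * (M1 u w - M1 s w)) = 0;
  pp_mean2 : forall s u xi C, 0 <= s -> s <= u -> fmeas s xi -> (forall w, `|xi w| <= C) ->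
    \int[P]_w (xi w * (M2 u w - M2 s w)) = 0;
  pp_moment1 : forall s u, 0 <= s -> s <= u -> \int[P]_w ((M1 u w - M1 s w) ^+ 2) <= c2 * (u - s);
  pp_moment2 : forall s u, 0 <= s -> s <= u -> \int[P]_w ((M2 u w - M2 s w) ^+ 2) <= c2 * (u - s);
  pp_cross : forall s u xi C, 0 <= s -> s <= u -> fmeas s xi -> (forall w, `|xi w| <= C) ->
    \int[P]_w (xi w * ((M1 u w - M1 s w) * (M2 u w - M2 s w))) = 0;
  pp_var1 : forall s u xi C, 0 <= s -> s <= u -> fmeas s xi -> (forall w, `|xi w| <= C) ->
    \int[P]_w (xi w * (M1 u w - M1 s w) ^+ 2) =
    c * (u - s) * \int[P]_w xi w + \int[P]_w (xi w * tint s u V1 w);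
  pp_var2 : forall s u xi C, 0 <= s -> s <= u -> fmeas s xi -> (forall w, `|xi w| <= C) ->
    \int[P]_w (xi w * (M2 u w - M2 s w) ^+ 2) =
    c * (u - s) * \int[P]_w xi w + \int[P]_w (xi w * tint s u V2 w);
  pp_jmeas1 : forall s u, 0 <= s -> jmeas s u V1;
  pp_jmeas2 : forall s u, 0 <= s -> jmeas s u V2;
  pp_bound1 : forall s w, `|V1 s w| <= CV;
  pp_bound2 : forall s w, `|V2 s w| <= CV;
  pp_small1 : small_variation P M1 q t;
  pp_small2 : small_variation P M2 q t;
  pp_drift : {ae P, forall w, forall s u, q <= s -> s <= u ->
    `|X1 u w - X1 s w - (M1 u w - M1 s w)| <= B * (u - s) /\
    `|X2 u w - X2 s w - (M2 u w - M2 s w)| <= B * (u - s)} }.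

Variables (X1 X2 M1 M2 V1 V2 : R -> T -> R) (B c c2 CV q t : R).
Hypothesis pp : planar_process X1 X2 M1 M2 V1 V2 B c c2 CV q t.

Definition radius2 s w := X1 s w ^+ 2 + X2 s w ^+ 2.

Let q0 := pp_start pp.
Let qt := pp_end pp.
Let k := (8 * B + 2) / c.

Let k0 : 0 <= k.
Proof.
apply: divr_ge0; last exact: ltW (pp_c pp).
by rewrite addr_ge0// mulr_ge0// (pp_B pp).
Qed.

Section step.
(** One step of the grid, from s to u: [A] is survival up to s, [A'] survival up to u, [H] an exit
    at u close to the origin. The number [a] is the parameter of Young's inequality in the estimate
    of the means of |m1| and |m2|. *)
Variables (e s u a : R) (A A' H : set T) (C : R).
Hypotheses (e0 : 0 < e) (e1 : 2 * e <= 1) (qs : q <= s) (su : s <= u) (a0 : 0 < a).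
Hypotheses (mA : fmeas s (\1_A)) (mA' : measurable A') (mH : measurable H).
Hypotheses (A'A : A' `<=` A) (HA : H `<=` A `\` A').
Hypotheses (A1 : forall w, A w -> radius2 s w <= 1).
Hypotheses (He : forall w, H w -> radius2 u w <= e).
Hypotheses (C0 : 0 <= C) (hC : forall x1 x2 b1 b2 m1 m2 h, x1 ^+ 2 + x2 ^+ 2 <= 1 -> 0 <= h ->
    `|b1| <= B * h -> `|b2| <= B * h ->
  forall w p, w = x1 ^+ 2 + x2 ^+ 2 + e -> p = x1 * m1 + x2 * m2 ->
  pot k w + 2 * pot_d1 k w * p + pot_d1 k w * (m1 ^+ 2 + m2 ^+ 2) - 4 * pot_d2 k w * p ^+ 2
    - 4 * pot_d1 k w * Num.sqrt w * B * h
    - C * (h ^+ 2 + h * (`|m1| + `|m2|) + (psi m1 + psi m2))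
    <= pot k ((x1 + (b1 + m1)) ^+ 2 + (x2 + (b2 + m2)) ^+ 2 + e)).

Let h := u - s.
Let s0 : 0 <= s := le_trans q0 qs.
Let u0 : 0 <= u := le_trans s0 su.
Let h0 : 0 <= h. Proof. by rewrite subr_ge0. Qed.
Let m1 w := M1 u w - M1 s w.
Let m2 w := M2 u w - M2 s w.
Let W r w := radius2 r w + e.
Let f r w := pot k (W r w).
Let F1 w := pot_d1 k (W s w).
Let E2 w := pot_d2 k (W s w).
(** [U] and [U'] bound the potential of a path that leaves the region ([potential_exit]). *)
Let U := 5 * (1 + k).
Let U' := 6 * (1 + k) * (B ^+ 2 + 1).
Let CF := pot_d1 k e + 4 * pot_d2 k e.

Let eW r w : e <= W r w.
Proof. by rewrite /W lerDr addr_ge0 ?sqr_ge0. Qed.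

Let W0 r w : 0 < W r w. Proof. exact: lt_le_trans e0 (eW r w). Qed.

Let mX1 r : 0 <= r -> fmeas r (X1 r). Proof. by move=> r0; apply: (fmeas_adapted hF (pp_adapted1 pp)). Qed.
Let mX2 r : 0 <= r -> fmeas r (X2 r). Proof. by move=> r0; apply: (fmeas_adapted hF (pp_adapted2 pp)). Qed.

Let mW r : 0 <= r -> fmeas r (W r).
Proof.
move=> r0; apply: measurable_funD; last exact: measurable_cst.
by apply: measurable_funD; apply: measurable_funX; [exact: mX1|exact: mX2].
Qed.

Let msqrt r : 0 <= r -> fmeas r (fun w => Num.sqrt (W r w)).
Proof.
move=> r0; apply: (measurableT_comp _ (mW r0)).
by apply: continuous_measurable_fun; exact: sqrt_continuous.
Qed.

Let mf r : 0 <= r -> fmeas r (f r).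
Proof.
move=> r0; apply: measurable_funD; last first.
  by apply: measurable_funM; [exact: measurable_cst|exact: msqrt].
by apply: (measurableT_comp _ (mW r0)); exact: measurable_ln.
Qed.

Let minv r (g : T -> R) : fmeas r g -> (forall w, 0 < g w) -> fmeas r (fun w => (g w)^-1).
Proof.
move=> mg g0.
have -> : (fun w => (g w)^-1) = (fun w => expR (- ln (g w))).
  by apply/funext => w; rewrite expRN lnK ?posrE.
apply: (measurableT_comp (@measurable_expR R)).
apply: (measurableT_comp (@oppr_measurable R setT)).
by apply: (measurableT_comp _ mg); exact: measurable_ln.
Qed.

Let sq0 r w : 0 < Num.sqrt (W r w). Proof. by rewrite sqrtr_gt0. Qed.

Let mF1 : fmeas s F1.
Proof.
apply: measurable_funD; apply: measurable_funM; try exact: measurable_cst.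
  by apply: minv => //; exact: mW.
apply: minv => [|w]; last by rewrite mulr_gt0.
by apply: measurable_funM; [exact: measurable_cst|exact: msqrt].
Qed.

Let mE2 : fmeas s E2.
Proof.
apply: measurable_funD; apply: measurable_funM; try exact: measurable_cst.
  apply: minv => [|w]; last by rewrite mulr_gt0 ?exprn_gt0.
  by apply: measurable_funM; [exact: measurable_cst|apply: measurable_funX; exact: mW].
apply: minv => [|w]; last by rewrite !mulr_gt0.
apply: measurable_funM; last exact: msqrt.
by apply: measurable_funM; [exact: measurable_cst|exact: mW].
Qed.

Let F10 w : 0 <= F1 w. Proof. exact: (pot_d1_ge0 k0 e0 (eW s w)). Qed.
Let E20 w : 0 <= E2 w. Proof. exact: (pot_d2_ge0 k0 e0 (eW s w)). Qed.
Let F1e w : F1 w <= pot_d1 k e. Proof. exact: (pot_d1_le k0 e0 (eW s w)). Qed.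
Let E2e w : E2 w <= pot_d2 k e. Proof. exact: (pot_d2_le k0 e0 (eW s w)). Qed.

Let X_le1 w : A w -> `|X1 s w| <= 1 /\ `|X2 s w| <= 1.
Proof. by move=> /A1; exact: abs_le1_of_norm2. Qed.

Let ind_bound (g : T -> R) K : 0 <= K -> (forall w, A w -> `|g w| <= K) ->
  forall w, `|\1_A w * g w| <= K.
Proof.
move=> K0 gK w; rewrite indicE; case: (boolP (w \in A)) => wA /=.
  by rewrite mul1r gK//; exact/set_mem.
by rewrite mul0r normr0.
Qed.

Let CF0 : 0 <= CF.
Proof.
rewrite /CF addr_ge0 ?mulr_ge0//; first exact: (pot_d1_ge0 k0 e0).
exact: (pot_d2_ge0 k0 e0).
Qed.

Let coef_bound (x y z : R) w : `|x| <= 1 -> `|y| <= 1 ->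
   `|F1 w * z| <= pot_d1 k e -> `|F1 w * z - 4 * E2 w * (x * y)| <= CF.
Proof.
move=> hx hy hz; apply: le_trans (ler_normB _ _) _; apply: lerD => //.
rewrite normrM ger0_norm ?mulr_ge0// -[leRHS]mulr1; apply: ler_pM => //.
- by rewrite mulr_ge0.
- by rewrite ler_wpM2l.
- by rewrite normrM -[leRHS]mulr1 ler_pM.
Qed.

(** Coefficients of m1^2, m2^2, - m1 m2, m1 and m2 in the expansion of [pot_step], restricted to the
    surviving paths: bounded variables of the past. *)
Let xi11 w := \1_A w * (F1 w - 4 * E2 w * (X1 s w * X1 s w)).
Let xi22 w := \1_A w * (F1 w - 4 * E2 w * (X2 s w * X2 s w)).
Let xi12 w := \1_A w * (8 * E2 w * (X1 s w * X2 s w)).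
Let xi1 w := \1_A w * (2 * F1 w * X1 s w).
Let xi2 w := \1_A w * (2 * F1 w * X2 s w).

Let F1n w : `|F1 w * 1| <= pot_d1 k e.
Proof. by rewrite mulr1 ger0_norm. Qed.

Let b11 w : `|xi11 w| <= CF.
Proof.
apply: (@ind_bound (fun w => F1 w - 4 * E2 w * (X1 s w * X1 s w)) (CF)) => // v /X_le1[h1 h2]; rewrite -[F1 v]mulr1.
by apply: coef_bound.
Qed.

Let b22 w : `|xi22 w| <= CF.
Proof.
apply: (@ind_bound (fun w => F1 w - 4 * E2 w * (X2 s w * X2 s w)) (CF)) => // v /X_le1[h1 h2]; rewrite -[F1 v]mulr1.
by apply: coef_bound.
Qed.

Let b12 w : `|xi12 w| <= 2 * CF.
Proof.
apply: (@ind_bound (fun w => 8 * E2 w * (X1 s w * X2 s w)) (2 * CF)) => [|v /X_le1[h1 h2]]; first by rewrite mulr_ge0.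
have := @coef_bound (X1 s v) (X2 s v) 0 v h1 h2; rewrite mulr0 sub0r normrN normr0.
move=> /(_ (pot_d1_ge0 k0 e0 (lexx _))) h3.
rewrite (_ : 8 * E2 v * _ = 2 * (4 * E2 v * (X1 s v * X2 s v))); last by ring.
by rewrite normrM ger0_norm// ler_wpM2l.
Qed.

Let b1 w : `|xi1 w| <= 2 * pot_d1 k e.
Proof.
apply: (@ind_bound (fun w => 2 * F1 w * X1 s w) (2 * pot_d1 k e)) => [|v /X_le1[h1 h2]].
  by rewrite mulr_ge0//; exact: (pot_d1_ge0 k0 e0).
by rewrite normrM ger0_norm ?mulr_ge0// -[leRHS]mulr1 ler_pM ?mulr_ge0// ler_wpM2l.
Qed.

Let b2 w : `|xi2 w| <= 2 * pot_d1 k e.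
Proof.
apply: (@ind_bound (fun w => 2 * F1 w * X2 s w) (2 * pot_d1 k e)) => [|v /X_le1[h1 h2]].
  by rewrite mulr_ge0//; exact: (pot_d1_ge0 k0 e0).
by rewrite normrM ger0_norm ?mulr_ge0// -[leRHS]mulr1 ler_pM ?mulr_ge0// ler_wpM2l.
Qed.

Let mxi11 : fmeas s xi11.
Proof.
apply: measurable_funM => //; apply: measurable_funB => //.
apply: measurable_funM; first by apply: measurable_funM => //; exact: measurable_cst.
by apply: measurable_funM; exact: mX1.
Qed.

Let mxi22 : fmeas s xi22.
Proof.
apply: measurable_funM => //; apply: measurable_funB => //.
apply: measurable_funM; first by apply: measurable_funM => //; exact: measurable_cst.
by apply: measurable_funM; exact: mX2.
Qed.

Let mxi12 : fmeas s xi12.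
Proof.
apply: measurable_funM => //.
apply: measurable_funM; first by apply: measurable_funM => //; exact: measurable_cst.
by apply: measurable_funM; [exact: mX1|exact: mX2].
Qed.

Let mxi1 : fmeas s xi1.
Proof.
apply: measurable_funM => //.
apply: measurable_funM; first by apply: measurable_funM => //; exact: measurable_cst.
exact: mX1.
Qed.

Let mxi2 : fmeas s xi2.
Proof.
apply: measurable_funM => //.
apply: measurable_funM; first by apply: measurable_funM => //; exact: measurable_cst.
exact: mX2.
Qed.

Hypothesis A'1 : forall w, A' w -> radius2 u w <= 1.

Let Vsum x w := `|V1 x w| + `|V2 x w|.

Let bound_ae : {ae P, forall w,
  `|X1 u w - X1 s w - m1 w| <= B * h /\ `|X2 u w - X2 s w - m2 w| <= B * h}.
Proof. by apply: filterS (pp_drift pp) => w /(_ s u qs su). Qed.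

Let potential_upper (w : T) r : 0 <= r -> W u w <= r -> f u w <= k + (1 + k) * r.
Proof.
move=> r0 Wr; have w0 := W0 u w.
have l : ln (W u w) <= r by apply: le_trans (ltW (ln_sublinear w0)) Wr.
have sq : Num.sqrt (W u w) <= 1 + r.
  by have := sqr_sqrtr (ltW w0); have := sqr_ge0 (Num.sqrt (W u w) - 1); nra.
rewrite /f /pot; have := ler_wpM2l k0 sq; move: l; rewrite mulrDl mulrDr mulr1 mul1r.
by move: (k * Num.sqrt _) (ln _) => x y; move: (k * r) => z; lra.
Qed.

(** A path may overshoot the unit disc when it exits. The potential grows at most linearly in w,
    hence is controlled by the squares of the increments, whose means are O(h) at each step and
    bounded after summation. *)
Let potential_exit w : A w -> `|X1 u w - X1 s w - m1 w| <= B * h ->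
  `|X2 u w - X2 s w - m2 w| <= B * h ->
  f u w <= U + U' * (h ^+ 2 + m1 w ^+ 2 + m2 w ^+ 2).
Proof.
move=> /A1 Aw; set be1 := X1 u w - _ - _; set be2 := X2 u w - _ - _ => hb1 hb2.
have sqb b : `|b| <= B * h -> b ^+ 2 <= B ^+ 2 * h ^+ 2.
  move=> hb; rewrite -exprMn -[b ^+ 2]real_normK ?num_real//.
  by rewrite lerXn2r ?nnegrE//; exact: le_trans hb.
have tri x y z : (x + y + z) ^+ 2 <= 3 * (x ^+ 2 + y ^+ 2 + z ^+ 2) :> R.
  by have := sqr_ge0 (x - y); have := sqr_ge0 (y - z); have := sqr_ge0 (x - z); nra.
pose r := 4 + 6 * (B ^+ 2 * h ^+ 2) + 3 * (m1 w ^+ 2 + m2 w ^+ 2).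
have hr : W u w <= r.
  have := tri (X1 s w) be1 (m1 w); have := tri (X2 s w) be2 (m2 w).
  have -> : X1 s w + be1 + m1 w = X1 u w by rewrite /be1; ring.
  have -> : X2 s w + be2 + m2 w = X2 u w by rewrite /be2; ring.
  move: Aw (sqb _ hb1) (sqb _ hb2) e1; rewrite /r /W /radius2.
  move: (X1 u w ^+ 2) (X2 u w ^+ 2) (X1 s w ^+ 2) (X2 s w ^+ 2) (be1 ^+ 2) (be2 ^+ 2)
    (m1 w ^+ 2) (m2 w ^+ 2) (B ^+ 2 * _) => *; lra.
have r0 : 0 <= r by apply: le_trans hr; exact: ltW (W0 u w).
apply: le_trans (potential_upper r0 hr) _; rewrite /U /U' /r.
have B2 := sqr_ge0 B; have h2 := sqr_ge0 h.
have n0 : 0 <= m1 w ^+ 2 + m2 w ^+ 2 by rewrite addr_ge0 ?sqr_ge0.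
rewrite -[h ^+ 2 + _ + _]addrA.
move: (m1 w ^+ 2 + _) (B ^+ 2) (h ^+ 2) n0 B2 h2 k0 => n b g n0 b0 g0 kk0.
have kn := mulr_ge0 kk0 n0; have kg := mulr_ge0 kk0 g0; have bn := mulr_ge0 b0 n0.
have kbn := mulr_ge0 kk0 bn.
rewrite [leRHS](_ : _ = k + (1 + k) * (4 + 6 * (b * g) + 3 * n) +
  (1 + 6 * (b * n + g) + 3 * n + 6 * (k * (b * n)) + 6 * (k * g) + 3 * (k * n))); last by ring.
by rewrite lerDl; lra.
Qed.

(** The point of the potential: an exit near the origin is worth the very negative ln (2 e). *)
Let potential_hit w : H w -> f u w <= U + ln (2 * e).
Proof.
move=> /He hw; rewrite addrC /f /pot.
have W2 : W u w <= 2 * e by rewrite /W; lra.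
have s1 : Num.sqrt (W u w) <= 1.
  rewrite -[leRHS]sqrtr1; apply: ler_wsqrtr.
  exact: le_trans W2 e1.
apply: lerD; first by rewrite ler_ln ?posrE ?mulr_gt0.
apply: (@le_trans _ _ (k * 1)); first by rewrite ler_wpM2l.
by rewrite /U; have := k0; lra.
Qed.

Let L1 w := \1_A w * f s w.
Let L2 w := xi1 w * m1 w + xi2 w * m2 w.
Let L3 w := xi11 w * m1 w ^+ 2 + xi22 w * m2 w ^+ 2 - xi12 w * (m1 w * m2 w).
Let L4 w := \1_A w * (4 * F1 w * Num.sqrt (W s w) * B * h).
Let L5 w := C * (h ^+ 2 + h * (`|m1 w| + `|m2 w|) + (psi (m1 w) + psi (m2 w))).
Let R1 w := \1_A' w * f u w.
Let R2 w := U * (\1_A w - \1_A' w).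
Let R3 w := ln (2 * e) * \1_H w.
Let R4 w := U' * (h ^+ 2 + m1 w ^+ 2 + m2 w ^+ 2).

Let psum_ge0 w : 0 <= h ^+ 2 + h * (`|m1 w| + `|m2 w|) + (psi (m1 w) + psi (m2 w)).
Proof.
apply: addr_ge0; last by rewrite addr_ge0 ?psi_ge0.
by apply: addr_ge0; [exact: sqr_ge0|apply: mulr_ge0 => //; exact: addr_ge0].
Qed.

Let U'_ge0 : 0 <= U'.
Proof.
apply: mulr_ge0; first by apply: mulr_ge0 => //; exact: addr_ge0.
by apply: addr_ge0 => //; exact: sqr_ge0.
Qed.

(** On [A'] the potential at u is kept; on [A] without [A'] it is replaced by the bound at an exit,
    improved by ln (2 e) on [H]. [R4] is nonnegative and is left on all paths. Off [A] only the
    nonpositive - [L5] and the nonnegative [R4] remain. *)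
Let step_pathwise : {ae P, forall w, L1 w + L2 w + L3 w - L4 w - L5 w <= R1 w + R2 w + R3 w + R4 w}.
Proof.
apply: filterS bound_ae => w [hb1 hb2].
have R40 : 0 <= U' * (h ^+ 2 + m1 w ^+ 2 + m2 w ^+ 2).
  by apply: mulr_ge0 => //; rewrite !addr_ge0 ?sqr_ge0.
have L50 : 0 <= L5 w by apply: mulr_ge0.
rewrite /L1 /L2 /L3 /L4 /R1 /R2 /R3 /R4 /xi1 /xi2 /xi11 /xi22 /xi12 !indicE.
have [wA|wA] := boolP (w \in A); last first.
  have wA' : w \notin A' by apply: contra wA => /set_mem /A'A /mem_set.
  have wH : w \notin H by apply: contra wA => /set_mem /HA[/mem_set].
  rewrite (negbTE wA') (negbTE wH) /= !(mul0r, mulr0, subr0, addr0, add0r, sub0r).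
  by move: R40 L50; move: (U' * _) (L5 w) => x y; lra.
have Aw : A w by exact: set_mem.
have := @hC (X1 s w) (X2 s w) (X1 u w - X1 s w - m1 w) (X2 u w - X2 s w - m2 w)
  (m1 w) (m2 w) h (A1 Aw) h0 hb1 hb2 (W s w) _ erefl erefl.
rewrite (_ : (X1 s w + (X1 u w - X1 s w - m1 w + m1 w)) ^+ 2 +
  (X2 s w + (X2 u w - X2 s w - m2 w + m2 w)) ^+ 2 + e = W u w); last first.
  by rewrite /W /radius2; ring.
rewrite -/(f s w) -/(f u w) -/(F1 w) -/(E2 w) -/(L5 w) => main.
have lhs : f s w + (2 * F1 w * X1 s w * m1 w + 2 * F1 w * X2 s w * m2 w) +
    ((F1 w - 4 * E2 w * (X1 s w * X1 s w)) * m1 w ^+ 2 +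
     (F1 w - 4 * E2 w * (X2 s w * X2 s w)) * m2 w ^+ 2 -
     8 * E2 w * (X1 s w * X2 s w) * (m1 w * m2 w)) -
    4 * F1 w * Num.sqrt (W s w) * B * h - L5 w <= f u w.
  apply: le_trans main; rewrite le_eqVlt; apply/orP; left; apply/eqP; ring.
rewrite /= !mul1r; apply: le_trans lhs _.
have [wA'|wA'] := boolP (w \in A').
  have wH : w \notin H.
    by apply/negP => /set_mem /HA[_]; apply; exact: set_mem.
  rewrite (negbTE wH) /= mul1r subrr !mulr0 !addr0.
  by rewrite lerDl.
have exit := potential_exit Aw hb1 hb2.
rewrite /= mul0r add0r subr0 mulr1.
have [wH|wH] := boolP (w \in H); rewrite /= ?mulr1 ?mulr0 ?addr0//.
have := potential_hit (set_mem wH); move: R40; move: (U' * _) (f u w) (ln _) => x y z.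
by move=> *; lra.
Qed.

Let msq1 := pp_sq1 pp s0 su.
Let msq2 := pp_sq2 pp s0 su.

Let mA_ : measurable_fun setT (\1_A : T -> R).
Proof. exact: (fmeas_measurable hF s0 mA). Qed.

Let ind1 (D : set T) w : `|\1_D w : R| <= 1.
Proof. by rewrite indicE; case: (_ \in _); rewrite ?normr1 ?normr0. Qed.

Let i_bdd (g : T -> R) K : fmeas s g -> (forall w, `|g w| <= K) -> itg P setT g.
Proof. by move=> mg gK; exact: (itg_fmeas_bounded hF s0 mg gK). Qed.

Let i_mul (g x : T -> R) K : fmeas s g -> (forall w, `|g w| <= K) -> itg P setT x ->
  itg P setT (fun w => g w * x w).
Proof.
move=> mg gK hx; apply: (itg_mulb measurableT hx) => [|w _]; last exact: gK.
exact: (fmeas_measurable hF s0 mg).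
Qed.

Let i_of_sq (g : T -> R) : measurable_fun setT g -> itg P setT (fun w => g w ^+ 2) -> itg P setT g.
Proof.
move=> mg ig; apply: (itg_le measurableT mg (itgD measurableT (itg_cst measurableT (prob_fin P) 1) ig)).
move=> w _; rewrite -[_ ^+ 2]real_normK ?num_real//.
by have := sqr_ge0 (`|g w| - 1); nra.
Qed.

Let im1 : itg P setT m1. Proof. by case: msq1 => ? ?; exact: i_of_sq. Qed.
Let im2 : itg P setT m2. Proof. by case: msq2 => ? ?; exact: i_of_sq. Qed.
Let im12 : itg P setT (fun w => m1 w * m2 w).
Proof. by case: msq1 => ? ?; case: msq2 => ? ?; exact: itg_mul_sq. Qed.
Let ip1 : itg P setT (fun w => psi (m1 w)).
Proof. by case: msq1 => ? ?; exact: itg_psi. Qed.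
Let ip2 : itg P setT (fun w => psi (m2 w)).
Proof. by case: msq2 => ? ?; exact: itg_psi. Qed.

Let fs_bound w : radius2 s w <= 1 -> `|pot k (W s w)| <= - ln e + U.
Proof.
move=> r1; have w2 : W s w <= 2 by exact: add_le2.
have lW : ln e <= ln (W s w) by rewrite ler_ln ?posrE.
have lW2 : ln (W s w) <= 2 by apply: le_trans (ltW (ln_sublinear (W0 s w))) w2.
have lne : ln e <= 0 by apply: ln_le0; exact: half_le1.
have s2 : Num.sqrt (W s w) <= 2.
  by have := sqr_sqrtr (ltW (W0 s w)); have := sqr_ge0 (Num.sqrt (W s w) - 1); nra.
have k2 : 0 <= k * Num.sqrt (W s w) <= 2 * k.
  by rewrite mulr_ge0// [2 * k]mulrC ler_wpM2l.
rewrite ler_norml /pot /U; case/andP: k2.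
by move: (k * Num.sqrt _) => y *; have := k0; lra.
Qed.

Let fu_bound w : A' w -> `|f u w| <= - ln e + U.
Proof.
move=> /A'1 r1; have w2 : W u w <= 2 by exact: add_le2.
have lW : ln e <= ln (W u w) by rewrite ler_ln ?posrE.
have lW2 : ln (W u w) <= 2 by apply: le_trans (ltW (ln_sublinear (W0 u w))) w2.
have lne : ln e <= 0 by apply: ln_le0; exact: half_le1.
have s2 : Num.sqrt (W u w) <= 2.
  by have := sqr_sqrtr (ltW (W0 u w)); have := sqr_ge0 (Num.sqrt (W u w) - 1); nra.
have k2 : 0 <= k * Num.sqrt (W u w) <= 2 * k.
  by rewrite mulr_ge0// [2 * k]mulrC ler_wpM2l.
rewrite ler_norml /f /pot /U; case/andP: k2.
by move: (k * Num.sqrt _) => y *; have := k0; lra.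
Qed.

Let lU0 : 0 <= - ln e + U.
Proof.
have : ln e <= 0 by apply: ln_le0; exact: half_le1.
move: (ln e) k0 => y kk y0; apply: addr_ge0; first by rewrite oppr_ge0.
by rewrite /U; apply: mulr_ge0 => //; exact: addr_ge0.
Qed.

Let iL1 : itg P setT L1.
Proof.
apply: (@i_bdd L1 (- ln e + U)); first by apply: measurable_funM => //; exact: mf.
by apply: (@ind_bound (f s)) => [|w /A1]; [exact: lU0|exact: fs_bound].
Qed.

Let F1sE w : 4 * F1 w * Num.sqrt (W s w) = 4 / Num.sqrt (W s w) + 2 * k.
Proof.
rewrite /F1 /pot_d1; set x := Num.sqrt (W s w).
have -> : W s w = x ^+ 2 by rewrite sqr_sqrtr// ltW.
have x0 : x != 0 by rewrite gt_eqF// sq0.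
by clearbody x; field.
Qed.

Let sinv_le w : (Num.sqrt (W s w))^-1 <= (Num.sqrt e)^-1.
Proof. by rewrite lef_pV2 ?posrE ?sqrtr_gt0// ler_wsqrtr. Qed.

Let se0 : 0 <= (Num.sqrt e)^-1. Proof. by rewrite invr_ge0 sqrtr_ge0. Qed.

Let mS : fmeas s (fun w => (Num.sqrt (W s w))^-1).
Proof. by apply: minv => //; exact: msqrt. Qed.

Let bS w : `|\1_A w * (Num.sqrt (W s w))^-1| <= (Num.sqrt e)^-1.
Proof.
apply: (@ind_bound (fun w => (Num.sqrt (W s w))^-1)) => // v _.
by rewrite ger0_norm ?invr_ge0 ?sqrtr_ge0.
Qed.

Let iS : itg P setT (fun w => \1_A w * (Num.sqrt (W s w))^-1).
Proof. by apply: (i_bdd _ bS); exact: measurable_funM. Qed.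

Let iA : itg P setT (\1_A : T -> R).
Proof. exact: (i_bdd mA (ind1 A)). Qed.

Let iA' : itg P setT (\1_A' : T -> R).
Proof. by apply: (itg_bounded measurableT (prob_fin P) (C := 1)) => // w _; exact: ind1. Qed.

Let iH : itg P setT (\1_H : T -> R).
Proof. by apply: (itg_bounded measurableT (prob_fin P) (C := 1)) => // w _; exact: ind1. Qed.

Let L4E w : L4 w = 4 * B * h * (\1_A w * (Num.sqrt (W s w))^-1) + 2 * k * B * h * \1_A w.
Proof. by rewrite /L4 F1sE; ring. Qed.

Let iL4 : itg P setT L4.
Proof.
apply: (eq_itg measurableT (f := fun w => 4 * B * h * (\1_A w * (Num.sqrt (W s w))^-1) + 2 * k * B * h * \1_A w)).
  by move=> w _; rewrite L4E.
by apply: itgD => //; exact: itgZ.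
Qed.

Let eL2 : itg P setT L2 /\ \int[P]_w L2 w = 0.
Proof.
have i1 := i_mul mxi1 b1 im1; have i2 := i_mul mxi2 b2 im2.
split; first exact: itgD.
by rewrite rintD// (pp_mean1 pp s0 su mxi1 b1) (pp_mean2 pp s0 su mxi2 b2) addr0.
Qed.

Let eL3 : itg P setT L3 /\ \int[P]_w L3 w = c * h * (\int[P]_w xi11 w + \int[P]_w xi22 w) +
  (\int[P]_w (xi11 w * tint s u V1 w) + \int[P]_w (xi22 w * tint s u V2 w)).
Proof.
have [_ j1] := msq1; have [_ j2] := msq2.
have i1 := i_mul mxi11 b11 j1; have i2 := i_mul mxi22 b22 j2.
have i3 := i_mul mxi12 b12 im12; have i4 := itgD measurableT i1 i2.
split; first exact: itgB.
rewrite rintB// rintD// (pp_cross pp s0 su mxi12 b12) subr0.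
rewrite (pp_var1 pp s0 su mxi11 b11) (pp_var2 pp s0 su mxi22 b22) -/h.
by rewrite [in RHS]mulrDr addrACA.
Qed.

Let abs_mean (g : T -> R) : measurable_fun setT g -> itg P setT (fun w => g w ^+ 2) ->
  \int[P]_w (g w ^+ 2) <= c2 * h -> \int[P]_w `|g w| <= a + c2 * h / a.
Proof.
move=> mg ig gh.
have i2 : itg P setT (fun w => a + a^-1 * g w ^+ 2).
  by apply: itgD => //; [exact: (itg_cst measurableT (prob_fin P))|exact: itgZ].
apply: (@le_trans _ _ (\int[P]_w (a + a^-1 * g w ^+ 2))).
  apply: ler_rint => //; first exact/itg_norm/i_of_sq.
  move=> w _; rewrite -[g w ^+ 2]real_normK ?num_real// -(ler_pM2l a0).
  rewrite mulrDr mulrA divff ?lt0r_neq0// mul1r -expr2.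
  by have := sqr_ge0 (a - `|g w|); have := normr_ge0 (g w); nra.
rewrite rintD//; [|exact: (itg_cst measurableT (prob_fin P))|exact: itgZ].
by rewrite rint_cst rintZ// lerD2l [a^-1 * _]mulrC ler_wpM2r// invr_ge0 ltW.
Qed.

Let eL5 : itg P setT L5 /\ \int[P]_w L5 w <= C * (h ^+ 2 + h * (2 * (a + c2 * h / a)) +
   (\int[P]_w psi (m1 w) + \int[P]_w psi (m2 w))).
Proof.
have ia : itg P setT (fun w => `|m1 w| + `|m2 w|).
  by apply: itgD => //; exact: itg_norm.
have ip : itg P setT (fun w => psi (m1 w) + psi (m2 w)) by exact: itgD.
have ic : itg P setT (fun=> h ^+ 2) by exact: (itg_cst measurableT (prob_fin P)).
have i1 : itg P setT (fun w => h ^+ 2 + h * (`|m1 w| + `|m2 w|)).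
  by apply: itgD => //; exact: itgZ.
have i2 := itgD measurableT i1 ip.
split; first exact: itgZ.
rewrite rintZ//; apply: ler_wpM2l => //; rewrite rintD//.
rewrite [\int[P]_x (h ^+ 2 + _)]rintD//; last exact: itgZ.
rewrite rint_cst rintZ// rintD//.
rewrite lerD2r lerD2l; apply: ler_wpM2l => //.
rewrite (rintD measurableT (itg_norm im1) (itg_norm im2)).
have [mm1 j1] := msq1; have [mm2 j2] := msq2.
have := abs_mean mm1 j1 (pp_moment1 pp s0 su); have := abs_mean mm2 j2 (pp_moment2 pp s0 su).
by move: (\int[P]_w `|m1 w|) (\int[P]_w `|m2 w|) (a + _) => x y z; lra.
Qed.

Let eR4 : itg P setT R4 /\ \int[P]_w R4 w <= U' * (h ^+ 2 + 2 * (c2 * h)).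
Proof.
have [mm1 j1] := msq1; have [mm2 j2] := msq2.
have ic : itg P setT (fun=> h ^+ 2) by exact: (itg_cst measurableT (prob_fin P)).
have i1 := itgD measurableT ic j1; have i2 := itgD measurableT i1 j2.
split; first exact: itgZ.
rewrite rintZ//; apply: ler_wpM2l => //; rewrite rintD// rintD// rint_cst.
have := pp_moment1 pp s0 su; have := pp_moment2 pp s0 su; rewrite -/h.
by move: (\int[P]_w ((M1 u w - M1 s w) ^+ 2)) (\int[P]_w ((M2 u w - M2 s w) ^+ 2)) (c2 * h) => x y z; lra.
Qed.

Let mVsum : jmeas s u Vsum.
Proof.
by apply: jmeasD; apply: jmeas_norm; [exact: (pp_jmeas1 pp)|exact: (pp_jmeas2 pp)].
Qed.

Let bVsum x w : `|Vsum x w| <= CV + CV.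
Proof.
by rewrite ger0_norm ?addr_ge0// lerD// ?(pp_bound1 pp)// (pp_bound2 pp).
Qed.

Let iV : itg P setT (fun w => \1_A w * tint s u Vsum w).
Proof. by apply: (i_mul mA (ind1 A)); exact: (itg_tint P su mVsum bVsum). Qed.

Let xi_tint (xi : T -> R) (V : R -> T -> R) : fmeas s xi -> (forall w, `|xi w| <= CF) ->
  (forall w, xi w = \1_A w * xi w) -> jmeas s u V -> (forall x w, `|V x w| <= CV) ->
  itg P setT (fun w => \1_A w * tint s u (fun x w => `|V x w|) w) /\
  - (CF * \int[P]_w (\1_A w * tint s u (fun x w => `|V x w|) w)) <=
    \int[P]_w (xi w * tint s u V w).
Proof.
move=> mxi bxi xiA mV bV; have mV' := jmeas_norm mV.
have bV' x w : `| `|V x w| | <= CV by rewrite normr_id.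
have i1 := i_mul mA (ind1 A) (itg_tint P su mV' bV').
split => //; rewrite -mulNr -rintZ//; apply: ler_rint => //; first exact: itgZ.
  exact: (i_mul mxi bxi (itg_tint P su mV bV)).
move=> w _; rewrite mulNr; apply: lerNnormlW.
rewrite xiA -mulrA normrM [leLHS](_ : _ = \1_A w * (`|xi w| * `|tint s u V w|)); last first.
  by rewrite normrM ger0_norm// indicE.
rewrite [leRHS]mulrCA; apply: ler_wpM2l; first by rewrite indicE.
apply: ler_pM => //; apply: ler_rint_norm => //.
- exact: (itg_section mV bV).
- exact: (itg_section mV' bV').
Qed.

(** The defects are multiplied by coefficients bounded by [CF] and supported on [A]. *)
Let eV : - (CF * \int[P]_w (\1_A w * tint s u Vsum w)) <=
  \int[P]_w (xi11 w * tint s u V1 w) + \int[P]_w (xi22 w * tint s u V2 w).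
Proof.
have idA w : \1_A w = \1_A w * \1_A w :> R.
  by rewrite indicE; case: (_ \in _); rewrite ?mulr1 ?mulr0.
have [i1 v1] := @xi_tint xi11 V1 mxi11 b11 (fun w => ltac:(by rewrite /xi11 [RHS]mulrA -idA))
  (pp_jmeas1 pp s0) (pp_bound1 pp).
have [i2 v2] := @xi_tint xi22 V2 mxi22 b22 (fun w => ltac:(by rewrite /xi22 [RHS]mulrA -idA))
  (pp_jmeas2 pp s0) (pp_bound2 pp).
apply: le_trans (lerD v1 v2); rewrite -opprD lerN2 -mulrDr.
apply: ler_wpM2l; first exact: CF0.
rewrite -(rintD measurableT i1 i2) le_eqVlt; apply/orP; left; apply/eqP.
apply: eq_rint => w _; rewrite -mulrDr; congr (_ * _); rewrite /tint.
rewrite -rintD.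
- by [].
- exact: measurable_itv.
- exact: (itg_section (jmeas_norm (pp_jmeas1 pp s0)) (fun x w => ltac:(by rewrite normr_id; exact: (pp_bound1 pp)))).
- exact: (itg_section (jmeas_norm (pp_jmeas2 pp s0)) (fun x w => ltac:(by rewrite normr_id; exact: (pp_bound2 pp)))).
Qed.

(* k is chosen so that c k = 8 B + 2: half of it pays for the drift term and  *)
(* leaves one copy of 1 / sqrt w.                                            *)
Let gain w : h * (\1_A w * (Num.sqrt (W s w))^-1) <= c * h * (xi11 w + xi22 w) -
  4 * B * h * (\1_A w * (Num.sqrt (W s w))^-1).
Proof.
rewrite /xi11 /xi22 -mulrDr.
rewrite [leRHS](_ : _ = h * (\1_A w * (c * (F1 w - 4 * E2 w * (X1 s w * X1 s w) +
  (F1 w - 4 * E2 w * (X2 s w * X2 s w))) - 4 * B * (Num.sqrt (W s w))^-1))); last by ring.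
apply: ler_wpM2l => //; apply: ler_wpM2l; first by rewrite indicE.
have x0 := sq0 s w; set x := Num.sqrt (W s w) in x0 *.
have WE : W s w = x ^+ 2 by rewrite sqr_sqrtr// ltW.
have c0 := pp_c pp.
have kc : c * k = 8 * B + 2 by rewrite /k mulrCA divff ?mulr1// lt0r_neq0.
have r2 : radius2 s w <= x ^+ 2 by rewrite -WE /W lerDl ltW.
have E2E : E2 w = 1 / (2 * x ^+ 4) + k / (8 * x ^+ 3).
  by rewrite /E2 /pot_d2 -/x WE; field; rewrite lt0r_neq0.
have F1E : F1 w = 1 / x ^+ 2 + k / (2 * x) by rewrite /F1 /pot_d1 -/x WE.
have -> : F1 w - 4 * E2 w * (X1 s w * X1 s w) + (F1 w - 4 * E2 w * (X2 s w * X2 s w)) =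
  2 * F1 w - 4 * E2 w * radius2 s w by rewrite /radius2; ring.
have key : k / 2 * x^-1 <= 2 * F1 w - 4 * E2 w * radius2 s w.
  apply: (@le_trans _ _ (2 * F1 w - 4 * E2 w * x ^+ 2)); last first.
    by rewrite lerD2l lerN2 ler_wpM2l// mulr_ge0.
  by rewrite le_eqVlt; apply/orP; left; apply/eqP; rewrite E2E F1E; field; rewrite lt0r_neq0.
have := ler_wpM2l (ltW c0) key.
have -> : c * (k / 2 * x^-1) = (4 * B + 1) * x^-1.
  by rewrite mulrA mulrA kc; congr (_ * _); field.
by rewrite mulrDl mul1r; move: (c * (2 * F1 w - _)) (4 * B * x^-1) => y z; lra.
Qed.

(** Expectation of [step_pathwise]: the terms linear in m1, m2 and the product m1 m2 have mean 0,
    the squares give c h times their coefficients up to the defects, and [gain] converts this, less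
    the first-order drift, into h / sqrt w. The last bracket collects the errors of drift, defect,
    expansion and overshoot. *)
Lemma potential_step :
  \int[P]_w (\1_A w * pot k (radius2 s w + e)) +
    h * \int[P]_w (\1_A w * (Num.sqrt (radius2 s w + e))^-1) <=
  \int[P]_w (\1_A' w * pot k (radius2 u w + e)) +
    U * (\int[P]_w \1_A w - \int[P]_w \1_A' w) +
    ln (2 * e) * \int[P]_w \1_H w +
    (2 * k * B * h + CF * \int[P]_w (\1_A w * tint s u Vsum w) +
     C * (h ^+ 2 + h * (2 * (a + c2 * h / a)) +
       (\int[P]_w psi (m1 w) + \int[P]_w psi (m2 w))) +
     U' * (h ^+ 2 + 2 * (c2 * h))).
Proof.
have [iL2 vL2] := eL2; have [iL3 vL3] := eL3; have [iL5 vL5] := eL5; have [iR4 vR4] := eR4.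
have iR1 : itg P setT R1.
  apply: (itg_bounded measurableT (prob_fin P) (C := - ln e + U)).
    apply: measurable_funM; first exact: measurable_indic.
    exact: (fmeas_measurable hF u0 (mf u0)).
  move=> w _; rewrite /R1 indicE; case: (boolP (w \in A')) => wA /=.
    by rewrite mul1r fu_bound//; exact: set_mem.
  by rewrite mul0r normr0; exact: lU0.
have iR2 : itg P setT R2 by apply: itgZ => //; exact: itgB.
have iR3 : itg P setT R3 by exact: itgZ.
have i12 := itgD measurableT iL1 iL2; have i123 := itgD measurableT i12 iL3.
have i1234 := itgB measurableT i123 iL4.
have j12 := itgD measurableT iR1 iR2; have j123 := itgD measurableT j12 iR3.
have := ae_ler_rint (itgB measurableT i1234 iL5) (itgD measurableT j123 iR4) step_pathwise.
rewrite rintB// rintB// rintD// rintD// vL2 addr0 vL3.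
rewrite [X in _ <= X]rintD// rintD// rintD//.
rewrite [\int[P]_w R2 w]rintZ//; last exact: itgB.
rewrite [\int[P]_w (\1_A w - _)]rintB// [\int[P]_w R3 w]rintZ//.
have vL4 : \int[P]_w L4 w = 4 * B * h * \int[P]_w (\1_A w * (Num.sqrt (W s w))^-1) +
    2 * k * B * h * \int[P]_w \1_A w.
  rewrite -!rintZ// -rintD//; [|exact: itgZ|exact: itgZ].
  by apply: eq_rint => // w _; exact: L4E.
have A_le1 : \int[P]_w \1_A w <= 1.
  rewrite -[leRHS](rint_cst P); apply: ler_rint => //.
    exact: (itg_cst measurableT (prob_fin P)).
have kBh : 0 <= 2 * k * B * h.
  by apply: mulr_ge0 => //; apply: mulr_ge0; [exact: mulr_ge0|exact: (pp_B pp)].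
have ix11 := i_bdd mxi11 b11; have ix22 := i_bdd mxi22 b22.
have G : h * \int[P]_w (\1_A w * (Num.sqrt (W s w))^-1) <=
   c * h * (\int[P]_w xi11 w + \int[P]_w xi22 w) -
   4 * B * h * \int[P]_w (\1_A w * (Num.sqrt (W s w))^-1).
  rewrite -rintD// -!rintZ//; last exact: itgD.
  rewrite -rintB//; [|by apply: itgZ => //; exact: itgD|exact: itgZ].
  apply: (ler_rint measurableT); last by move=> w _; exact: gain.
    exact: (itgZ measurableT).
  by apply: (itgB measurableT); apply: (itgZ measurableT) => //; exact: (itgD measurableT).
have A_kBh := ler_wpM2l kBh A_le1; rewrite mulr1 in A_kBh.
rewrite vL4; move: G A_kBh eV vL5 vR4.
rewrite -/(W s) /L1 /R1 -/h.
move: (\int[P]_w (\1_A w * (Num.sqrt (W s w))^-1)) => S.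
move: (h * S) (4 * B * h * S) (c * h * _) (2 * k * B * h * _) => x1 x2 x3 x4.
move: (CF * _) (\int[P]_w (xi11 w * tint s u V1 w) + _) (\int[P]_w L5 w) (C * _)
  (\int[P]_w R4 w) (U' * _) => x5 x6 x7 x8 x9 x10.
move: (\int[P]_w (\1_A w * f s w)) (\int[P]_w (\1_A' w * f u w)) (U * _) (ln _ * _)
  (2 * k * B * h) => x11 x12 x13 x14 x15.
move=> *; rewrite /W -/(f s) -/(f u); lra.
Qed.

End step.
End planar_processes.

Section sum_of_steps.
Context {R : realFieldType}.

Lemma sum_steps (f S al chi E : nat -> R) U L n :
  (forall i, (i < n)%N -> f i + S i <= f i.+1 + U * (al i - al i.+1) + L * chi i + E i) ->
  f 0%N + \sum_(i < n) S i <=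
    f n + U * (al 0%N - al n) + L * \sum_(i < n) chi i + \sum_(i < n) E i.
Proof.
elim: n => [|n IH] h; first by rewrite !big_ord0 subrr !mulr0 !addr0.
have := IH (fun i hi => h i (ltnW hi)); have := h n (ltnSn n).
rewrite !big_ord_recr /=; rewrite !mulrBr mulrDr.
move: (\sum_(i < n) S i) (\sum_(i < n) chi i) (\sum_(i < n) E i) => x y z.
move: (L * y) (L * chi n) (U * al n) (U * al 0%N) (U * al n.+1) => *; lra.
Qed.

Lemma error_split (CF v C h a c2 p1 p2 U' x y : R) :
  x + CF * v + C * (h ^+ 2 + h * (2 * (a + c2 * h / a)) + (p1 + p2)) + U' * y =
  (x + C * (h ^+ 2 + h * (2 * (a + c2 * h / a))) + U' * y) + CF * v + C * (p1 + p2).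
Proof. by rewrite [C * (_ + _ + (p1 + p2))]mulrDr; move: (C * (p1 + p2)) (C * _) => *; ring. Qed.

Lemma error_sum (K CF C : R) (E v p1 p2 : nat -> R) n :
  (forall i, E i = K + CF * v i + C * (p1 i + p2 i)) ->
  \sum_(i < n) E i =
    n%:R * K + CF * \sum_(i < n) v i + C * (\sum_(i < n) p1 i + \sum_(i < n) p2 i).
Proof.
move=> h; rewrite (eq_bigr (fun i : 'I_n => K + CF * v i + C * (p1 i + p2 i))) => [|i _ //].
rewrite !big_split /= -!mulr_sumr big_split /=.
by rewrite sumr_const card_ord -[_ *+ n]mulr_natl.
Qed.

Lemma error_const (n h tau k B C a c2 U' : R) : n * h = tau -> a != 0 ->
  n * (2 * k * B * h + C * (h ^+ 2 + h * (2 * (a + c2 * h / a))) + U' * (h ^+ 2 + 2 * (c2 * h))) =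
  2 * k * B * tau + (h * (C * tau + 2 * (C * tau * c2) / a) + 2 * (C * tau) * a) +
  U' * (tau * h + 2 * (c2 * tau)).
Proof. by move=> <- a0; field. Qed.

Lemma quarter_bound (x : R) : 0 <= x -> x * (1 / (4 * (x + 1))) <= 1 / 4.
Proof.
move=> x0; have y0 : 0 < x + 1 by rewrite ltr_wpDl.
by rewrite mulrA mulr1 ler_pdivrMr ?mulr_gt0//; lra.
Qed.

Lemma eighth_bound (x : R) : 0 <= x -> 2 * x * (1 / (8 * (x + 1))) <= 1 / 4.
Proof.
move=> x0; have y0 : 0 < x + 1 by rewrite ltr_wpDl.
by rewrite [leLHS]mulrA mulr1 ler_pdivrMr ?mulr_gt0//; lra.
Qed.

Lemma error_shuffle (x y z u v : R) : x + y + z + u + v = x + u + y + v + z.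
Proof. by ring. Qed.

End sum_of_steps.

(** * The potential along a regular grid *)

Section grid_potential.
Context {R : realType} {d : measure_display} {T : measurableType d}.
Variables (P : probability T R) (F : R -> set_system T).
Hypothesis hF : usual_conditions P F.
Variables (X1 X2 M1 M2 V1 V2 : R -> T -> R) (B c c2 CV q t : R).
Hypothesis pp : planar_process P F X1 X2 M1 M2 V1 V2 B c c2 CV q t.
Local Notation radius2 := (radius2 X1 X2).
Let k := (8 * B + 2) / c.
Let U := 5 * (1 + k).
Let U' := 6 * (1 + k) * (B ^+ 2 + 1).

Definition planar_defect x w := `|V1 x w| + `|V2 x w|.

(* A i: the path is still in the region at the i-th grid point; H i: it left *)
(* between the i-th and the next one, having come within e of the origin.    *)
Record grid_sets (e : R) (n : nat) (A H : nat -> set T) : Prop := {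
  gs_adapted : forall i, (i <= n)%N -> F (grid q t n i) (A i);
  gs_hit_measurable : forall i, (i < n)%N -> measurable (H i);
  gs_decreasing : forall i, (i < n)%N -> A i.+1 `<=` A i;
  gs_exit : forall i, (i < n)%N -> H i `<=` A i `\` A i.+1;
  gs_radius : forall i w, (i <= n)%N -> A i w -> radius2 (grid q t n i) w <= 1;
  gs_hit : forall i w, (i < n)%N -> H i w -> radius2 (grid q t n i.+1) w <= e }.

Let tau := t - q.
Let tau0 : 0 < tau. Proof. by rewrite subr_gt0 (pp_end pp). Qed.
Let k0 : 0 <= k.
Proof.
apply: divr_ge0; last exact: ltW (pp_c pp).
by rewrite addr_ge0// mulr_ge0// (pp_B pp).
Qed.

Lemma grid_le n i : q <= grid q t n i.
Proof. by rewrite /grid lerDl mulr_ge0// divr_ge0// ltW. Qed.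

Lemma gridS n i : grid q t n i <= grid q t n i.+1.
Proof. by rewrite /grid lerD2l ler_wpM2r ?ler_nat// divr_ge0// ltW. Qed.

Lemma grid_step n i : grid q t n i.+1 - grid q t n i = (t - q) / n%:R.
Proof. by rewrite /grid -[i.+1]addn1 natrD; ring. Qed.

Lemma pot_upper e x : 0 < e -> 2 * e <= 1 -> 0 <= x -> x <= 1 -> pot k (x + e) <= k + (1 + k) * 2.
Proof.
move=> e0 e1 x0 x1; have w0 : 0 < x + e by rewrite ltr_wpDl.
have w2 := add_le2 e0 e1 x1.
have l : ln (x + e) <= 2 by apply: le_trans (ltW (ln_sublinear w0)) w2.
have sq : Num.sqrt (x + e) <= 2.
  by have := sqr_sqrtr (ltW w0); have := sqr_ge0 (Num.sqrt (x + e) - 1); nra.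
rewrite /pot; have := ler_wpM2l k0 sq; move: l k0.
by move: (ln _) (Num.sqrt _) k => z y kk; move: (kk * y) => v; lra.
Qed.

Lemma pot_ge e x : 0 <= k -> 0 < e -> 0 <= x -> ln e <= pot k (x + e).
Proof.
move=> kk e0 x0; rewrite /pot -[leLHS]addr0; apply: lerD.
  by rewrite ler_ln ?posrE ?lerDr// ltr_wpDl.
by rewrite mulr_ge0// sqrtr_ge0.
Qed.

Lemma measurable_pot : measurable_fun setT (pot k).
Proof.
apply: measurable_funD; first exact: measurable_ln.
apply: measurable_funM; first exact: measurable_cst.
by apply: continuous_measurable_fun; exact: sqrt_continuous.
Qed.

Lemma radius2_measurable r : 0 <= r -> fmeas F r (radius2 r).
Proof.
move=> r0; apply: measurable_funD; apply: measurable_funX.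
  exact: (fmeas_adapted hF (pp_adapted1 pp)).
exact: (fmeas_adapted hF (pp_adapted2 pp)).
Qed.

(** [K0] is chosen before e. The constants [C] and [CF], which depend on e, multiply h, the sums of
    [psi] and the defects; [eta] and [n0], chosen after e, make these products small. *)
Lemma grid_potential : exists K0, forall e, 0 < e -> 2 * e <= 1 ->
  exists2 eta, 0 < eta & exists n0, forall n, (n0 <= n)%N -> (0 < n)%N ->
  forall A H, grid_sets e n A H ->
    \sum_(i < n) \int[P]_w (\1_(A i) w * tint (grid q t n i) (grid q t n i.+1) planar_defect w) <= eta ->
    \int[P]_w (\1_(A 0%N) w * pot ((8 * B + 2) / c) (radius2 q w + e)) +
    (t - q) / n%:R * \sum_(i < n) \int[P]_w (\1_(A i) w * (Num.sqrt (radius2 (grid q t n i) w + e))^-1) -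
    ln (2 * e) * \sum_(i < n) \int[P]_w \1_(H i) w <= K0.
Proof.
pose K1 := 2 * k * B * tau + U' * (tau * tau + 2 * (c2 * tau)).
have B0 := pp_B pp; have c20 := pp_c2 pp.
have U'0 : 0 <= U'.
  by rewrite /U' !mulr_ge0// addr_ge0// sqr_ge0.
have U0 : 0 <= U by rewrite /U mulr_ge0// addr_ge0.
(* The final potential is at most k + 2 (1 + k), the exits cost [U], the drift and the overshoots
   [K1], and 1 is for four errors of at most 1/4 each. *)
exists (k + (1 + k) * 2 + U + K1 + 1) => e e0 e1.
have [C C0 hC] := pot_step k0 e0 (half_le1 e0 e1) B0.
pose CF := pot_d1 k e + 4 * pot_d2 k e.
have CF0 : 0 <= CF.
  rewrite /CF addr_ge0 ?mulr_ge0//; first exact: (pot_d1_ge0 k0 e0).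
  exact: (pot_d2_ge0 k0 e0).
pose eta := 1 / (4 * (CF + 1)).
have inv0 x : 0 <= x -> 0 < x + 1 :> R by move=> x0; rewrite ltr_wpDl.
have eta0 : 0 < eta by rewrite divr_gt0// mulr_gt0// inv0.
exists eta => //.
have Ct0 : 0 <= C * tau by rewrite mulr_ge0// ltW.
(* Summed over the grid, Young's inequality costs 2 C tau a, made at most 1/4 here, and a term in
   1/a that carries a factor h. *)
pose a := 1 / (8 * (C * tau + 1)).
have a0 : 0 < a by rewrite divr_gt0// mulr_gt0// inv0.
pose K2 := C * tau + 2 * (C * tau * c2) / a.
have K20 : 0 <= K2.
  by rewrite /K2 addr_ge0//; apply: divr_ge0; [rewrite !mulr_ge0// ltW|exact: ltW].
pose eta' := 1 / (8 * (C + 1)).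
have eta'0 : 0 < eta' by rewrite divr_gt0// mulr_gt0// inv0.
have [n1 hn1] := pp_small1 pp eta'0; have [n2 hn2] := pp_small2 pp eta'0.
exists (maxn (maxn n1 n2) (Num.bound (4 * tau * K2))) => n.
rewrite !geq_max => /andP[/andP[/hn1 {}hn1 /hn2 {}hn2] nK] n0 A H gs hV.
have {}hn1 := hn1 n0; have {}hn2 := hn2 n0.
have nR : 0 < n%:R :> R by rewrite ltr0n.
set h := (t - q) / n%:R.
have nh : n%:R * h = tau by rewrite /h mulrCA divff ?mulr1// gt_eqF.
have h0 : 0 <= h by rewrite divr_ge0// ltW.
have htau : h <= tau by rewrite -nh ler_peMl// ler1n.
have q0 := pp_start pp.
have F0 i : (i <= n)%N -> fmeas F (grid q t n i) (\1_(A i)).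
  by move=> hi; apply: (fmeas_indic hF (le_trans q0 (grid_le n i))); exact: gs_adapted gs _ hi.
have mA i : (i <= n)%N -> measurable (A i).
  move=> hi; apply: (filtration_measurable hF (le_trans q0 (grid_le n i))); exact: gs_adapted gs _ hi.
pose E i := 2 * k * B * h + CF * \int[P]_w (\1_(A i) w * tint (grid q t n i) (grid q t n i.+1) planar_defect w) +
     C * (h ^+ 2 + h * (2 * (a + c2 * h / a)) +
       (\int[P]_w psi (M1 (grid q t n i.+1) w - M1 (grid q t n i) w) +
        \int[P]_w psi (M2 (grid q t n i.+1) w - M2 (grid q t n i) w))) +
     U' * (h ^+ 2 + 2 * (c2 * h)).
have step i : (i < n)%N ->
  \int[P]_w (\1_(A i) w * pot k (radius2 (grid q t n i) w + e)) +
    h * \int[P]_w (\1_(A i) w * (Num.sqrt (radius2 (grid q t n i) w + e))^-1) <=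
  \int[P]_w (\1_(A i.+1) w * pot k (radius2 (grid q t n i.+1) w + e)) +
    U * (\int[P]_w \1_(A i) w - \int[P]_w \1_(A i.+1) w) +
    ln (2 * e) * \int[P]_w \1_(H i) w + E i.
  move=> hi.
  have := potential_step hF pp e0 e1 (grid_le n i) (gridS n i) a0 (F0 i (ltnW hi)) (mA _ hi)
    (gs_hit_measurable gs hi) (gs_decreasing gs hi) (gs_exit gs hi)
    (fun w => @gs_radius _ _ _ _ gs i w (ltnW hi)) (fun w => @gs_hit _ _ _ _ gs i w hi) C0 hC
    (fun w => @gs_radius _ _ _ _ gs i.+1 w hi).
  by rewrite grid_step.
have := sum_steps (f := fun i => \int[P]_w (\1_(A i) w * pot k (radius2 (grid q t n i) w + e)))
  (S := fun i => h * \int[P]_w (\1_(A i) w * (Num.sqrt (radius2 (grid q t n i) w + e))^-1))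
  (al := fun i => \int[P]_w \1_(A i) w) (chi := fun i => \int[P]_w \1_(H i) w) step.
rewrite -mulr_sumr /= {1}/grid mul0r addr0.
have ind_le1 i : (i <= n)%N -> 0 <= \int[P]_w \1_(A i) w <= 1.
  move=> hi; apply/andP; split.
    by apply: rint_ge0 => // w _; rewrite indicE.
  rewrite -[leRHS](rint_cst P); apply: ler_rint => //.
  - by apply: (itg_fmeas_bounded hF (C := 1) (le_trans q0 (grid_le n i)) (F0 i hi)) => w; rewrite indicE; case: (_ \in _); rewrite ?normr1 ?normr0.
  - exact: (itg_cst measurableT (prob_fin P)).
have al : U * (\int[P]_w \1_(A 0%N) w - \int[P]_w \1_(A n) w) <= U.
  rewrite -[leRHS]mulr1; apply: ler_wpM2l => //.
  by have /andP[_ h1] := ind_le1 0%N (leq0n n); have /andP[h2 _] := ind_le1 n (leqnn n); lra.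
have fn : \int[P]_w (\1_(A n) w * pot k (radius2 (grid q t n n) w + e)) <= k + (1 + k) * 2.
  have t0 := le_trans q0 (grid_le n n); have mAn : fmeas F (grid q t n n) (\1_(A n)) by exact: F0.
  have K30 : 0 <= k + (1 + k) * 2 by rewrite addr_ge0// mulr_ge0// addr_ge0.
  have lne : ln e <= 0 by apply: ln_le0; exact: half_le1.
  rewrite -[leRHS](rint_cst P); apply: ler_rint => //.
  - apply: (itg_fmeas_bounded hF (C := - ln e + (k + (1 + k) * 2)) t0).
      apply: measurable_funM => //; apply: (measurableT_comp measurable_pot).
      by apply: measurable_funD; [exact: radius2_measurable|exact: measurable_cst].
    move=> w; rewrite indicE; case: (boolP (w \in A n)) => [/set_mem wA|_] /=.
      rewrite mul1r; have r1 := gs_radius gs (leqnn n) wA.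
      have r0 : 0 <= radius2 (grid q t n n) w by rewrite addr_ge0 ?sqr_ge0.
      have := pot_upper e0 e1 r0 r1; have := pot_ge k0 e0 r0.
      rewrite ler_norml; move: (pot _ _) K30 lne; move: (ln e) (k + (1 + k) * 2) => x y z; lra.
    by rewrite mul0r normr0; move: K30 lne; move: (ln e) (k + (1 + k) * 2) => x y; lra.
  - exact: (itg_cst measurableT (prob_fin P)).
  move=> w _; rewrite indicE; case: (boolP (w \in A n)) => [/set_mem wA|_] /=.
    rewrite mul1r; apply: (pot_upper e0 e1); first by rewrite addr_ge0 ?sqr_ge0.
    exact: (gs_radius gs (leqnn n) wA).
  by rewrite mul0r.
have ErrE : \sum_(i < n) E i = 2 * k * B * tau +
   CF * \sum_(i < n) \int[P]_w (\1_(A i) w * tint (grid q t n i) (grid q t n i.+1) planar_defect w) +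
   (h * K2 + 2 * (C * tau) * a) + C * (\sum_(i < n) \int[P]_w psi (M1 (grid q t n i.+1) w - M1 (grid q t n i) w) +
     \sum_(i < n) \int[P]_w psi (M2 (grid q t n i.+1) w - M2 (grid q t n i) w)) +
   U' * (tau * h + 2 * (c2 * tau)).
  have sp i : E i = _ := error_split CF _ C h a c2 _ _ U' _ _.
  rewrite (error_sum (v := fun i => \int[P]_w (\1_(A i) w * tint (grid q t n i) (grid q t n i.+1) planar_defect w))
    (p1 := fun i => \int[P]_w psi (M1 (grid q t n i.+1) w - M1 (grid q t n i) w))
    (p2 := fun i => \int[P]_w psi (M2 (grid q t n i.+1) w - M2 (grid q t n i) w)) n sp).
  rewrite (error_const _ _ _ _ _ nh (lt0r_neq0 a0)) -/K2.
  exact: error_shuffle.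
have e1' : CF * \sum_(i < n) \int[P]_w (\1_(A i) w * tint (grid q t n i) (grid q t n i.+1) planar_defect w) <= 1 / 4.
  apply: le_trans (ler_wpM2l CF0 hV) _.
  exact: quarter_bound.
have e2' : 2 * (C * tau) * a <= 1 / 4.
  exact: eighth_bound.
have e3' : h * K2 <= 1 / 4.
  have bK := archi_boundP (x := 4 * tau * K2) ltac:(by rewrite !mulr_ge0// ltW).
  rewrite /h mulrAC ler_pdivrMr//.
  have {}nK : (Num.bound (4 * tau * K2))%:R <= n%:R :> R by rewrite ler_nat.
  have := ltW (lt_le_trans bK nK).
  by rewrite -/tau -mulrA; move: (tau * K2) n%:R => x y; lra.
have e4' : C * (\sum_(i < n) \int[P]_w psi (M1 (grid q t n i.+1) w - M1 (grid q t n i) w) +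
     \sum_(i < n) \int[P]_w psi (M2 (grid q t n i.+1) w - M2 (grid q t n i) w)) <= 1 / 4.
  apply: le_trans (ler_wpM2l C0 (lerD hn1 hn2)) _.
  apply: le_trans (eighth_bound C0); rewrite -/eta' [2 * C]mulrC -mulrA.
  by rewrite [2 * _]mulrDl mul1r.
have e5' : U' * (tau * h + 2 * (c2 * tau)) <= U' * (tau * tau + 2 * (c2 * tau)).
  by apply: ler_wpM2l => //; rewrite lerD2r ler_wpM2l// ltW.
rewrite ErrE -/h; move: e1' e2' e3' e4' e5' al fn; rewrite /K1.
move: (CF * _) (2 * (C * tau) * a) (h * K2) (C * (_ + _)) (U' * _) (U' * _) (U * _)
  (\int[P]_w (\1_(A n) w * _)) => x1 x2 x3 x4 x5 x6 x7 x8.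
move: (\int[P]_w (\1_(A 0%N) w * _)) (h * _) (ln _ * _) (2 * k * B * tau) (k + _) U => x9 x10 x11 x12 x13 x14.
by lra.
Qed.

End grid_potential.

(** * Negligible sets detected on grids *)

Section negligible_sets.
Context {R : realType} {d : measure_display} {T : measurableType d} (P : probability T R).

Lemma measure_liminf_le (U : nat -> set T) (eta : R) n0 : (forall n, measurable (U n)) ->
  (forall n, (n0 <= n)%N -> (P (U n) <= eta%:E)%E) ->
  measurable (\bigcup_m \bigcap_(n in [set n | (m <= n)%N]) U n) /\
  (P (\bigcup_m \bigcap_(n in [set n | (m <= n)%N]) U n) <= eta%:E)%E.
Proof.
move=> mU hU.
have mL m : measurable (\bigcap_(n in [set n | (m <= n)%N]) U n) by exact: bigcap_measurableType.
have mLL : measurable (\bigcup_m \bigcap_(n in [set n | (m <= n)%N]) U n) by exact: bigcup_measurable.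
split=> //; have := nondecreasing_cvg_mu (mu := P) mL mLL.
have homoL : {homo (fun m : nat => \bigcap_(n in [set n | (m <= n)%N]) U n) : n m / (n <= m)%N >-> (n <= m)%O}.
  by move=> i j ij; apply/subsetPset => w h n /= jn; apply: h => /=; exact: leq_trans jn.
move=> /(_ homoL); apply: cvge_le.
apply: nearW => m /=; apply: (@le_trans _ _ (P (U (maxn m n0)))).
  apply: le_measure; rewrite ?inE//.
  by move=> w /(_ (maxn m n0)); apply => /=; rewrite leq_maxl.
by apply: hU; rewrite leq_maxr.
Qed.

(** N need not be measurable, and [U n] captures a path of N only for n beyond a threshold depending
    on the path. So N lies in the lower limit of the [U n], of measure at most eta; intersecting
    over eta = 1 / (j + 1) gives a null set. *)
Lemma negligible_liminf (N : set T) :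
  (forall eta, 0 < eta -> exists U : nat -> set T,
    [/\ forall n, measurable (U n),
        exists n0, forall n, (n0 <= n)%N -> (P (U n) <= eta%:E)%E &
        forall w, N w -> exists n0, forall n, (n0 <= n)%N -> U n w]) ->
  P.-negligible N.
Proof.
move=> h.
have h' (j : nat) : exists L : set T, [/\ measurable L, (P L <= (j.+1%:R^-1)%:E)%E & N `<=` L].
  have j0 : 0 < j.+1%:R^-1 :> R by rewrite invr_gt0 ltr0n.
  have [U [mU [n0 hU] NU]] := h _ j0.
  have [mL hL] := measure_liminf_le mU hU.
  exists (\bigcup_m \bigcap_(n in [set n | (m <= n)%N]) U n); split=> // w /NU[m hm].
  by exists m => // n /= mn; exact: hm.
have [L hL] := choice h'.
have mL : measurable (\bigcap_j L j) by apply: bigcapT_measurable => j; case: (hL j).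
exists (\bigcap_j L j); split=> //; last by move=> w Nw j _; case: (hL j) => _ _; apply.
apply/eqP; rewrite eq_le measure_ge0 andbT.
apply/lee_addgt0Pr => e e0; rewrite add0e.
have [j hj] : exists j : nat, j.+1%:R^-1 <= e.
  exists (Num.bound e^-1); rewrite -[leRHS]invrK lef_pV2 ?posrE ?invr_gt0 ?ltr0n//.
  by apply/ltW/(lt_trans (archi_boundP _)); rewrite ?invr_ge0 ?ltr_nat// ltW.
have [mLj PL _] := hL j.
apply: (le_trans _ (le_trans PL _)); last by rewrite lee_fin.
by apply: le_measure; rewrite ?inE// => w; apply.
Qed.

Lemma rint_indic (A : set T) : measurable A -> (\int[P]_w \1_A w)%:E = P A.
Proof.
move=> mA; rewrite /Rintegral integral_indic// setIT fineK//.
by rewrite ge0_fin_numE//; apply: le_lt_trans (probability_le1 P mA) _; rewrite ltry.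
Qed.

Lemma measure_bigsetU_le (n : nat) (H : nat -> set T) (c : R) :
  (forall i, (i < n)%N -> measurable (H i)) ->
  \sum_(i < n) \int[P]_w \1_(H i) w <= c ->
  (P (\big[setU/set0]_(i < n) H i) <= c%:E)%E.
Proof.
move=> mH hc; apply: le_trans (le_mu_bigsetU P mH) _.
rewrite (eq_bigr (fun i : 'I_n => (\int[P]_w \1_(H i) w)%:E)).
  by rewrite sumEFin lee_fin.
by move=> i _; rewrite rint_indic//; exact: mH.
Qed.

Lemma rint_eventually0 (f : nat -> T -> R) (C : R) :
  (forall n, measurable_fun setT (f n)) -> (forall n w, `|f n w| <= C) ->
  (forall w, exists n0, forall n, (n0 <= n)%N -> f n w = 0) ->
  forall eta, 0 < eta -> exists n0, forall n, (n0 <= n)%N -> \int[P]_w f n w <= eta.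
Proof.
move=> mf fC f0 eta eta0.
have := @dominated_cvg _ _ _ P setT measurableT (fun n w => (f n w)%:E) (cst 0%E) (cst C%:E).
move=> /(_ (fun n => measurableT_comp (@EFin_measurable _ _ ) (mf n))).
have h1 : forall x : T, [set: T] x -> (f n x)%:E @[n --> \oo] --> (cst 0%E x : \bar R).
  move=> w _; apply: cvg_near_cst; have [n0 hn] := f0 w.
  by exists n0 => // n /= /hn ->.
move=> /(_ h1 (fun _ _ => isT) (itg_cst measurableT (prob_fin P) C)).
have h2 : forall n x, [set: T] x -> (`|(f n x)%:E| <= (cst C%:E x : \bar R))%E.
  by move=> n w _; rewrite /= lee_fin.
move=> /(_ h2); rewrite integral0 => /fine_cvgP[_ /cvgrPdist_lt/(_ _ eta0)[n0 _ hn]].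
exists n0 => n /hn /=; rewrite sub0r normrN => /ltW; exact: le_trans (ler_norm _).
Qed.

End negligible_sets.

Lemma continuous_paths_near {R : realType} {d : measure_display} {T : measurableType d}
    (X : R -> T -> R) w s e : continuous_paths X -> 0 <= s -> 0 < e ->
  exists2 h, 0 < h & forall r, 0 <= r -> `|s - r| < h -> `|X s w - X r w| < e.
Proof.
move=> cX s0 e0; have /subspace_continuousP/(_ s) := cX w.
rewrite /= in_itv/= s0 => /(_ isT)/cvgrPdist_lt/(_ _ e0)[h h0 hX].
exists h => // r r0 sr; apply: (hX r) => //=.
by rewrite in_itv/= r0.
Qed.

(** * Hitting the origin *)

Section region.
Context {R : realType} {d : measure_display} {T : measurableType d}.
Variables (P : probability T R) (F : R -> set_system T).
Hypothesis hF : usual_conditions P F.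
Variables (X1 X2 M1 M2 V1 V2 : R -> T -> R) (B c c2 CV q t : R).
Hypothesis pp : planar_process P F X1 X2 M1 M2 V1 V2 B c c2 CV q t.
Hypotheses (cX1 : continuous_paths X1) (cX2 : continuous_paths X2).
Local Notation rho2 := (radius2 X1 X2).
Local Notation planar_defect := (planar_defect V1 V2).
Local Notation gr := (grid q t).

(** [G s] is the event of being in the region at time s. By [GV] the defects then vanish for a
    further time h0, which depends on the path. *)
Variable G : R -> set T.
Hypothesis mG : forall s, 0 <= s -> F s (G s).
Hypothesis GV : forall w, exists2 h0, 0 < h0 & forall s r, q <= s -> s <= r -> r <= t ->
  r - s <= h0 -> G s w -> V1 r w = 0 /\ V2 r w = 0.

Let q0 : 0 <= q := pp_start pp.
Let gr0 n i : 0 <= gr n i := le_trans q0 (grid_le pp n i).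

Let mV s u : 0 <= s -> jmeas s u planar_defect.
Proof. by move=> s0; apply: jmeasD; apply: jmeas_norm; [exact: (pp_jmeas1 pp)|exact: (pp_jmeas2 pp)]. Qed.

Let bV x w : `|planar_defect x w| <= CV + CV.
Proof. by rewrite ger0_norm ?addr_ge0// lerD// ?(pp_bound1 pp)// (pp_bound2 pp). Qed.

Let CV0 : 0 <= CV. Proof. exact: le_trans (normr_ge0 _) (pp_bound1 pp 0 point). Qed.

Let mGr n i : measurable (G (gr n i)).
Proof. exact: (filtration_measurable hF (gr0 n i) (mG (gr0 n i))). Qed.

Let ind1 (D : set T) w : `|\1_D w : R| <= 1.
Proof. by rewrite indicE; case: (_ \in _); rewrite ?normr1 ?normr0. Qed.

Let tint0 s u w : 0 <= tint s u planar_defect w.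
Proof. by apply: rint_ge0 => x _; rewrite addr_ge0. Qed.

Let i_defect n i : itg P setT (fun w => \1_(G (gr n i)) w * tint (gr n i) (gr n i.+1) planar_defect w).
Proof.
apply: (itg_mulb (C := 1) measurableT (itg_tint P (gridS pp n i) (mV (gr0 n i)) bV)) => [|w _].
  exact: measurable_indic.
exact: ind1.
Qed.

Lemma grid_end n : (0 < n)%N -> gr n n = t.
Proof.
by move=> n0; rewrite /grid mulrCA divff ?mulr1 ?pnatr_eq0 -?lt0n// addrC subrK.
Qed.

Lemma grid_mono n i j : (i <= j)%N -> gr n i <= gr n j.
Proof.
move=> ij; rewrite /grid lerD2l ler_wpM2r ?ler_nat// divr_ge0// subr_ge0.
exact: ltW (pp_end pp).
Qed.

(** For a given path the sum is 0 as soon as the mesh is at most its h0. As the sums are bounded by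
    2 CV (t - q), dominated convergence concludes. *)
Lemma defect_small eta : 0 < eta -> exists n0, forall n, (n0 <= n)%N -> (0 < n)%N ->
  \sum_(i < n) \int[P]_w (\1_(G (gr n i)) w * tint (gr n i) (gr n i.+1) planar_defect w) <= eta.
Proof.
move=> eta0.
pose f n w := \sum_(i < n) (\1_(G (gr n i)) w * tint (gr n i) (gr n i.+1) planar_defect w).
have mf n : measurable_fun setT (f n).
  by apply: (itg_measurable (mu := P)); apply: (itg_sum measurableT) => i _; exact: i_defect.
have t_q : 0 <= t - q by rewrite subr_ge0 ltW// (pp_end pp).
have fC n w : `|f n w| <= (CV + CV) * (t - q).
  apply: le_trans (ler_norm_sum _ _ _) _.
  apply: (@le_trans _ _ (\sum_(i < n) (CV + CV) * ((t - q) / n%:R))).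
    apply: ler_sum => i _; rewrite normrM -[leRHS]mul1r; apply: ler_pM => //.
    have := tint_bound (gridS pp n i) (mV (gr0 n i)) bV w.
    by rewrite (grid_step _ _ n i).
  rewrite sumr_const card_ord -mulrnAr ler_wpM2l ?addr_ge0// -mulr_natl.
  case: n => [|n]; first by rewrite mul0r.
  by rewrite mulrCA divff ?mulr1// pnatr_eq0.
have f0 w : exists n0, forall n, (n0 <= n)%N -> f n w = 0.
  have [h0 h00 hV] := GV w.
  exists (Num.bound ((t - q) / h0)) => n hn.
  have small i : gr n i.+1 - gr n i <= h0.
    rewrite grid_step; case: n hn => [|n] hn; first by rewrite invr0 mulr0 ltW.
    rewrite ler_pdivrMr ?ltr0n// mulrC -ler_pdivrMr//.
    apply/ltW/(lt_le_trans (archi_boundP _)); rewrite ?ler_nat//.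
    by rewrite divr_ge0// ltW.
  rewrite /f big1// => i _; rewrite indicE.
  case: (boolP (w \in G (gr n i))) => [/set_mem wG|_] /=; last by rewrite mul0r.
  rewrite mul1r /tint; transitivity (\int[lebesgue_measure]_(x in `]gr n i, gr n i.+1]) (0 : R)); last first.
    by apply: rint0; exact: measurable_itv.
  apply: eq_rint.
  move=> x /=; rewrite in_itv/= => /andP[ix xi].
  have n_gt0 : (0 < n)%N by exact: leq_ltn_trans (leq0n _) (ltn_ord i).
  have xt : x <= t by apply: le_trans xi _; rewrite -[leRHS](grid_end n_gt0); exact: grid_mono.
  have [] := hV (gr n i) x (grid_le pp n i) (ltW ix) xt _ wG.
    by apply: le_trans (small i); rewrite lerD2r.
  by rewrite /planar_defect => -> ->; rewrite normr0 addr0.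
have [n0 hn] := rint_eventually0 P mf fC f0 eta0.
exists n0 => n /hn + _; rewrite /f rint_sum// => i _; exact: i_defect.
Qed.

Let kk := (8 * B + 2) / c.

(** If the surviving paths are in [G] at the grid points, the smallness of the defects assumed in
    [grid_potential] holds on all fine grids. *)
Lemma region_potential : exists K0, forall e, 0 < e -> 2 * e <= 1 ->
  exists n0, forall n, (n0 <= n)%N -> (0 < n)%N ->
  forall A H, grid_sets F X1 X2 q t e n A H -> (forall i, (i < n)%N -> A i `<=` G (gr n i)) ->
    \int[P]_w (\1_(A 0%N) w * pot kk (rho2 q w + e)) +
    (t - q) / n%:R * \sum_(i < n) \int[P]_w (\1_(A i) w * (Num.sqrt (rho2 (gr n i) w + e))^-1) -
    ln (2 * e) * \sum_(i < n) \int[P]_w \1_(H i) w <= K0.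
Proof.
have [K0 hK] := grid_potential hF pp; exists K0 => e e0 e1.
have [eta eta0 [n0 hn]] := hK e e0 e1; have [n1 hn1] := defect_small eta0.
exists (maxn n0 n1) => n; rewrite geq_max => /andP[/hn {}hn /hn1 {}hn1] n_gt0 A H gs AG.
apply: (hn n_gt0 A H gs); apply: le_trans (hn1 n_gt0); apply: ler_sum => i _.
have mA : measurable (A i).
  exact: (filtration_measurable hF (gr0 n i) (gs_adapted gs (ltnW (ltn_ord i)))).
apply: ler_rint => //.
  apply: (itg_mulb (C := 1) measurableT (itg_tint P (gridS pp n i) (mV (gr0 n i)) bV)) => [|w _].
    exact: measurable_indic.
  exact: ind1.
move=> w _; apply: ler_wpM2r => //; rewrite !indicE.
case: (boolP (w \in A i)) => //= /set_mem/(AG _ (ltn_ord i)) wG.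
by rewrite mem_set.
Qed.

Let F_setI s A A' : 0 <= s -> F s A -> F s A' -> F s (A `&` A').
Proof.
move=> s0 FA FA'; have sF := sigma_algebra_id (filtration_sigma_algebra hF s0).
have : @measurable _ (g_sigma_algebraType (F s)) (A `&` A').
  by apply: measurableI; rewrite -[X in X _]/(<<s F s>>) sF.
by rewrite -[X in X _ -> _]/(<<s F s>>) sF.
Qed.

Let F_bigcap n i (A : nat -> set T) : (forall j, (j <= i)%N -> F (gr n j) (A j)) ->
  F (gr n i) (\bigcap_(j in [set j | (j <= i)%N]) A j).
Proof.
move=> FA; have sF := sigma_algebra_id (filtration_sigma_algebra hF (gr0 n i)).
have : @measurable _ (g_sigma_algebraType (F (gr n i))) (\bigcap_(j in [set j | (j <= i)%N]) A j).
  apply: bigcap_measurableType => j /= ji; rewrite -[X in X _]/(<<s F (gr n i)>>) sF.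
  by apply: (filtration_nondecreasing hF (gr0 n j) (grid_mono n ji)); exact: FA.
by rewrite -[X in X _ -> _]/(<<s F _>>) sF.
Qed.

Let F_radius n i (D : set R) : measurable D -> F (gr n i) (rho2 (gr n i) @^-1` D).
Proof.
by move=> mD; exact: ((fmeasP hF _ (gr0 n i)).1 (radius2_measurable hF pp (gr0 n i))).
Qed.

Let F_meas n i A : F (gr n i) A -> measurable A.
Proof. exact: (filtration_measurable hF (gr0 n i)). Qed.

Let radius0 s w : 0 <= rho2 s w. Proof. by rewrite addr_ge0 ?sqr_ge0. Qed.

Let iA (A : set T) (f : T -> R) C : measurable A -> measurable_fun setT f ->
  (forall w, A w -> `|f w| <= C) -> 0 <= C -> itg P setT (fun w => \1_A w * f w).
Proof.
move=> mA mf fC C0; apply: (itg_bounded measurableT (prob_fin P) (C := C)).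
  by apply: measurable_funM => //; exact: measurable_indic.
move=> w _; rewrite indicE; case: (boolP (w \in A)) => [/set_mem/fC|_] /=.
  by rewrite mul1r.
by rewrite mul0r normr0.
Qed.

Let i_ind (A : set T) : measurable A -> itg P setT (\1_A : T -> R).
Proof.
move=> mA; apply: (itg_bounded measurableT (prob_fin P) (C := 1)) => [|w _].
  exact: measurable_indic.
exact: ind1.
Qed.

Let ind_le1 (A : set T) : measurable A -> \int[P]_w (\1_A w : R) <= 1.
Proof. by move=> mA; rewrite -lee_fin rint_indic//; exact: probability_le1. Qed.

Let ind_ge0 (A : set T) : 0 <= \int[P]_w (\1_A w : R).
Proof. by apply: rint_ge0 => w _; rewrite indicE. Qed.

Let kk0 : 0 <= kk.
Proof.
apply: divr_ge0; last exact: ltW (pp_c pp).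
by rewrite addr_ge0// mulr_ge0// (pp_B pp).
Qed.

(** As ln r <= 0, it is also a lower bound for ln r times the probability of A. *)
Let pot_start (A : set T) e r : 0 < e -> 2 * e <= 1 -> 0 < r -> r <= 1 -> measurable A ->
  (forall w, A w -> r <= rho2 q w + e) -> (forall w, A w -> rho2 q w <= 1) ->
  ln r <= \int[P]_w (\1_A w * pot kk (rho2 q w + e)).
Proof.
move=> e0 e1 r0 r1 mA rA A1; have lr : ln r <= 0 by apply: ln_le0.
have pA w : A w -> ln r <= pot kk (rho2 q w + e).
  move=> Aw; rewrite /pot -[leLHS]addr0; apply: lerD; last by rewrite mulr_ge0 ?sqrtr_ge0.
  by rewrite ler_ln ?posrE//; [exact: rA|rewrite ltr_wpDl].
apply: (@le_trans _ _ (ln r * \int[P]_w \1_A w)).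
  by rewrite -[leLHS]mulr1 ler_wnM2l// ind_le1.
rewrite -rintZ//; last exact: i_ind.
apply: ler_rint => //; first by apply: itgZ => //; exact: i_ind.
  apply: (iA (C := - ln r + (kk + (1 + kk) * 2))) => //.
  - apply: (measurableT_comp (measurable_pot B c)); apply: measurable_funD; last exact: measurable_cst.
    exact: (fmeas_measurable hF q0 (radius2_measurable hF pp q0)).
  - move=> w Aw; have := pA _ Aw; have := pot_upper pp e0 e1 (radius0 q w) (A1 _ Aw).
    have : 0 <= kk + (1 + kk) * 2 by rewrite addr_ge0// mulr_ge0// addr_ge0.
    rewrite ler_norml -/kk; move: lr; move: (pot _ _) (kk + (1 + kk) * 2) (ln r) => x y z *; apply/andP; split; lra.
  - by rewrite addr_ge0 ?oppr_ge0// addr_ge0// mulr_ge0// addr_ge0.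
move=> w _; rewrite indicE; case: (boolP (w \in A)) => [/set_mem/pA|_] /=.
  by rewrite mulr1 mul1r.
by rewrite mulr0 mul0r.
Qed.

Let S_ge0 n (A : nat -> set T) e : 0 <= (t - q) / n%:R *
  \sum_(i < n) \int[P]_w (\1_(A i) w * (Num.sqrt (rho2 (gr n i) w + e))^-1).
Proof.
rewrite mulr_ge0 ?divr_ge0 ?subr_ge0 ?(ltW (pp_end pp))// sumr_ge0// => i _.
by apply: rint_ge0 => w _; rewrite indicE mulr_ge0// invr_ge0 sqrtr_ge0.
Qed.

Definition hit_set (r : R) : set T := [set w | r < rho2 q w /\ exists u, [/\ q <= u, u <= t,
  rho2 u w = 0 & forall s, q <= s -> s <= u -> G s w /\ rho2 s w <= 1]].

Let radius_near s w e : 0 <= s -> rho2 s w = 0 -> 0 < e -> e <= 1 ->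
  exists2 h, 0 < h & forall v, 0 <= v -> `|s - v| < h -> rho2 v w <= e.
Proof.
move=> s0 rs e0 e1; have e2 : 0 < e / 2 by rewrite divr_gt0.
have [h1 h10 hX1] := continuous_paths_near w cX1 s0 e2.
have [h2 h20 hX2] := continuous_paths_near w cX2 s0 e2.
exists (Num.min h1 h2); first by rewrite lt_min h10.
move=> v v0; rewrite lt_min => /andP[/(hX1 _ v0) {}hX1 /(hX2 _ v0) {}hX2].
have z1 : X1 s w = 0 by move: rs (sqr_ge0 (X1 s w)) (sqr_ge0 (X2 s w)); rewrite /radius2 => r a b; apply/eqP; rewrite -sqrf_eq0; apply/eqP; lra.
have z2 : X2 s w = 0 by move: rs (sqr_ge0 (X1 s w)) (sqr_ge0 (X2 s w)); rewrite /radius2 => r a b; apply/eqP; rewrite -sqrf_eq0; apply/eqP; lra.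
have sq x : `|0 - x| < e / 2 -> x ^+ 2 <= e / 2 :> R.
  rewrite sub0r normrN => hx; rewrite -[x ^+ 2]real_normK ?num_real//.
  by have := normr_ge0 x; nra.
by rewrite /radius2; move: hX1 hX2; rewrite z1 z2 => /sq + /sq; lra.
Qed.

(** In [region_potential], - ln (2 e) times the probability of coming within e of the origin is at
    most K0 - ln r. As [K0] does not depend on e, this probability tends to 0 with e. *)
Lemma hit_set_negligible r : 0 < r -> P.-negligible (hit_set r).
Proof.
move=> r0; wlog r1 : r r0 / r <= 1.
  move=> h; have [|r1] := leP r 1; first exact: h.
  by apply: negligibleS (h 1 ltr01 (lexx _)) => w [wr wu]; split=> //; exact: lt_trans wr.
apply: negligible_liminf => eta eta0.
have [K0 hK] := region_potential.
(* [e] is such that - ln (2 e) = y. The summand K / eta of [y] makes the probability at most eta;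
   the summand 1 / r gives e < r, so that the path starts farther than e. *)
pose K := `|K0 - ln r|; have K_ge0 : 0 <= K by exact: normr_ge0.
pose y := K / eta + r^-1.
have y0 : 0 < y by rewrite ltr_wpDl ?invr_gt0// divr_ge0// ltW.
pose e := expR (- y) / 2.
have e0 : 0 < e by rewrite divr_gt0// expR_gt0.
have e2 : 2 * e = expR (- y) by rewrite /e; field.
have e1 : 2 * e <= 1 by rewrite e2 -expR0 ler_expR oppr_le0 ltW.
have er : e < r.
  apply: (@lt_le_trans _ _ (2 * e)); first by rewrite ltr_pMl// ltr1n.
  rewrite e2 expRN -[r]invrK lef_pV2 ?posrE ?invr_gt0 ?expR_gt0//.
  apply: (@le_trans _ _ (1 + y)); last exact: expR_ge1Dx.
  by rewrite /y addrA lerDr addr_ge0// divr_ge0// ltW.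
have [n0 hn] := hK e e0 e1.
(* Survival requires being in the region and strictly beyond e at all grid points up to the i-th;
   [H n i] is the first arrival within e, at the point i + 1. *)
pose A n i := (rho2 q @^-1` `]r, +oo[) `&`
  \bigcap_(j in [set j | (j <= i)%N]) (G (gr n j) `&` rho2 (gr n j) @^-1` `]e, 1%R]).
pose H n i := A n i `&` rho2 (gr n i.+1) @^-1` `]-oo, e].
have FA n i : F (gr n i) (A n i).
  apply: F_setI => //; last first.
    by apply: F_bigcap => j ji; apply: F_setI => //; [exact: mG|exact: F_radius].
  apply: (filtration_nondecreasing hF q0 (grid_le pp n i)).
  by apply: ((fmeasP hF _ q0).1 (radius2_measurable hF pp q0)); exact: measurable_itv.
have mH n i : measurable (H n i).
  by apply: measurableI; [exact: F_meas (FA n i)|apply: F_meas; exact: F_radius].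
have gs n : grid_sets F X1 X2 q t e n (A n) (H n).
  split => //.
  - move=> i _ w [wr wA]; split => // j /= ji; apply: wA => /=; exact: leq_trans ji _.
  - move=> i _ w [wA /=]; rewrite in_itv/= => we; split => // -[_ /(_ i.+1 (leqnn _))[_ /=]].
    by rewrite in_itv/= ltNge we.
  - by move=> i w _ [_ /(_ i (leqnn _))[_ /=]]; rewrite in_itv/= => /andP[].
  - by move=> i w _ [_ /=]; rewrite in_itv.
exists (fun n => \big[setU/set0]_(i < n) H n i); split.
- by move=> n; apply: bigsetU_measurable => i _.
- exists (maxn n0 1) => n; rewrite geq_max => /andP[/hn {}hn n_gt0].
  apply: measure_bigsetU_le => //.
  have := hn n_gt0 _ _ (gs n) (fun i _ w wA => (wA.2 i (leqnn i)).1).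
  have mA0 := F_meas (FA n 0%N).
  have g0 : gr n 0 = q by rewrite /grid mul0r addr0.
  have A0r w : A n 0%N w -> r <= rho2 q w + e.
    by case=> /=; rewrite in_itv/= andbT => /ltW wr _; rewrite (le_trans wr)// lerDl ltW.
  have A01 w : A n 0%N w -> rho2 q w <= 1.
    by case=> _ /(_ 0%N (leqnn _))[_ /=]; rewrite in_itv/= g0 => /andP[].
  have := pot_start e0 e1 r0 r1 mA0 A0r A01; have := S_ge0 n (A n) e.
  rewrite e2 expRK; set x1 := (t - q) / _ * _; set x2 := \int[P]_w (\1_(A n 0%N) w * _).
  set x3 := \sum_(i < n) _ => h1 h2 h3.
  have x30 : 0 <= x3 by apply: sumr_ge0 => i _; exact: ind_ge0.
  have yx : y * x3 <= K.
    apply: (@le_trans _ _ (K0 - ln r)); last exact: ler_norm.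
    by move: h1 h2 h3; rewrite mulNr opprK; move: (y * x3) x1 x2 (ln r) => *; lra.
  rewrite -(ler_pM2l y0); apply: le_trans yx _.
  rewrite /y mulrDl mulrVK ?unitfE ?gt_eqF// lerDl mulr_ge0 ?invr_ge0 ?ltW//.
move=> w [wr [u [qu ut ru wu]]].
have u0 := le_trans q0 qu; have e_le1 := half_le1 e0 e1.
have [h h0 hw] := radius_near u0 ru e0 e_le1.
have qu' : q < u.
  by rewrite lt_neqAle qu andbT; apply/eqP => E; move: wr; rewrite E ru ltNge ltW.
exists (Num.bound ((t - q) / h)) => n hb.
have tq := pp_end pp.
have n_gt0 : (0 < n)%N.
  apply: leq_trans hb; rewrite -(ltr_nat R); apply: le_lt_trans (archi_boundP _) => //.
    by apply: divr_ge0; [rewrite subr_ge0|]; exact: ltW.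
  by apply: divr_ge0; [rewrite subr_ge0|]; exact: ltW.
have step : (t - q) / n%:R < h.
  rewrite ltr_pdivrMr ?ltr0n// mulrC -ltr_pdivrMr//.
  apply: lt_le_trans (archi_boundP _) _; rewrite ?ler_nat//.
  by rewrite divr_ge0 ?subr_ge0 ?ltW.
(* [j] is the last grid point not after the hitting time u; it is so close to u that the path is
   already within e there. *)
have [j [jn ju uj]] : exists j, [/\ (j <= n)%N, gr n j <= u & u < gr n j + h].
  have exj : exists j, gr n j <= u by exists 0%N; rewrite /grid mul0r addr0.
  have bj j : gr n j <= u -> (j <= n)%N.
    move=> ju; rewrite leqNgt; apply/negP => nj; move: ju; rewrite leNgt => /negP; apply.
    apply: le_lt_trans ut _; rewrite -[ltLHS](grid_end n_gt0) /grid ltrD2l ltr_pM2r ?ltr_nat//.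
    by rewrite divr_gt0 ?subr_gt0 ?ltr0n.
  case: (ex_maxnP exj bj) => j ju hj; exists j; split => //; first exact: bj.
  rewrite ltNge; apply/negP => hu; have := hj j.+1; rewrite ltnn => /(_ _)/negP; apply=> //.
  apply: le_trans hu; rewrite -lerBlDl grid_step; exact: ltW.
(* The least such index is positive because the path starts beyond e; its predecessor i is the step
   at which the path enters [H n i]. *)
have ex : exists j, (gr n j <= u) && (rho2 (gr n j) w <= e).
  exists j; rewrite ju hw//.
  by rewrite ger0_norm ?subr_ge0// ltrBlDl.
case: (ex_minnP ex) => -[|i] /andP[iu ie] imin.
  by move: ie; rewrite /grid mul0r addr0 leNgt (lt_trans er wr).
have i_n : (i < n)%N.
  rewrite -(ltn_predK n_gt0) ltnS -ltnS (ltn_predK n_gt0).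
  apply: leq_trans jn; apply: imin; rewrite ju hw//.
  by rewrite ger0_norm ?subr_ge0// ltrBlDl.
have -> : (\big[setU/set0]_(i < n) H n i) w = (\bigcup_(i < n) H n i) w by rewrite bigcup_mkord.
exists i => //; split; last by rewrite /= in_itv.
split; first by rewrite /= in_itv/= andbT.
move=> l /= li; have lu : gr n l <= u.
  by apply: le_trans iu; apply: grid_mono; exact: leq_trans li _.
have [Gl rl] := wu _ (grid_le pp n l) lu; split => //=; rewrite in_itv/= rl andbT ltNge.
apply/negP => le; have := imin l; rewrite lu le => /(_ isT).
by rewrite ltnNge li.
Qed.

Definition zero_set : set T := [set w | forall s, q <= s -> s <= t -> G s w /\ rho2 s w = 0].

(** On paths that stay at the origin, 1 / sqrt w is e^(-1/2) all the time. Its integral is bounded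
    by a constant plus the initial potential of order |ln e|, which is of smaller order. *)
Lemma zero_set_negligible : P.-negligible zero_set.
Proof.
apply: negligible_liminf => eta eta0.
have [K0 hK] := region_potential.
pose K := `|K0| + 4.
have K0K : 0 < K by rewrite ltr_wpDl.
have tq : 0 < t - q by rewrite subr_gt0 (pp_end pp).
(* With e = x^4 one has sqrt e = x^2 and - ln e <= 4 / x, so the probability of the grid event times
   t - q is at most x^2 (|K0| + 4 / x) <= x K, hence at most eta (t - q). *)
pose x := Num.min (1 / 2) (eta * (t - q) / K).
have x0 : 0 < x by rewrite lt_min divr_gt0// divr_gt0// mulr_gt0.
have x1 : x <= 1 / 2 by rewrite ge_min lexx.
have xK : x * K <= eta * (t - q) by rewrite -ler_pdivlMr// ge_min lexx orbT.
pose e := x ^+ 4.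
have e0 : 0 < e by rewrite exprn_gt0.
have xx : x ^+ 2 <= 1 / 4 by nra.
have eE : e = x ^+ 2 * x ^+ 2 by rewrite /e -exprD.
have e1 : 2 * e <= 1 by rewrite eE; have := sqr_ge0 x; nra.
have se : Num.sqrt e = x ^+ 2.
  by rewrite /e -[4%N]/(2 * 2)%N exprM sqrtr_sqr ger0_norm// sqr_ge0.
have lne : - ln e <= 4 / x.
  have : - ln x <= x^-1 by rewrite -lnV ?posrE//; apply/ltW/ln_sublinear; rewrite invr_gt0.
  by rewrite /e lnXn// -mulr_natl; move: (ln x) x^-1 => a b; lra.
have [n0 hn] := hK e e0 e1.
pose A n i := \bigcap_(j in [set j | (j <= i)%N]) (G (gr n j) `&` rho2 (gr n j) @^-1` [set 0]).
have FA n i : F (gr n i) (A n i).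
  by apply: F_bigcap => j ji; apply: F_setI => //; [exact: mG|exact: F_radius].
have gs n : grid_sets F X1 X2 q t e n (A n) (fun=> set0).
  split => //.
  - by move=> i _ w wA j /= ji; apply: wA => /=; exact: leq_trans ji _.
  - by move=> i w _ /(_ i (leqnn _))[_ /= ->].
exists (fun n => A n n); split.
- by move=> n; exact: F_meas (FA n n).
- exists (maxn n0 1) => n; rewrite geq_max => /andP[/hn {}hn n_gt0].
  have := hn n_gt0 _ _ (gs n) (fun i _ w wA => (wA i (leqnn i)).1).
  have mA i : measurable (A n i) := F_meas (FA n i).
  have g0 : gr n 0 = q by rewrite /grid mul0r addr0.
  have A0 w : A n 0%N w -> rho2 q w = 0 by move=> /(_ 0%N (leqnn _))[_ /=]; rewrite g0.
  have e_le1 := half_le1 e0 e1.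
  have A0r w : A n 0%N w -> e <= rho2 q w + e by move=> /A0 ->; rewrite add0r.
  have A01 w : A n 0%N w -> rho2 q w <= 1 by move=> /A0 ->.
  have := pot_start e0 e1 e0 e_le1 (mA 0%N) A0r A01.
  rewrite -rint_indic// lee_fin; set a := \int[P]_w \1_(A n n) w.
  have S : (t - q) * (a / x ^+ 2) <= (t - q) / n%:R *
      \sum_(i < n) \int[P]_w (\1_(A n i) w * (Num.sqrt (rho2 (gr n i) w + e))^-1).
    rewrite -[leRHS]mulrA; apply: ler_wpM2l; first exact: ltW.
    rewrite [leRHS]mulrC ler_pdivlMr ?ltr0n//; have -> : a / x ^+ 2 * n%:R = \sum_(i < n) (a / x ^+ 2).
      by rewrite sumr_const card_ord mulr_natr.
    apply: ler_sum => i _; rewrite /a mulrC -rintZ//; last exact: i_ind.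
    have gi w : A n i w -> (Num.sqrt (rho2 (gr n i) w + e))^-1 = (x ^+ 2)^-1.
      by move=> /(_ i (leqnn _))[_ /= ->]; rewrite add0r se.
    have E w : \1_(A n i) w * (Num.sqrt (rho2 (gr n i) w + e))^-1 = (x ^+ 2)^-1 * \1_(A n i) w.
      rewrite mulrC indicE; case: (boolP (w \in A n i)) => [/set_mem/gi -> //|_] /=.
      by rewrite !mulr0.
    rewrite [leRHS](_ : _ = \int[P]_w ((x ^+ 2)^-1 * \1_(A n i) w)); last first.
      by apply: eq_rint => w _; exact: E.
    apply: ler_rint => //; try by apply: itgZ => //; exact: i_ind.
    move=> w _; rewrite ler_wpM2l ?invr_ge0 ?sqr_ge0// !indicE.
    case: (boolP (w \in A n n)) => //= /set_mem wA; rewrite mem_set// => j /= ji.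
    by apply: wA => /=; apply: leq_trans ji _; exact: ltnW.
  have -> : \sum_(i < n) \int[P]_w (\1_set0 w : R) = 0.
    by apply: big1 => i _; rewrite -(rint0 P measurableT); apply: eq_rint => w _; rewrite indicE in_set0.
  rewrite mulr0 subr0.
  move: S; set x1' := (t - q) / _ * _; set x2 := \int[P]_w (\1_(A n 0%N) w * _) => h1 h2 h3.
  have : (t - q) * (a / x ^+ 2) <= `|K0| + 4 / x.
    by have := ler_norm K0; move: h1 h2 h3 lne; move: (4 / x) x1' x2 (ln e) => *; lra.
  have x20 : 0 < x ^+ 2 by rewrite exprn_gt0.
  rewrite mulrA ler_pdivrMr// => h4.
  have h5 : (t - q) * a <= x * K.
    apply: le_trans h4 _; rewrite /K mulrDl mulrDr; apply: lerD.
      by rewrite expr2 mulrCA; apply: ler_wpM2l; [exact: ltW|rewrite ler_piMr//; lra].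
    by rewrite expr2 mulrA mulfVK ?gt_eqF// mulrC.
  by rewrite -(ler_pM2l tq); apply: le_trans h5 _; rewrite [leRHS]mulrC.
move=> w wZ; exists 1%N => n n_gt0 j /= jn.
have jt : gr n j <= t by rewrite -[leRHS](grid_end n_gt0); exact: grid_mono.
by have [? ?] := wZ _ (grid_le pp n j) jt.
Qed.

End region.

(** * Competing Brownian particles *)

Section measurable_ranks.
Context {R : realType} {N : nat}.

Lemma measurable_forall {d} {T : measurableType d} (D : set T) (I : finType)
    (f : I -> T -> bool) : (forall i, measurable_fun D (f i)) ->
  measurable_fun D (fun s => [forall i, f i s]).
Proof.
move=> mf; rewrite [X in measurable_fun D X](_ : _ = fun s => \big[andb/true]_(i : I) f i s).
  rewrite unlock; elim: (index_enum I) => [|i r IH] /=; first exact: measurable_cst.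
  by apply: measurable_and.
by apply/funext => s; rewrite big_andE.
Qed.

Lemma measurable_bool_natr {d} {T : measurableType d} (D : set T) (b : T -> bool) :
  measurable_fun D b -> measurable_fun D (fun s => (b s)%:R : R).
Proof.
move=> mb mD; rewrite (_ : (fun s => _) = fun s => if b s then 1 else 0); last first.
  by apply/funext => s; case: (b s).
exact: (measurable_fun_if mD mb (measurable_cst _) (measurable_cst _) mD).
Qed.

Lemma rank_perm_eqE (x : 'cV[R]_N) (p : 'S_N) : (rank_perm x == p) =
  [forall i : 'I_N, forall j : 'I_N, (i <= j)%N ==> (x (p i) ord0 <= x (p j) ord0)] &&
  [forall i : 'I_N, forall j : 'I_N, (i < j)%N && (x (p i) ord0 == x (p j) ord0) ==> (p i < p j)%N].
Proof.
apply/eqP/andP => [<-|[h1 h2]].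
  have [h1 h2] := rank_permP x.
  split; apply/forallP => i; apply/forallP => j; apply/implyP; first exact: h1.
  by move=> /andP[ij /eqP]; exact: h2.
apply/esym/rank_perm_unique; split => i j.
  by move=> ij; have /forallP/(_ i)/forallP/(_ j)/implyP := h1; apply.
move=> ij xij; have /forallP/(_ i)/forallP/(_ j)/implyP := h2; apply.
by rewrite ij xij eqxx.
Qed.

(** There are finitely many permutations, and [rank_perm x == p] is a Boolean combination of
    comparisons of coordinates ([rank_perm_eqE]). *)
Lemma measurable_rank {d} {T : measurableType d} (D : set T) (x : T -> 'cV[R]_N)
    (c : 'S_N -> R) : (forall i, measurable_fun D (fun s => x s i ord0)) ->
  measurable_fun D (fun s => c (rank_perm (x s))).
Proof.
move=> mx.
rewrite [X in measurable_fun D X](_ : _ = fun s => \sum_p c p * (rank_perm (x s) == p)%:R).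
  apply: measurable_sum => p; apply: measurable_funM; first exact: measurable_cst.
  apply: measurable_bool_natr; under eq_fun do rewrite rank_perm_eqE.
  apply: measurable_and; apply: measurable_forall => i; apply: measurable_forall => j.
    case: (i <= j)%N => /=; last exact: measurable_cst.
    exact: measurable_fun_ler.
  case: (i < j)%N => /=; last exact: measurable_cst.
  case: (p i < p j)%N.
    by under eq_fun do rewrite implybT; exact: measurable_cst.
  under eq_fun do rewrite implybF; apply: measurable_neg; exact: measurable_fun_eqr.
apply/funext => s; rewrite (bigD1 (rank_perm (x s)))//= eqxx mulr1 big1 ?addr0// => p.
by rewrite eq_sym => /negbTE ->; rewrite mulr0.
Qed.

Lemma sum_rank (p : 'S_N) (i : 'I_N) (c : 'I_N -> R) :
  \sum_(k < N) (p k == i)%:R * c k = c ((p^-1)%g i).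
Proof.
rewrite (bigD1 ((p^-1)%g i))//= permKV eqxx mul1r big1 ?addr0// => k ki.
case: eqP => [E|]; last by rewrite mul0r.
by move: ki; rewrite -E permK eqxx.
Qed.

Lemma sum_rank_bound (p : 'S_N) (i : 'I_N) (c : 'I_N -> R) :
  `|\sum_(k < N) (p k == i)%:R * c k| <= \sum_(k < N) `|c k|.
Proof.
rewrite sum_rank (bigD1 ((p^-1)%g i))//= lerDl.
exact: sumr_ge0.
Qed.

End measurable_ranks.

Section particles.
Context {R : realType} {d : measure_display} {T : measurableType d}.
Variables (P : probability T R) (F : R -> set_system T).
Hypothesis hF : usual_conditions P F.
Context {N : nat} (g sigma : 'I_N -> R).
Variables (W : 'I_N -> R -> T -> R) (X : R -> T -> 'cV[R]_N).
Hypothesis hX : classical_competing_brownian_particles P F g sigma W X.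

Definition diffusion i t w : R := \sum_(k < N) (rank_perm (X t w) k == i)%:R * sigma k.
Let S := \sum_(k < N) `|sigma k|.
Let Gs := \sum_(k < N) `|g k|.

Lemma drift_bound i w s u : 0 <= s -> s <= u ->
  `|\int[lebesgue_measure]_(r in `[0, u]) (\sum_(k < N) (rank_perm (X r w) k == i)%:R * g k) -
    \int[lebesgue_measure]_(r in `[0, s]) (\sum_(k < N) (rank_perm (X r w) k == i)%:R * g k)| <=
  Gs * (u - s).
Proof.
move=> s0 su.
have mX j : measurable_fun (`[0, u]%classic : set (measurableTypeR R)) (fun r => X r w j ord0).
  have mX0 : measurable_fun (`[0, +oo[%classic : set (measurableTypeR R)) (fun r => X r w j ord0).
    have cX : continuous_paths (fun r w => X r w j ord0) by move=> w0; apply: (cbp_continuous hX).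
    exact: (subspace_continuous_measurable_fun (measurable_itv _) (cX w)).
  apply: (measurable_funS _ _ mX0); first exact: measurable_itv.
  by move=> r /=; rewrite !in_itv/= andbT => /andP[].
have mg : measurable_fun (`[0, u]%classic : set (measurableTypeR R))
    (fun r => \sum_(k < N) (rank_perm (X r w) k == i)%:R * g k).
  exact: (measurable_rank (fun p => \sum_(k < N) (p k == i)%:R * g k) mX).
have fin (A : set (measurableTypeR R)) : measurable A -> A `<=` `[0, u]%classic ->
    (lebesgue_measure A < +oo)%E.
  move=> mA Au; apply: (@le_lt_trans _ _ (lebesgue_measure `[0, u]%classic)).
    by apply: le_measure; rewrite ?inE//; exact: measurable_itv.
  by rewrite lebesgue_measure_itv/=; case: ifP => _; rewrite ltry.
have ig : itg lebesgue_measure `[0, u]%classic (fun r => \sum_(k < N) (rank_perm (X r w) k == i)%:R * g k).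
  have fu := fin `[0, u]%classic (measurable_itv _) (fun _ h => h).
  apply: (itg_bounded _ fu (C := Gs)) => //.
  by move=> r _; exact: sum_rank_bound.
rewrite Rintegral_itvB ?bnd_simp//.
have sub : `]s, u] `<=` `[0, u].
  by move=> r /=; rewrite !in_itv/= => /andP[sr ->]; rewrite (le_trans s0 (ltW sr)).
rewrite -(lebesgue_itvE su) -Rintegral_cst; last exact: measurable_itv.
apply: ler_rint_norm; first exact: measurable_itv.
- apply: (itg_bounded _ (lebesgue_itv_fin s u) (C := Gs)) => //.
    by apply: (measurable_funS _ sub mg); exact: measurable_itv.
  by move=> r _; exact: sum_rank_bound.
- apply: (itg_cst _ (lebesgue_itv_fin s u)); exact: measurable_itv.
by move=> r _; exact: sum_rank_bound.
Qed.

(** The drift enters later arguments through its Lipschitz bound alone, valid for all times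
    simultaneously. *)
Lemma particle_ito i : exists M, bounded_ito P F (W i) (diffusion i) M S /\
  {ae P, forall w, forall s u, 0 <= s -> s <= u ->
    `|X u w i ord0 - X s w i ord0 - (M u w - M s w)| <= Gs * (u - s)}.
Proof.
have [M hM hae] := cbp_sde hX i; exists M; split.
  apply: (bounded_ito_integral hF (cbp_brownian hX i) hM) => x w.
  exact: sum_rank_bound.
apply: filterS hae => w hw s u s0 su; have := drift_bound i w s0 su.
rewrite (hw _ s0) (hw _ (le_trans s0 su)).
set x := Rintegral _ _ _; set y := Rintegral _ _ _; congr (`|_| <= _); ring.
Qed.

End particles.

(** * Scaled differences of two Ito integrals *)

Section differences.
Context {R : realType} {d : measure_display} {T : measurableType d}.
Variables (P : probability T R) (F : R -> set_system T).
Hypothesis hF : usual_conditions P F.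
Local Notation kappa := (gauss_moment (R := R) 2).
Local Notation fmeas := (fmeas F).

Definition scaled_diff (l : R) (M N : R -> T -> R) (u : R) (w : T) : R := l * (M u w - N u w).

Let i_mul s (xi f : T -> R) C : 0 <= s -> fmeas s xi -> (forall w, `|xi w| <= C) ->
  itg P setT f -> itg P setT (fun w => xi w * f w).
Proof.
move=> s0 mxi xiC hf; apply: (itg_mulb measurableT hf (C := C)) => [|w _]; last exact: xiC.
exact: (fmeas_measurable hF s0 mxi).
Qed.

Section one_pair.
Variables (W1 H1 M1 W2 H2 M2 : R -> T -> R) (S l : R).
Hypotheses (I1 : bounded_ito P F W1 H1 M1 S) (I2 : bounded_ito P F W2 H2 M2 S).
Hypothesis h12 : covariation P F 0 W1 W2.
Local Notation M := (scaled_diff l M1 M2).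

(** Rate of the bracket of l (M1 - M2) in excess of kappa; it vanishes where l^2 (H1^2 + H2^2) =
    1. *)
Definition diff_defect (r : R) (w : T) : R :=
  kappa * (l ^+ 2 * (H1 r w * H1 r w + H2 r w * H2 r w) - 1).

Let diffE s u w : M u w - M s w = l * ((M1 u w - M1 s w) - (M2 u w - M2 s w)).
Proof. by rewrite /scaled_diff; ring. Qed.

Lemma scaled_diff_sq s u : 0 <= s -> s <= u ->
  measurable_fun setT (fun w => M u w - M s w) /\ itg P setT (fun w => (M u w - M s w) ^+ 2).
Proof.
move=> s0 su; have [m1 i1] := bito_sq I1 s0 su; have [m2 i2] := bito_sq I2 s0 su.
have E : (fun w => M u w - M s w) = fun w => l * ((M1 u w - M1 s w) + - (M2 u w - M2 s w)).
  by apply/funext => w; exact: diffE.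
split.
  rewrite E; apply: measurable_funM; first exact: measurable_cst.
  by apply: measurable_funD => //; exact: measurableT_comp.
apply: (eq_itg measurableT (f := fun w => l ^+ 2 * ((M1 u w - M1 s w) + - (M2 u w - M2 s w)) ^+ 2)) => //.
  by move=> w _; rewrite diffE exprMn.
apply: itgZ => //; apply: itg_sqrD => //; first exact: measurableT_comp.
by apply: (eq_itg measurableT (f := fun w => (M2 u w - M2 s w) ^+ 2)) => // w _; rewrite sqrrN.
Qed.

Lemma scaled_diff_mean s u xi C : 0 <= s -> s <= u -> fmeas s xi -> (forall w, `|xi w| <= C) ->
  \int[P]_w (xi w * (M u w - M s w)) = 0.
Proof.
move=> s0 su mxi xiC.
have [i1 e1] := ito_mean hF I1 s0 su mxi xiC; have [i2 e2] := ito_mean hF I2 s0 su mxi xiC.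
have j1 := i_mul s0 mxi xiC i1; have j2 := i_mul s0 mxi xiC i2.
transitivity (\int[P]_w (l * (xi w * (M1 u w - M1 s w) - xi w * (M2 u w - M2 s w)))).
  by apply: eq_rint => w _; rewrite diffE; ring.
by rewrite rintZ//; [rewrite rintB// e1 e2 subrr mulr0|exact: itgB].
Qed.

Lemma scaled_diff_moment s u : 0 <= s -> s <= u ->
  \int[P]_w ((M u w - M s w) ^+ 2) <= 4 * l ^+ 2 * kappa * S ^+ 2 * (u - s).
Proof.
move=> s0 su; have [m1 i1] := bito_sq I1 s0 su; have [m2 i2] := bito_sq I2 s0 su.
have [_ i] := scaled_diff_sq s0 su.
apply: (@le_trans _ _ (\int[P]_w (2 * l ^+ 2 * ((M1 u w - M1 s w) ^+ 2 + (M2 u w - M2 s w) ^+ 2)))).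
  apply: ler_rint => //; first by apply: itgZ => //; exact: itgD.
  move=> w _; rewrite diffE exprMn -[leRHS]mulrA [leRHS]mulrCA; apply: ler_wpM2l; first exact: sqr_ge0.
  move: (M1 u w - _) (M2 u w - _) => x y; have := sqr_ge0 (x + y).
  by rewrite sqrrD sqrrB; move: (x ^+ 2) (y ^+ 2) (x * y) => *; lra.
rewrite rintZ//; last exact: itgD.
rewrite rintD//.
have a := ito_second_moment hF I1 s0 su; have b := ito_second_moment hF I2 s0 su.
have l0 : 0 <= 2 * l ^+ 2 by rewrite mulr_ge0// sqr_ge0.
apply: le_trans (ler_wpM2l l0 (lerD a b)) _.
by rewrite le_eqVlt; apply/orP; left; apply/eqP; ring.
Qed.

Lemma diff_defect_jmeas s u : 0 <= s -> jmeas s u diff_defect.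
Proof.
move=> s0; have j1 : jmeas s u H1 := bito_jmeas I1 s0; have j2 : jmeas s u H2 := bito_jmeas I2 s0.
apply: measurable_funM; first exact: measurable_cst.
apply: measurable_funB; last exact: measurable_cst.
apply: measurable_funM; first exact: measurable_cst.
by apply: measurable_funD; apply: measurable_funM.
Qed.

Lemma diff_defect_bound r w : `|diff_defect r w| <= kappa * (l ^+ 2 * (S ^+ 2 + S ^+ 2) + 1).
Proof.
have k0 : 0 <= kappa by exact/ltW/gauss_moment2_gt0.
have sq x : `|x| <= S -> `|x * x| <= S ^+ 2 by move=> hx; rewrite normrM expr2 ler_pM.
rewrite /diff_defect normrM ger0_norm// ler_wpM2l//.
apply: le_trans (ler_normB _ _) _; rewrite normr1 lerD2r normrM ger0_norm ?sqr_ge0//.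
rewrite ler_wpM2l ?sqr_ge0//; apply: le_trans (ler_normD _ _) _.
by apply: lerD; apply: sq; [exact: (bito_bound I1)|exact: (bito_bound I2)].
Qed.

Lemma scaled_diff_var s u xi C : 0 <= s -> s <= u -> fmeas s xi -> (forall w, `|xi w| <= C) ->
  \int[P]_w (xi w * (M u w - M s w) ^+ 2) =
  kappa * (u - s) * \int[P]_w xi w + \int[P]_w (xi w * tint s u diff_defect w).
Proof.
move=> s0 su mxi xiC.
have [m1 i1] := bito_sq I1 s0 su; have [m2 i2] := bito_sq I2 s0 su.
have i12 := itg_mul_sq measurableT m1 m2 i1 i2.
have j1 := i_mul s0 mxi xiC (itg_mul_sq measurableT m1 m1 i1 i1).
have j2 := i_mul s0 mxi xiC (itg_mul_sq measurableT m2 m2 i2 i2).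
have j12 := i_mul s0 mxi xiC i12.
have c1 := ito_covariation hF I1 I1 s0 su mxi xiC (covariation_brownian hF (bito_brownian I1)).
have c2 := ito_covariation hF I2 I2 s0 su mxi xiC (covariation_brownian hF (bito_brownian I2)).
have c12 := ito_covariation hF I1 I2 s0 su mxi xiC h12.
have jH1 : jmeas s u H1 := bito_jmeas I1 s0; have jH2 : jmeas s u H2 := bito_jmeas I2 s0.
have sq (H : R -> T -> R) : (forall x w, `|H x w| <= S) -> forall x w, `|H x w * H x w| <= S ^+ 2.
  by move=> hH x w; rewrite normrM expr2 ler_pM.
have b1 := sq _ (bito_bound I1); have b2 := sq _ (bito_bound I2).
have mH1 := jmeasM jH1 jH1; have mH2 := jmeasM jH2 jH2.
have t1 := i_mul s0 mxi xiC (itg_tint P su mH1 b1).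
have t2 := i_mul s0 mxi xiC (itg_tint P su mH2 b2).
have ixi := itg_fmeas_bounded hF s0 mxi xiC.
have lhs : \int[P]_w (xi w * (M u w - M s w) ^+ 2) = l ^+ 2 *
   (kappa * \int[P]_w (xi w * tint s u (fun x w => H1 x w * H1 x w) w) +
    kappa * \int[P]_w (xi w * tint s u (fun x w => H2 x w * H2 x w) w)).
  transitivity (\int[P]_w (l ^+ 2 * ((xi w * ((M1 u w - M1 s w) * (M1 u w - M1 s w)) +
    xi w * ((M2 u w - M2 s w) * (M2 u w - M2 s w))) - 2 * (xi w * ((M1 u w - M1 s w) * (M2 u w - M2 s w)))))).
    by apply: eq_rint => w _; rewrite diffE; move: (M1 u w - _) (M2 u w - _) => x y; ring.
  have j := itgD measurableT j1 j2; have j' := itgZ measurableT 2 j12.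
  rewrite rintZ//; last exact: itgB.
  by rewrite rintB// rintD// rintZ// c1 c2 c12 mul0r mulr0 subr0.
have tE w : tint s u diff_defect w = kappa * l ^+ 2 * (tint s u (fun x w => H1 x w * H1 x w) w +
    tint s u (fun x w => H2 x w * H2 x w) w) - kappa * (u - s).
  have k1 := itg_section mH1 b1 w; have k2 := itg_section mH2 b2 w.
  have mI : measurable (`]s, u]%classic : set (measurableTypeR R)) by exact: measurable_itv.
  have kc := itg_cst mI (lebesgue_itv_fin s u) kappa.
  rewrite /tint -rintD// -rintZ//; last exact: itgD.
  rewrite -(lebesgue_itvE su) -Rintegral_cst// -rintB//; last by apply: itgZ => //; exact: itgD.
  by apply: eq_rint => x _; rewrite /diff_defect; ring.
rewrite lhs.
transitivity (kappa * (u - s) * \int[P]_w xi w + \int[P]_w (kappa * l ^+ 2 *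
   (xi w * tint s u (fun x w => H1 x w * H1 x w) w + xi w * tint s u (fun x w => H2 x w * H2 x w) w) -
   kappa * (u - s) * xi w)); last first.
  by congr (_ + _); apply: eq_rint => w _; rewrite tE; ring.
have tt := itgD measurableT t1 t2.
rewrite rintB//; [|exact: itgZ|exact: itgZ].
rewrite (rintZ measurableT _ tt) (rintD measurableT t1 t2) (rintZ measurableT _ ixi); ring.
Qed.

Lemma scaled_diff_small q t : 0 <= q -> q <= t -> small_variation P M q t.
Proof.
move=> q0 qt; apply: small_variationB => //.
- exact: (bito_sq I1).
- exact: (bito_sq I2).
- exact: (ito_small_variation hF I1).
- exact: (ito_small_variation hF I2).
Qed.

End one_pair.

(** Bilinear expansion into four pairs, each with one process from the first difference and one from
    the second; all four have covariation 0. *)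
Lemma scaled_diff_cross Wa Ha Ma Wb Hb Mb Wc Hc Mc Wd Hd Md S l1 l2 :
  bounded_ito P F Wa Ha Ma S -> bounded_ito P F Wb Hb Mb S ->
  bounded_ito P F Wc Hc Mc S -> bounded_ito P F Wd Hd Md S ->
  covariation P F 0 Wa Wc -> covariation P F 0 Wa Wd ->
  covariation P F 0 Wb Wc -> covariation P F 0 Wb Wd ->
  forall s u xi C, 0 <= s -> s <= u -> fmeas s xi -> (forall w, `|xi w| <= C) ->
  \int[P]_w (xi w * ((scaled_diff l1 Ma Mb u w - scaled_diff l1 Ma Mb s w) *
                     (scaled_diff l2 Mc Md u w - scaled_diff l2 Mc Md s w))) = 0.
Proof.
move=> Ia Ib Ic Id ac ad bc bd s u xi C s0 su mxi xiC.
have cross W1 H1 M1 W2 H2 M2 : bounded_ito P F W1 H1 M1 S -> bounded_ito P F W2 H2 M2 S ->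
    covariation P F 0 W1 W2 ->
    itg P setT (fun w => xi w * ((M1 u w - M1 s w) * (M2 u w - M2 s w))) /\
    \int[P]_w (xi w * ((M1 u w - M1 s w) * (M2 u w - M2 s w))) = 0.
  move=> I1 I2 h12; split.
    have [m1 i1] := bito_sq I1 s0 su; have [m2 i2] := bito_sq I2 s0 su.
    exact: (i_mul s0 mxi xiC (itg_mul_sq measurableT m1 m2 i1 i2)).
  by rewrite (ito_covariation hF I1 I2 s0 su mxi xiC h12) mul0r.
have [jac eac] := cross _ _ _ _ _ _ Ia Ic ac; have [jad ead] := cross _ _ _ _ _ _ Ia Id ad.
have [jbc ebc] := cross _ _ _ _ _ _ Ib Ic bc; have [jbd ebd] := cross _ _ _ _ _ _ Ib Id bd.
transitivity (\int[P]_w (l1 * l2 * ((xi w * ((Ma u w - Ma s w) * (Mc u w - Mc s w)) +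
    xi w * ((Mb u w - Mb s w) * (Md u w - Md s w))) -
    (xi w * ((Ma u w - Ma s w) * (Md u w - Md s w)) +
    xi w * ((Mb u w - Mb s w) * (Mc u w - Mc s w)))))).
  apply: eq_rint => w _; rewrite /scaled_diff.
  by move: (Ma u w) (Ma s w) (Mb u w) (Mb s w) (Mc u w) (Mc s w) (Md u w) (Md s w) => *; ring.
have j1 := itgD measurableT jac jbd; have j2 := itgD measurableT jad jbc.
rewrite rintZ//; last exact: itgB.
by rewrite rintB// rintD// rintD// eac ead ebc ebd addr0 subrr mulr0.
Qed.

End differences.

(** Uniform continuity from the compactness of [q, t], in the near-covering form along small
    positive h. Only [s] is confined to [q, t]. *)
Lemma continuous_paths_unif {R : realType} {d : measure_display} {T : measurableType d}
    (X : R -> T -> R) w q t e : continuous_paths X -> 0 <= q -> 0 < e ->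
  exists2 h, 0 < h & forall s r, q <= s -> s <= t -> 0 <= r -> `|s - r| <= h ->
    `|X s w - X r w| < e.
Proof.
move=> cX q0 e0; have e2 : 0 < e / 2 by rewrite divr_gt0.
have cK : compact `[q, t]%classic by exact: segment_compact.
have := (compact_near_coveringP _).1 cK R (at_right (0 : R))
  (fun h s => forall r, 0 <= r -> `|s - r| <= h -> 0 <= s -> `|X s w - X r w| < e) _.
case.
  move=> x /=; rewrite in_itv/= => /andP[qx xt].
  have [h h0 hX] := continuous_paths_near w cX (le_trans q0 qx) e2.
  have h2 : 0 < h / 2 by rewrite divr_gt0.
  exists (ball x (h / 2), [set k | 0 < k < h / 2]) => /=.
    split; first exact: nbhsx_ballx.
    near=> k => /=; apply/andP; split; near: k; [exact: nbhs_right_gt|exact: nbhs_right_lt].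
  move=> [s k] /= [xs /andP[k0 kh]] r r0 sr s0.
  have xs' : `|x - s| < h by apply: lt_le_trans xs _; lra.
  have xr : `|x - r| < h.
    rewrite (_ : x - r = (x - s) + (s - r)); last by ring.
    by apply: le_lt_trans (ler_normD _ _) _; move: xs sr; rewrite /ball/=; lra.
  rewrite (_ : X s w - X r w = (X x w - X r w) - (X x w - X s w)); last by ring.
  apply: le_lt_trans (ler_normB _ _) _.
  by have := hX _ s0 xs'; have := hX _ r0 xr; lra.
move=> h /= h0 hX; exists (h / 2); first by rewrite divr_gt0.
move=> s r qs st r0 sr; have h2 : 0 < h / 2 by rewrite divr_gt0.
apply: (hX (h / 2) _ h2 s _ r) => //=; last exact: le_trans qs.
  by rewrite /ball/= sub0r normrN ger0_norm ?ltW// ltr_pdivrMr// ltr_pMr// ltr1n.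
by rewrite in_itv/= qs.
Unshelve. all: by end_near. Qed.

(** * Two pairs of particles while the others keep apart *)

Section separated_region.
Context {R : realType} {d : measure_display} {T : measurableType d}.
Variables (P : probability T R) (F : R -> set_system T).
Hypothesis hF : usual_conditions P F.
Context {N : nat} (g sigma : 'I_N -> R).
Variables (W : 'I_N -> R -> T -> R) (X : R -> T -> 'cV[R]_N).
Hypothesis hX : classical_competing_brownian_particles P F g sigma W X.
Local Notation kappa := (gauss_moment (R := R) 2).

Definition coord (i : 'I_N) (s : R) (w : T) : R := X s w i ord0.

(** [e] is a set of strict inequalities between coordinates. A margin [delta] > 0 is imposed at grid
    points so that the bare inequalities, [delta] = 0, persist for a while after them. *)
Definition separated (e : 'I_N -> 'I_N -> bool) (delta : R) (x : 'cV[R]_N) : bool :=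
  [forall i : 'I_N, forall j : 'I_N, e i j ==> (x i ord0 + delta < x j ord0)].

Let S := \sum_(k < N) `|sigma k|.
Let Gs := \sum_(k < N) `|g k|.
Let Gs0 : 0 <= Gs. Proof. exact: sumr_ge0. Qed.

Let cX i : continuous_paths (coord i).
Proof. by move=> w; apply: (cbp_continuous hX). Qed.

Let aX i : adapted F (coord i).
Proof. exact: (cbp_adapted hX i). Qed.

Lemma scaled_diff_continuous l i j : continuous_paths (scaled_diff l (coord i) (coord j)).
Proof.
move=> w; apply/subspace_continuousP => x x0.
have /subspace_continuousP/(_ x x0) ci := @cX i w; have /subspace_continuousP/(_ x x0) cj := @cX j w.
by apply: cvgM; [exact: cvg_cst|exact: cvgB].
Qed.

Lemma scaled_diff_adapted l i j : adapted F (scaled_diff l (coord i) (coord j)).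
Proof.
move=> s s0; apply/(fmeasP hF _ s0); apply: measurable_funM; first exact: measurable_cst.
by apply: measurable_funB; exact: (fmeas_adapted hF (aX _) s0).
Qed.

Lemma separated_measurable e delta s : 0 <= s -> F s [set w | separated e delta (X s w)].
Proof.
move=> s0; have sF := sigma_algebra_id (filtration_sigma_algebra hF s0).
have : @measurable _ (g_sigma_algebraType (F s)) [set w | separated e delta (X s w)].
  have m : measurable_fun setT ((fun w => separated e delta (X s w)) : g_sigma_algebraType (F s) -> bool).
    apply: measurable_forall => i; apply: measurable_forall => j.
    case: (e i j) => /=; last exact: measurable_cst.
    apply: measurable_fun_ltr; last exact: (fmeas_adapted hF (aX j) s0).
    by apply: measurable_funD; [exact: (fmeas_adapted hF (aX i) s0)|exact: measurable_cst].
  by have := m measurableT [set true]; rewrite setTI; apply.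
by rewrite -[X in X _ -> _]/(<<s F s>>) sF.
Qed.

Lemma separated_near e delta q t w : 0 <= q -> 0 < delta ->
  exists2 h, 0 < h & forall s r, q <= s -> s <= r -> r <= t -> r - s <= h ->
    separated e delta (X s w) -> separated e 0 (X r w).
Proof.
move=> q0 delta0; have d2 : 0 < delta / 2 by rewrite divr_gt0.
have hX' i := continuous_paths_unif w t (@cX i) q0 d2.
pose h i := sval (cid2 (hX' i)).
have hh i : 0 < h i by rewrite /h; case: cid2.
have hc i s r : q <= s -> s <= t -> 0 <= r -> `|s - r| <= h i -> `|coord i s w - coord i r w| < delta / 2.
  by rewrite /h; case: cid2 => /= k k0 hk; exact: hk.
exists (\big[Num.min/1]_(i < N) h i).
  by elim/big_ind: _ => // x y x0 y0; rewrite lt_min x0.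
move=> s r qs sr rt rs /forallP sep; apply/forallP => i; apply/forallP => j; apply/implyP => eij.
have /forallP/(_ j)/implyP/(_ eij) sij := sep i.
have le k : `|s - r| <= h k.
  by rewrite distrC ger0_norm ?subr_ge0//; apply: le_trans rs _; apply: bigmin_le_cond.
have r0 : 0 <= r by apply: le_trans sr; exact: le_trans qs.
have st := le_trans sr rt.
have := hc i s r qs st r0 (le i); have := hc j s r qs st r0 (le j).
by rewrite /coord !ltr_norml => /andP[? ?] /andP[? ?]; lra.
Qed.

Section two_pairs.
Variables (a b c c' : 'I_N) (l1 l2 : R).
Hypotheses (ab : a != b) (cc : c != c') (ac : a != c) (ac' : a != c') (bc : b != c) (bc' : b != c').
Hypotheses (l10 : 0 <= l1) (l20 : 0 <= l2).

Let D1 := scaled_diff l1 (coord a) (coord b).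
Let D2 := scaled_diff l2 (coord c) (coord c').
Let V1 := diff_defect (diffusion sigma X a) (diffusion sigma X b) l1.
Let V2 := diff_defect (diffusion sigma X c) (diffusion sigma X c') l2.

(** The constants of the two differences are added so that one set of bounds serves both
    coordinates. The four particles being distinct, their Brownian motions have covariation 0 two by
    two. *)
Lemma two_pairs_planar q t : 0 <= q -> q < t ->
  exists M1 M2 B c2 CV, planar_process P F D1 D2 M1 M2 V1 V2 B kappa c2 CV q t.
Proof.
move=> q0 qt; have /choice[M hM] := particle_ito hF hX.
have I i : bounded_ito P F (W i) (diffusion sigma X i) (M i) S := (hM i).1.
have k0 := @gauss_moment2_gt0 R.
have cov i j : i != j -> covariation P F 0 (W i) (W j).
  move=> ij; apply: (covariation_independent hF (cbp_brownian hX i) (cbp_brownian hX j)).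
  exact: (independent_processes_pair (cbp_independent hX) ij).
pose cv l := kappa * (l ^+ 2 * (S ^+ 2 + S ^+ 2) + 1).
have cv0 l : 0 <= cv l.
  apply: mulr_ge0; first exact: ltW.
  by rewrite addr_ge0// mulr_ge0 ?sqr_ge0// addr_ge0 ?sqr_ge0.
pose mo l := 4 * l ^+ 2 * kappa * S ^+ 2.
have mo0 l : 0 <= mo l.
  by apply: mulr_ge0 (sqr_ge0 _); apply: mulr_ge0 (ltW k0); rewrite mulr_ge0// sqr_ge0.
exists (scaled_diff l1 (M a) (M b)), (scaled_diff l2 (M c) (M c')).
exists ((l1 + l2) * (Gs + Gs)), (mo l1 + mo l2), (cv l1 + cv l2).
split => //.
- by rewrite mulr_ge0// addr_ge0.
- by rewrite addr_ge0.
- exact: scaled_diff_adapted.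
- exact: scaled_diff_adapted.
- exact: (scaled_diff_sq _ (I a) (I b)).
- exact: (scaled_diff_sq _ (I c) (I c')).
- exact: (scaled_diff_mean hF _ (I a) (I b)).
- exact: (scaled_diff_mean hF _ (I c) (I c')).
- move=> s u s0 su; apply: le_trans (scaled_diff_moment hF _ (I a) (I b) s0 su) _.
  by rewrite ler_wpM2r ?subr_ge0// lerDl.
- move=> s u s0 su; apply: le_trans (scaled_diff_moment hF _ (I c) (I c') s0 su) _.
  by rewrite ler_wpM2r ?subr_ge0// lerDr.
- by apply: (scaled_diff_cross hF _ _ (I a) (I b) (I c) (I c')); exact: cov.
- exact: (scaled_diff_var hF _ (I a) (I b) (cov _ _ ab)).
- exact: (scaled_diff_var hF _ (I c) (I c') (cov _ _ cc)).
- by move=> s u s0; exact: (diff_defect_jmeas _ (I a) (I b)).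
- by move=> s u s0; exact: (diff_defect_jmeas _ (I c) (I c')).
- by move=> s w; apply: le_trans (diff_defect_bound _ (I a) (I b) s w) _; rewrite lerDl.
- by move=> s w; apply: le_trans (diff_defect_bound _ (I c) (I c') s w) _; rewrite lerDr.
- exact: (scaled_diff_small hF _ (I a) (I b) q0 (ltW qt)).
- exact: (scaled_diff_small hF _ (I c) (I c') q0 (ltW qt)).
have dr l i j : 0 <= l -> {ae P, forall w, forall s u, q <= s -> s <= u ->
    `|scaled_diff l (coord i) (coord j) u w - scaled_diff l (coord i) (coord j) s w -
      (scaled_diff l (M i) (M j) u w - scaled_diff l (M i) (M j) s w)| <= l * (Gs + Gs) * (u - s)}.
  move=> l0; apply: filterS2 (hM i).2 (hM j).2 => w hi hj s u qs su.
  have s0 := le_trans q0 qs; have hi' := hi s u s0 su; have hj' := hj s u s0 su.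
  rewrite (_ : _ - _ - (_ - _) = l * ((coord i u w - coord i s w - (M i u w - M i s w)) -
    (coord j u w - coord j s w - (M j u w - M j s w)))); last by rewrite /scaled_diff; ring.
  rewrite normrM ger0_norm// -mulrA; apply: ler_wpM2l => //.
  by apply: le_trans (ler_normB _ _) _; rewrite mulrDl lerD.
apply: filterS2 (dr l1 a b l10) (dr l2 c c' l20) => w h1 h2 s u qs su; split.
  apply: le_trans (h1 s u qs su) _; rewrite ler_wpM2r ?subr_ge0// ler_wpM2r ?addr_ge0//.
  by rewrite lerDl.
apply: le_trans (h2 s u qs su) _; rewrite ler_wpM2r ?subr_ge0// ler_wpM2r ?addr_ge0//.
by rewrite lerDr.
Qed.

Variables (e : 'I_N -> 'I_N -> bool) (delta : R).
Hypothesis delta0 : 0 < delta.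
Hypothesis h1 : forall x, separated e 0 x ->
  l1 ^+ 2 * (sigma ((rank_perm x)^-1%g a) ^+ 2 + sigma ((rank_perm x)^-1%g b) ^+ 2) = 1.
Hypothesis h2 : forall x, separated e 0 x ->
  l2 ^+ 2 * (sigma ((rank_perm x)^-1%g c) ^+ 2 + sigma ((rank_perm x)^-1%g c') ^+ 2) = 1.

Local Notation good := (fun s => [set w | separated e delta (X s w)]).

Let defect0 q t w : 0 <= q -> exists2 h0, 0 < h0 & forall s r, q <= s -> s <= r -> r <= t ->
  r - s <= h0 -> good s w -> V1 r w = 0 /\ V2 r w = 0.
Proof.
move=> q0; have [h h0 hs] := separated_near e t w q0 delta0.
exists h => // s r qs sr rt rs /(hs _ _ qs sr rt rs) sep.
split; rewrite /V1 /V2 /diff_defect /diffusion !sum_rank -!expr2.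
  by rewrite h1// subrr mulr0.
by rewrite h2// subrr mulr0.
Qed.

Lemma two_pairs_hit q t r : 0 <= q -> q < t -> 0 < r -> P.-negligible (hit_set D1 D2 q t good r).
Proof.
move=> q0 qt r0; have [M1 [M2 [B [c2 [CV pp]]]]] := two_pairs_planar q0 qt.
apply: (hit_set_negligible hF pp) => //.
- exact: scaled_diff_continuous.
- exact: scaled_diff_continuous.
- by move=> s s0; exact: separated_measurable.
- by move=> w; exact: defect0.
Qed.

Lemma two_pairs_zero q t : 0 <= q -> q < t -> P.-negligible (zero_set D1 D2 q t good).
Proof.
move=> q0 qt; have [M1 [M2 [B [c2 [CV pp]]]]] := two_pairs_planar q0 qt.
apply: (zero_set_negligible hF pp).
- by move=> s s0; exact: separated_measurable.
- by move=> w; exact: defect0.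
Qed.

End two_pairs.
End separated_region.

(** * Ranks near a collision *)

Section collisions.
Context {R : realType} {N : nat}.
Implicit Types (x : 'cV[R]_N).

Lemma rank_lt x (i j : 'I_N) : x i ord0 < x j ord0 ->
  ((rank_perm x)^-1%g i < (rank_perm x)^-1%g j)%N.
Proof.
move=> xij; rewrite ltnNge; apply/negP => ji; have [h _] := rank_permP x.
by have := h _ _ ji; rewrite !permKV leNgt xij.
Qed.

Lemma card_ord_lt (n : nat) : (n <= N)%N -> #|[set r : 'I_N | (r < n)%N]%SET| = n.
Proof. by move=> nN; rewrite -sum1dep_card (big_ord_narrow nN) sum_nat_const card_ord muln1. Qed.

Lemma ranked_le x (i j : 'I_N) : (i <= j)%N -> ranked x i <= ranked x j.
Proof. by case: (rank_permP x) => h _; exact: h. Qed.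

Section pair.
Variables (y x : 'cV[R]_N) (k k' : 'I_N).
Hypotheses (kk' : k' = k.+1 :> nat) (eqk : ranked y k = ranked y k').
Hypothesis no_triple : ~ triple_collision y.
Hypothesis sep : forall i j, y i ord0 < y j ord0 -> x i ord0 < x j ord0.

Let below (m : 'I_N) : (m < k)%N -> ranked y m < ranked y k.
Proof.
move=> mk; rewrite lt_neqAle (ranked_le y (ltnW mk)) andbT; apply/eqP => mE.
have k0 : (0 < k)%N by exact: leq_ltn_trans mk.
have pk : (k.-1 < N)%N by apply: leq_ltn_trans (ltn_ord k); exact: leq_pred.
apply: no_triple; exists (Ordinal pk), k, k'; split => //=; first by rewrite prednK.
apply/eqP; rewrite eq_le ranked_le ?leq_pred//= -mE ranked_le//=.
by rewrite -ltnS prednK.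
Qed.

Let above (m : 'I_N) : (k' < m)%N -> ranked y k < ranked y m.
Proof.
move=> km; rewrite eqk lt_neqAle (ranked_le y (ltnW km)) andbT; apply/eqP => mE.
have pk : (k'.+1 < N)%N by exact: leq_ltn_trans km (ltn_ord m).
apply: no_triple; exists k, k', (Ordinal pk); split => //=.
by apply/eqP; rewrite eq_le ranked_le ?leqnSn//= mE ranked_le//=.
Qed.

(** A count: in y, the k particles of lower rank than k are strictly below i, for lack of a triple
    collision, and remain so in x; hence i has rank at least k in x. The particles ranked above k'
    give the other bound in the same way. *)
Let rank_between i : y i ord0 = ranked y k ->
  (k <= (rank_perm x)^-1%g i)%N && ((rank_perm x)^-1%g i <= k')%N.
Proof.
move=> yi; set p := rank_perm x; set q := rank_perm y; set r := (p^-1)%g i.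
have finj : injective (fun m : 'I_N => (p^-1)%g (q m)).
  by move=> m m' /perm_inj/perm_inj.
apply/andP; split.
  have -> : (k : nat) = #|(fun m : 'I_N => (p^-1)%g (q m)) @: [set m : 'I_N | (m < k)%N]%SET|.
    by rewrite card_imset// card_ord_lt// ltnW.
  rewrite -[leqRHS]card_ord_lt; last exact/ltnW/ltn_ord.
  apply: subset_leq_card; apply/fintype.subsetP => _ /imsetP[m + ->]; rewrite !inE => mk.
  by apply: rank_lt; apply: sep; rewrite yi; exact: below.
have cK (n : 'I_N) : #|[set m : 'I_N | (n < m)%N]%SET| = (N - n.+1)%N.
  have -> : [set m : 'I_N | (n < m)%N]%SET = (~: [set m : 'I_N | (m < n.+1)%N])%SET.
    by apply/finset.setP => m; rewrite !inE ltnS -ltnNge.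
  by rewrite cardsCs finset.setCK card_ord_lt// card_ord.
have : (N - k'.+1 <= N - r.+1)%N.
  rewrite -!cK -(card_imset _ finj).
  apply: subset_leq_card; apply/fintype.subsetP => _ /imsetP[m + ->]; rewrite !inE => mk.
  by apply: rank_lt; apply: sep; rewrite yi; exact: above.
by have := ltn_ord r; have := ltn_ord k'; lia.
Qed.

(** The two particles have distinct ranks in {k, k'}, in an unknown order; a sum over the pair does
    not see the order, which is why the bracket of the difference is constant. *)
Lemma pair_rank_sum (c : 'I_N -> R) :
  c ((rank_perm x)^-1%g (rank_perm y k)) + c ((rank_perm x)^-1%g (rank_perm y k')) = c k + c k'.
Proof.
have ra := rank_between (erefl : y (rank_perm y k) ord0 = ranked y k).
have rb := rank_between (esym eqk : y (rank_perm y k') ord0 = ranked y k).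
have ne : (rank_perm x)^-1%g (rank_perm y k) <> (rank_perm x)^-1%g (rank_perm y k').
  by move=> /perm_inj/perm_inj kE; move: kk'; rewrite -kE; lia.
move: ra rb ne; set r := fun_of_perm _ _; set r' := fun_of_perm _ _; rewrite kk'.
move=> /andP[r1 r2] /andP[r3 r4] ne.
have {}ne : r <> r' :> nat by move=> /val_inj.
have [rk|rk] := eqVneq (r : nat) k.
  have -> : r = k by exact: val_inj.
  by have -> : r' = k' by apply: val_inj => /=; lia.
have -> : r = k' by apply: val_inj => /=; move/eqP: rk; lia.
have -> : r' = k by apply: val_inj => /=; move/eqP: rk; lia.
by rewrite addrC.
Qed.

End pair.
End collisions.

Lemma ae_forall_countable {R : realType} {d : measure_display} {T : measurableType d}
    (P : probability T R) (I : countType) (Q : I -> T -> Prop) :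
  (forall i, {ae P, forall w, Q i w}) -> {ae P, forall w, forall i, Q i w}.
Proof.
move=> h; have : {ae P, forall w, forall n, if unpickle n is Some i then Q i w else True}.
  apply: ae_foralln => n; case: unpickle => [i|]; first exact: h.
  by apply: aeW.
by apply: filterS => w hw i; have := hw (pickle i); rewrite pickleK.
Qed.

Lemma inv_succ_lt {R : realType} (x : R) : 0 < x -> exists m : nat, m.+1%:R^-1 < x.
Proof.
move=> x0; exists (Num.bound x^-1).
rewrite -[ltRHS]invrK ltf_pV2 ?posrE ?invr_gt0 ?ltr0n//.
by apply: (lt_trans (archi_boundP _)); rewrite ?invr_ge0 ?ltr_nat// ltW.
Qed.

(** * Exclusion of simultaneous collisions *)

Section simultaneous_collisions.
Context {R : realType} {d : measure_display} {T : measurableType d}.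
Variables (P : probability T R) (F : R -> set_system T).
Hypothesis hF : usual_conditions P F.
Context {N : nat} (g sigma : 'I_N -> R).
Hypothesis hsigma : forall k, 0 < sigma k.
Variables (W : 'I_N -> R -> T -> R) (X : R -> T -> 'cV[R]_N).
Hypothesis hX : classical_competing_brownian_particles P F g sigma W X.

Definition pair_scale (k k' : 'I_N) : R := (Num.sqrt (sigma k ^+ 2 + sigma k' ^+ 2))^-1.

Let scale_ge0 k k' : 0 <= pair_scale k k'.
Proof. by rewrite invr_ge0 sqrtr_ge0. Qed.

Let scaleK k k' : pair_scale k k' ^+ 2 * (sigma k ^+ 2 + sigma k' ^+ 2) = 1.
Proof.
have s0 : 0 < sigma k ^+ 2 + sigma k' ^+ 2 by rewrite addr_gt0// exprn_gt0.
by rewrite exprVn sqr_sqrtr ?ltW// mulVf// gt_eqF.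
Qed.

Definition diff_process (a b k k' : 'I_N) := scaled_diff (pair_scale k k') (coord X a) (coord X b).

(** The normalization under which the bracket defect vanishes, required on the whole open cone cut
    out by [e]. *)
Definition admissible (e : 'I_N -> 'I_N -> bool) (a b k k' : 'I_N) : Prop :=
  forall x : 'cV[R]_N, separated e 0 x -> pair_scale k k' ^+ 2 *
    (sigma ((rank_perm x)^-1%g a) ^+ 2 + sigma ((rank_perm x)^-1%g b) ^+ 2) = 1.

(** The conditions on the data are premises of the statement, so that it can be asserted for all
    data at once by countable intersection. *)
Definition no_approach (e : 'I_N -> 'I_N -> bool) (a b c c' k k' l l' : 'I_N) (q t : R) (m r : nat) w : Prop :=
  uniq [:: a; b; c; c'] -> 0 <= q -> q < t -> admissible e a b k k' -> admissible e c c' l l' ->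
  ~ hit_set (diff_process a b k k') (diff_process c c' l l') q t
      (fun s => [set w | separated e m.+1%:R^-1 (X s w)]) r.+1%:R^-1 w /\
  ~ zero_set (diff_process a b k k') (diff_process c c' l l') q t
      (fun s => [set w | separated e m.+1%:R^-1 (X s w)]) w.

Let ae_of_negligible (A : set T) : P.-negligible A -> {ae P, forall w, ~ A w}.
Proof. by move=> [B [mB PB AB]]; exists B; split=> // w /contrapT; exact: AB. Qed.

(** The relation [e] is a finite function here, which makes its type countable. *)
Lemma no_approach_ae : {ae P, forall w, forall (e : {ffun 'I_N -> {ffun 'I_N -> bool}})
  (a b c c' k k' l l' : 'I_N) (q t : rat) (m r : nat),
  no_approach (fun i j => e i j) a b c c' k k' l l' (ratr q) (ratr t) m r w}.
Proof.
apply: ae_forall_countable => e; apply: ae_forall_countable => a.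
apply: ae_forall_countable => b; apply: ae_forall_countable => c.
apply: ae_forall_countable => c'; apply: ae_forall_countable => k.
apply: ae_forall_countable => k'; apply: ae_forall_countable => l.
apply: ae_forall_countable => l'; apply: ae_forall_countable => q.
apply: ae_forall_countable => t; apply: ae_forall_countable => m.
apply: ae_forall_countable => r; rewrite /no_approach.
have [u|_] := boolP (uniq [:: a; b; c; c']); last by apply: aeW => w [].
have [q0|_] := boolP (0 <= (ratr q : R)); last by apply: aeW => w _.
have [qt|_] := boolP ((ratr q : R) < ratr t); last by apply: aeW => w _ _.
have [h1|h1] := pselect (admissible (fun i j => e i j) a b k k'); last by apply: aeW => w _ _ _ h; case: (h1 h).
have [h2|h2] := pselect (admissible (fun i j => e i j) c c' l l'); last by apply: aeW => w _ _ _ _ h; case: (h2 h).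
move: u; rewrite /= !inE !negb_or -!andbA andbT => /and4P[ab ac ac' /and3P[bc bc' cc']].
have i0 n : 0 < n.+1%:R^-1 :> R by rewrite invr_gt0 ltr0n.
have hit := two_pairs_hit hF hX ab cc' ac ac' bc bc' (scale_ge0 k k') (scale_ge0 l l')
  (i0 m) h1 h2 q0 qt (i0 r).
have zero := two_pairs_zero hF hX ab cc' ac ac' bc bc' (scale_ge0 k k') (scale_ge0 l l')
  (i0 m) h1 h2 q0 qt.
by apply: filterS2 (ae_of_negligible hit) (ae_of_negligible zero) => w hw zw _ _ _ _ _.
Qed.

Let cX i : continuous_paths (coord X i).
Proof. by move=> w; apply: (cbp_continuous hX). Qed.

Let cD a b k k' : continuous_paths (diff_process a b k k').
Proof. exact: (scaled_diff_continuous hX). Qed.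

Let nonzero_near (Y : R -> T -> R) w s : continuous_paths Y -> 0 <= s -> Y s w != 0 ->
  exists2 h, 0 < h & forall v, 0 <= v -> `|s - v| < h -> Y v w != 0.
Proof.
move=> cY s0 ys; have y0 : 0 < `|Y s w| by rewrite normr_gt0.
have [h h0 hY] := continuous_paths_near w cY s0 y0.
exists h => // v v0 sv; apply/eqP => yv; have := hY v v0 sv.
by rewrite yv subr0 ltxx.
Qed.

Lemma no_simultaneous_collision w : (forall (e : {ffun 'I_N -> {ffun 'I_N -> bool}})
  (a b c c' k k' l l' : 'I_N) (q t : rat) (m r : nat),
  no_approach (fun i j => e i j) a b c c' k k' l l' (ratr q) (ratr t) m r w) ->
  (forall t, 0 < t -> ~ triple_collision (X t w)) ->
  forall t, 0 < t -> ~ simultaneous_collision (X t w).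
Proof.
move=> hw ht t t0 [k [k' [l [l' [kk' ll' kl ek el]]]]].
have nt := ht t t0; set y := X t w in ek el nt.
(* Two colliding pairs of ranks that share a rank would form a triple collision. *)
have kl' : k' <> l by move=> E; apply: nt; exists k, k', l'; split=> //; rewrite E.
have lk' : l' <> k by move=> E; apply: nt; exists l, l', k'; split=> //; rewrite E.
pose p := rank_perm y.
pose e : {ffun 'I_N -> {ffun 'I_N -> bool}} := [ffun i => [ffun j => y i ord0 < y j ord0]].
have sepE (x : 'cV[R]_N) i j : separated (fun i j => e i j) 0 x -> y i ord0 < y j ord0 -> x i ord0 < x j ord0.
  by move=> /forallP/(_ i)/forallP/(_ j); rewrite !ffunE addr0 => /implyP.
have adm (r r' : 'I_N) : r' = r.+1 :> nat -> ranked y r = ranked y r' ->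
    admissible (fun i j => e i j) (p r) (p r') r r'.
  move=> rr' er x sx.
  by rewrite (pair_rank_sum rr' er nt (fun i j => sepE x i j sx) (fun i => sigma i ^+ 2)) scaleK.
have un : uniq [:: p k; p k'; p l; p l'].
  rewrite -[X in uniq X]/(map p [:: k; k'; l; l']) (map_inj_uniq perm_inj) /= !inE !negb_or.
  rewrite -!(inj_eq val_inj) /=.
  have := contra_not (@val_inj _ _ _ k l) kl.
  have := contra_not (@val_inj _ _ _ k' l) kl'; have := contra_not (@val_inj _ _ _ l' k) lk'.
  move: kk' ll' => /=; lia.
set D1 := diff_process (p k) (p k') k k'; set D2 := diff_process (p l) (p l') l l'.
have D1t : D1 t w = 0.
  have E : y (p k) ord0 = y (p k') ord0 := ek.
  by rewrite /D1 /diff_process /scaled_diff /coord -/y E subrr mulr0.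
have D2t : D2 t w = 0.
  have E : y (p l) ord0 = y (p l') ord0 := el.
  by rewrite /D2 /diff_process /scaled_diff /coord -/y E subrr mulr0.
have t_ge0 := ltW t0.
(* Near t each coordinate moves by less than 1 / (m + 1): of a gap exceeding 3 / (m + 1), two thirds
   of this bound cover the motion of both ends and one third is left as the margin. *)
have [m hm] : exists m : nat, forall i j, y i ord0 < y j ord0 -> 3 * m.+1%:R^-1 < y j ord0 - y i ord0.
  pose gap := \big[Num.min/1]_(ij : 'I_N * 'I_N | y ij.1 ord0 < y ij.2 ord0) (y ij.2 ord0 - y ij.1 ord0).
  have gap0 : 0 < gap / 3.
    rewrite divr_gt0// /gap; elim/big_ind: _ => // [u v u0 v0|ij]; first by rewrite lt_min u0.
    by rewrite subr_gt0.
  have [m hm] := inv_succ_lt gap0; exists m => i j yij.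
  rewrite mulrC -ltr_pdivlMr//; apply: lt_le_trans hm _; rewrite ler_pM2r ?invr_gt0//.
  exact: (@bigmin_le_cond _ _ _ _ (i, j)).
have i0 n : 0 < n.+1%:R^-1 :> R by rewrite invr_gt0 ltr0n.
have hc i := continuous_paths_near w (@cX i) t_ge0 (i0 m).
have half : 0 < 1 / 2 :> R by [].
have [h1 h10 hD1] := continuous_paths_near w (@cD (p k) (p k') k k') t_ge0 half.
have [h2 h20 hD2] := continuous_paths_near w (@cD (p l) (p l') l l') t_ge0 half.
(* The bound by t keeps the times of ]t - h, t] nonnegative; the others keep the path in the
   separated region and in the unit disc. *)
pose h := Num.min t (Num.min (Num.min h1 h2) (\big[Num.min/1]_(i < N) sval (cid2 (hc i)))).
have h0 : 0 < h.
  rewrite !lt_min t0 h10 h20 /=; elim/big_ind: _ => // [u v u0 v0|i _]; first by rewrite lt_min u0.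
  by case: cid2.
have near v : 0 <= v -> `|t - v| < h ->
    separated (fun i j => e i j) m.+1%:R^-1 (X v w) /\ radius2 D1 D2 v w <= 1.
  move=> v0; rewrite !lt_min => /and3P[_ /andP[/(hD1 v v0) d1 /(hD2 v v0) d2] hb]; split.
    apply/forallP => i; apply/forallP => j; apply/implyP; rewrite !ffunE => /hm.
    have ci i' : `|coord X i' t w - coord X i' v w| < m.+1%:R^-1.
      have : `|t - v| < sval (cid2 (hc i')) by apply: lt_le_trans hb _; exact: bigmin_le_cond.
      by case: cid2 => /= z _ hz; exact: hz.
    have := ci i; have := ci j; rewrite /coord -/y !ltr_norml.
    move: (m.+1%:R^-1) (X v w i ord0) (X v w j ord0) (y i ord0) (y j ord0) => z x1 x2 x3 x4.
    by move=> /andP[b1 b2] /andP[b3 b4] b5; lra.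
  have sq z : `|0 - z| < 1 / 2 -> z ^+ 2 <= 1 / 2 :> R.
    rewrite sub0r normrN => hz; rewrite -[z ^+ 2]real_normK ?num_real//.
    by have := normr_ge0 z; nra.
  by move: d1 d2; rewrite -/D1 -/D2 D1t D2t => /sq d1 /sq d2; rewrite /radius2; lra.
have th : 0 <= t - h by rewrite subr_ge0 ge_min lexx.
have dist v : t - h < v -> v <= t -> `|t - v| < h.
  by move=> v1 v2; rewrite ger0_norm ?subr_ge0//; lra.
have pos v : t - h < v -> 0 <= v by move=> v1; exact: le_trans (ltW v1).
(* If the pair of differences is nonzero somewhere shortly before t, it hits the origin from a
   positive distance; otherwise it vanishes on a whole interval. *)
have [[s [s1 s2 s3]]|hz] := pselect (exists s, [/\ t - h < s, s < t & radius2 D1 D2 s w != 0]).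
  have [q q1 q2] : exists2 q : rat, t - h < ratr q < t & radius2 D1 D2 (ratr q) w != 0.
    have [z z0 hzz] : exists2 z, 0 < z & forall v, 0 <= v -> `|s - v| < z -> radius2 D1 D2 v w != 0.
      have [e1|n1] := eqVneq (D1 s w) 0; last first.
        have [z z0 hzz] := nonzero_near (@cD (p k) (p k') k k') (pos s s1) n1.
        exists z => // v v0 /(hzz v v0) nz; rewrite /radius2 gt_eqF//.
        by rewrite ltr_pwDl ?sqr_ge0// lt0r sqrf_eq0 nz sqr_ge0.
      have n2 : D2 s w != 0.
        by apply: contra s3 => /eqP e2; rewrite /radius2 e1 e2 expr0n addr0.
      have [z z0 hzz] := nonzero_near (@cD (p l) (p l') l l') (pos s s1) n2.
      exists z => // v v0 /(hzz v v0) nz; rewrite /radius2 gt_eqF//.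
      by rewrite ltr_wpDl ?sqr_ge0// lt0r sqrf_eq0 nz sqr_ge0.
    (* The nonvanishing is an open condition, so s may be replaced by a rational time between s and
       t. *)
    have lt_s : s < Num.min t (s + z) by rewrite lt_min s2 ltrDl.
    have [q] := rat_in_itvoo lt_s; rewrite in_itv/= lt_min => /and3P[q1 q2 q3].
    exists q; first by rewrite (lt_trans s1 q1).
    apply: hzz; first by apply: pos; exact: lt_trans q1.
    by rewrite distrC ger0_norm ?subr_ge0 ?ltW//; lra.
  case/andP: q1 => q1 q1'.
  have [r hr] : exists r : nat, r.+1%:R^-1 < radius2 D1 D2 (ratr q) w.
    by apply: inv_succ_lt; rewrite lt0r q2 addr_ge0 ?sqr_ge0.
  (* t itself may be irrational; the interval of [hit_set] ends at any rational t1 beyond it, as the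
     region is only required up to the hitting time. *)
  have [t1] := rat_in_itvoo (ltr_pwDr ltr01 (lexx t)); rewrite in_itv/= => /andP[t1t _].
  have [nh _] := hw e (p k) (p k') (p l) (p l') k k' l l' q t1 m r un (pos _ q1)
    (lt_trans q1' t1t) (adm _ _ kk' ek) (adm _ _ ll' el).
  apply: nh; split => //; exists t; split; [exact: ltW|exact: ltW| |].
    by rewrite -/D1 -/D2 /radius2 D1t D2t expr0n addr0.
  by move=> v qv vt; have v1 := lt_le_trans q1 qv; exact: near (pos _ v1) (dist _ v1 vt).
have hlt : t - h < t by rewrite ltrBlDr ltrDl.
have [q] := rat_in_itvoo hlt; rewrite in_itv/= => /andP[q1 q2].
have [t1] := rat_in_itvoo q2; rewrite in_itv/= => /andP[t1q t1t].
have [_ nz] := hw e (p k) (p k') (p l) (p l') k k' l l' q t1 m 0%N un (pos _ q1) t1q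
  (adm _ _ kk' ek) (adm _ _ ll' el).
apply: nz => v qv vt; have v1 := lt_le_trans q1 qv; have v2 := le_lt_trans vt t1t.
split; first exact: (near v (pos _ v1) (dist _ v1 (ltW v2))).1.
by apply/eqP/negPn/negP => vz; apply: hz; exists v.
Qed.

End simultaneous_collisions.

Theorem corollary1p5 (R : realType) (d : measure_display)
    (T : measurableType d) (P : probability T R) (F : R -> set_system T)
    (hF : usual_conditions P F)
    (N : nat) (hN : (2 <= N)%N) (g sigma : 'I_N -> R)
    (hsigma : forall k, 0 < sigma k)
    (W : 'I_N -> R -> T -> R) (X : R -> T -> 'cV[R]_N)
    (hX : classical_competing_brownian_particles P F g sigma W X)
    (htriple : {ae P, forall w, forall t, 0 < t -> ~ triple_collision (X t w)}) :
  {ae P, forall w, forall t, 0 < t -> ~ simultaneous_collision (X t w)}.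
Proof.
apply: filterS2 (no_approach_ae hF hX) htriple => w.
exact: (no_simultaneous_collision hsigma hX).
Qed.
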